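(* Let $A$ be a complex abelian variety of dimension $g$, let $m\geq 1$, and let $x_1,\ldots,x_m,y_1,\ldots,y_m\in A$ be closed points. Then $$\sum_{i=1}^m[x_i]=\sum_{i=1}^m[y_i]\ \text{ in }\mathrm{CH}_0(A)\iff \sum_{i=1}^m[x_i]=\sum_{i=1}^m[y_i]\ \text{ in }\mathrm{CH}_0(A)/F_{\mathrm B}^{m+1}\mathrm{CH}_0(A).$$
   Context: Chow groups have rational coefficients; $[x]$ is the class in $\mathrm{CH}_0(A)=\mathrm{CH}^g(A)$ of a closed point $x$. For an integer $k$, let $[k]:A\to A$ be multiplication by $k$. The graded pieces of the Beauville decomposition of $\mathrm{CH}^g(A)$ are $$\mathrm{CH}^g_{(s)}(A)=\{\alpha\in\mathrm{CH}^g(A): [k]^*\alpha=k^{2g-s}\alpha\ \text{for all }k\in\mathbb Z\},$$ and $F_{\mathrm B}^{m+1}\mathrm{CH}_0(A)=\bigoplus_{s=m+1}^g\mathrm{CH}^g_{(s)}(A)$. *)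

(* Defs.v *)
From HB Require Import structures.
From mathcomp Require Import all_boot all_order all_algebra.
From mathcomp Require Import generic_quotient ring_quotient.
From mathcomp Require Import mpoly freeg complex.
From mathcomp Require Import boolp reals.

Set Implicit Arguments.
Unset Strict Implicit.
Unset Printing Implicit Defensive.

Import GRing.Theory.
Local Open Scope ring_scope.
Local Open Scope quotient_scope.

(* Varieties are classical: over an algebraically closed field K, a variety is
   its set of closed points.  A projective variety in P(K^N) is a type T with
   a map c : T -> 'rV[K]_N choosing homogeneous coordinates for every point;
   no notion below depends on the choice of representatives. *)

Section ZariskiTopology.

Variables (K : closedFieldType) (N : nat).

Definition form_eval (F : {mpoly K[N]}) (v : 'rV[K]_N) : K :=
  F.@[fun i => v 0 i].

Variables (T : Type) (c : T -> 'rV[K]_N).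

Definition zclosed (Z : T -> Prop) : Prop :=
  exists S : {mpoly K[N]} -> Prop,
    (forall F, S F -> exists d : nat, F \is d.-homog) /\
    (forall x, Z x <-> forall F, S F -> form_eval F (c x) = 0).

Definition irreducible_closed (Z : T -> Prop) : Prop :=
  [/\ zclosed Z,
      exists x, Z x
    & forall Z1 Z2, zclosed Z1 -> zclosed Z2 ->
        (forall x, Z x -> Z1 x \/ Z2 x) ->
        (forall x, Z x -> Z1 x) \/ (forall x, Z x -> Z2 x)].

Definition irreducible_chain (r : nat) (Z : nat -> T -> Prop) : Prop :=
  (forall i, (i <= r)%N -> irreducible_closed (Z i)) /\
  (forall i, (i < r)%N ->
     (forall x, Z i x -> Z i.+1 x) /\ (exists x, Z i.+1 x /\ ~ Z i x)).

Definition has_dim (n : nat) : Prop :=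
  (exists Z, irreducible_chain n Z) /\
  (forall r Z, irreducible_chain r Z -> (r <= n)%N).

Definition is_projective_variety : Prop :=
  [/\ forall x, c x != 0,
      forall x y (a : K), c y = a *: c x -> x = y,
      exists S : {mpoly K[N]} -> Prop,
        (forall F, S F -> exists d : nat, F \is d.-homog) /\
        (forall v, v != 0 ->
           ((forall F, S F -> form_eval F v = 0) <->
            exists x, exists a : K, v = a *: c x))
    & irreducible_closed (fun _ => True)].

(* P holds on a Zariski neighbourhood of x *)
Definition near_pt (x : T) (P : T -> Prop) : Prop :=
  exists (d : nat) (H : {mpoly K[N]}),
    [/\ H \is d.-homog, form_eval H (c x) != 0
      & forall y, form_eval H (c y) != 0 -> P y].

(* Elements of the local ring at x are represented by functions on all of T,
   two of which have the same germ when they agree near x. *)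
Definition regular_at (x : T) (phi : T -> K) : Prop :=
  exists (d : nat) (F G : {mpoly K[N]}),
    [/\ F \is d.-homog, G \is d.-homog
      & near_pt x (fun y => form_eval G (c y) != 0 /\
                            phi y = form_eval F (c y) / form_eval G (c y))].

(* t generates the maximal ideal of the local ring at x *)
Definition uniformizer (x : T) (t : T -> K) : Prop :=
  [/\ regular_at x t, t x = 0
    & forall phi, regular_at x phi -> phi x = 0 ->
        exists2 psi, regular_at x psi & near_pt x (fun y => phi y = t y * psi y)].

(* the order at x of the rational function F / G is r: near x, one has
   F / G = u t^(a - b) with u a unit, t a uniformizer and r = a - b *)
Definition order_at (x : T) (F G : {mpoly K[N]}) (r : int) : Prop :=
  exists (t u : T -> K) (a b : nat),
    [/\ uniformizer x t, regular_at x u, u x != 0, r = a%:Z - b%:Z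
      & near_pt x (fun y => form_eval F (c y) * t y ^+ b
                            = u y * t y ^+ a * form_eval G (c y))].

End ZariskiTopology.

(* homogeneous coordinates on a product, by the Segre embedding *)
Definition segre (K : closedFieldType) (M N : nat) (T U : Type)
    (c : T -> 'rV[K]_M) (c' : U -> 'rV[K]_N) (p : T * U) : 'rV[K]_(M * N) :=
  mxvec ((c p.1)^T *m c' p.2).

(* Morphisms of spaces with functions; continuity is a consequence, because
   the nonvanishing loci of regular functions form a basis of open sets. *)
Definition is_morphism (K : closedFieldType) (M N : nat) (T U : Type)
    (c : T -> 'rV[K]_M) (c' : U -> 'rV[K]_N) (f : T -> U) : Prop :=
  forall (x : T) (phi : U -> K),
    regular_at c' (f x) phi -> regular_at c x (fun y => phi (f y)).

Record projVariety (K : closedFieldType) := ProjVariety {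
  pv_pt :> choiceType;
  pv_size : nat;
  pv_coord : pv_pt -> 'rV[K]_pv_size;
  pv_axiom : is_projective_variety pv_coord }.

Definition is_smooth_curve (K : closedFieldType) (C : projVariety K) : Prop :=
  has_dim (@pv_coord K C) 1 /\
  forall x : C, exists t, uniformizer (@pv_coord K C) x t.

Section FibreMultiplicity.

Variables (K : closedFieldType) (X Y : projVariety K) (f : X -> Y).

(* the ideal generated in the local ring at x by the pullback of the maximal
   ideal of f x *)
Definition fibre_ideal (x : X) (phi : X -> K) : Prop :=
  exists s : seq ((Y -> K) * (X -> K)),
    (forall i, (i < size s)%N ->
       let p := nth (fun=> 0, fun=> 0) s i in
       [/\ regular_at (@pv_coord K Y) (f x) p.1, p.1 (f x) = 0
         & regular_at (@pv_coord K X) x p.2]) /\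
    near_pt (@pv_coord K X) x (fun y => phi y = \sum_(p <- s) p.1 (f y) * p.2 y).

(* The local ring of the scheme-theoretic fibre of f at x has length e; the
   residue field being K, the length is the K-dimension. *)
Definition fibre_mult (x : X) (e : nat) : Prop :=
  exists b : 'I_e -> X -> K,
    (forall j, regular_at (@pv_coord K X) x (b j)) /\
    (forall phi, regular_at (@pv_coord K X) x phi ->
       exists! v : 'rV[K]_e,
         fibre_ideal x (fun y => phi y - \sum_j v 0 j * b j y)).

End FibreMultiplicity.

Section ChowGroup.

Variables (K : closedFieldType).

Definition cycle0 (X : projVariety K) := {freeg X / rat}.

Definition push_cycle (X Y : projVariety K) (f : X -> Y) (D : cycle0 X)
    : cycle0 Y :=
  fglift (fun x => << f x >> : cycle0 Y) D.

Definition is_divisor (C : projVariety K) (F G : {mpoly K[pv_size C]})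
    (D : cycle0 C) : Prop :=
  forall x : C, exists2 r : int,
    order_at (@pv_coord K C) x F G r & coeff x D = r%:~R.

Variable X : projVariety K.

(* nu_*(div h) for a morphism nu from a smooth projective curve C to X and a
   nonzero rational function h = F / G on C.  Normalizations of curves in X are
   among the nu, and the other nu add nothing to the subgroup generated, since
   proper push-forward preserves rational equivalence. *)
Definition principal_cycle (alpha : cycle0 X) : Prop :=
  exists (C : projVariety K) (nu : C -> X) (d : nat)
         (F G : {mpoly K[pv_size C]}) (D : cycle0 C),
    [/\ is_smooth_curve C /\ is_morphism (@pv_coord K C) (@pv_coord K X) nu,
        F \is d.-homog /\ G \is d.-homog,
        (exists x : C, form_eval F (pv_coord x) != 0) /\
        (exists x : C, form_eval G (pv_coord x) != 0),
        is_divisor F G D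
      & alpha = push_cycle nu D].

Definition rat_trivial (alpha : cycle0 X) : Prop :=
  exists s : seq (rat * cycle0 X),
    (forall p, p \in s -> principal_cycle p.2) /\
    alpha = \sum_(p <- s) p.1 *: p.2.

Definition rat_trivial_pred : {pred cycle0 X} :=
  fun alpha => `[< rat_trivial alpha >].

Lemma rat_trivial_zmod_closed : zmod_closed rat_trivial_pred.
Proof.
split; first by apply/asboolP; exists [::]; split=> //; rewrite big_nil.
move=> a b /asboolP[s [Hs ->]] /asboolP[t [Ht ->]]; apply/asboolP.
exists (s ++ [seq (- p.1, p.2) | p <- t]); split=> [p|].
  by rewrite mem_cat => /orP[/Hs //|/mapP[q /Ht Hq ->]].
rewrite big_cat big_map /= -sumrN; congr (_ + _).
by apply: eq_bigr => p _; rewrite scaleNr.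
Qed.

HB.instance Definition _ :=
  GRing.isZmodClosed.Build _ rat_trivial_pred rat_trivial_zmod_closed.

Definition CH0 := Quotient.quot rat_trivial_pred.

HB.instance Definition _ := Quotient.on CH0.
HB.instance Definition _ := GRing.Zmodule.on CH0.

Definition CH0_class (alpha : cycle0 X) : CH0 := \pi_CH0 alpha.

Lemma CH0_classP (alpha beta : cycle0 X) :
  CH0_class alpha = CH0_class beta <-> rat_trivial (alpha - beta).
Proof.
have E := Quotient.idealrBE rat_trivial_pred alpha beta.
split=> [H|H].
  apply/asboolP; rewrite -[X in is_true X]/(alpha - beta \in rat_trivial_pred).
  by rewrite E; apply/eqP.
by apply/eqP; rewrite -[_ == _]E; apply/asboolP.
Qed.

Lemma CH0_classD : {morph CH0_class : a b / a + b}.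
Proof. exact: (@Quotient.pi_add _ rat_trivial_pred). Qed.

Lemma CH0_class_repr (a : CH0) : CH0_class (repr a) = a.
Proof. exact: reprK. Qed.

Lemma rat_trivialZ (q : rat) (alpha : cycle0 X) :
  rat_trivial alpha -> rat_trivial (q *: alpha).
Proof.
move=> [s [Hs ->]]; exists [seq (q * p.1, p.2) | p <- s]; split.
  by move=> p /mapP[r /Hs Hr ->].
by rewrite big_map scaler_sumr; apply: eq_bigr => p _; rewrite scalerA.
Qed.

Definition CH0_scale (q : rat) (a : CH0) : CH0 := CH0_class (q *: repr a).

Lemma CH0_classZ q alpha : CH0_class (q *: alpha) = CH0_scale q (CH0_class alpha).
Proof.
apply/CH0_classP; rewrite -scalerBr; apply: rat_trivialZ.
by apply/CH0_classP; rewrite CH0_class_repr.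
Qed.

Fact CH0_scalerA (p q : rat) (a : CH0) :
  CH0_scale p (CH0_scale q a) = CH0_scale (p * q) a.
Proof. by rewrite -(CH0_class_repr a) -!CH0_classZ scalerA. Qed.

Fact CH0_scale1r : left_id 1 CH0_scale.
Proof. by move=> a; rewrite -(CH0_class_repr a) -CH0_classZ scale1r. Qed.

Fact CH0_scalerDr : right_distributive CH0_scale +%R.
Proof.
move=> q a b; rewrite -(CH0_class_repr a) -(CH0_class_repr b).
by rewrite -CH0_classD -!CH0_classZ -CH0_classD scalerDr.
Qed.

Fact CH0_scalerDl (a : CH0) : {morph CH0_scale^~ a : p q / p + q}.
Proof.
move=> p q; rewrite -(CH0_class_repr a).
by rewrite -!CH0_classZ -CH0_classD scalerDl.
Qed.

HB.instance Definition _ := GRing.Zmodule_isLmodule.Build rat CH0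
  CH0_scalerA CH0_scale1r CH0_scalerDr CH0_scalerDl.

Definition pt_class (x : X) : CH0 := CH0_class (<< x >> : cycle0 X).

End ChowGroup.

Arguments pt_class {K X} x.

(* The group law of an abelian variety is commutative, so it is taken to be a
   zmodType; irreducibility is part of [is_projective_variety], and smoothness
   is automatic for a group variety over the closed field K. *)
Record abelianVariety (K : closedFieldType) := AbelianVariety {
  av_pt :> zmodType;
  av_size : nat;
  av_coord : av_pt -> 'rV[K]_av_size;
  av_axiom : is_projective_variety av_coord;
  av_add : is_morphism (segre av_coord av_coord) av_coord
             (fun p : av_pt * av_pt => p.1 + p.2);
  av_opp : is_morphism av_coord av_coord (fun x : av_pt => - x) }.

Coercion av_variety (K : closedFieldType) (A : abelianVariety K) : projVariety K :=
  ProjVariety (av_axiom A).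

Section Beauville.

Variables (K : closedFieldType) (A : abelianVariety K) (g : nat).

Definition mulz_pt (k : int) (x : A) : A := x *~ k.

(* beta = [k]^* alpha.  If k != 0 then [k] is flat, and [k]^* is flat pullback:
   [k]^*[y] is the cycle of the scheme-theoretic fibre over y; the same holds
   if g = 0.  If g > 0 then [0]^* factors through CH^g of a point, which is 0. *)
Definition pullback_cycle (k : int) (alpha beta : cycle0 A) : Prop :=
  if (k == 0) && (0 < g)%N then beta = 0
  else forall x : A, exists2 e : nat,
    @fibre_mult K A A (mulz_pt k) x e
    & coeff x beta = e%:R * coeff (mulz_pt k x) alpha.

(* the graph of [k]^* on CH^g(A) = CH_0(A) *)
Definition is_pullback (k : int) (a b : CH0 A) : Prop :=
  exists alpha beta : cycle0 A,
    [/\ CH0_class alpha = a, CH0_class beta = b & pullback_cycle k alpha beta].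

(* CH^g_(s)(A), for s <= g *)
Definition beauville_piece (s : nat) (a : CH0 A) : Prop :=
  forall k : int, is_pullback k a (k%:~R ^+ (2 * g - s) *: a).

(* F_B^n CH_0(A), the sum of the CH^g_(s)(A) for n <= s <= g *)
Definition beauville_filtration (n : nat) (a : CH0 A) : Prop :=
  exists a_ : nat -> CH0 A,
    (forall s, (n <= s <= g)%N -> beauville_piece s (a_ s)) /\
    a = \sum_(n <= s < g.+1) a_ s.

(* equality of the images in the quotient CH_0(A) / F_B^n CH_0(A) *)
Definition eq_mod_filtration (n : nat) (a b : CH0 A) : Prop :=
  beauville_filtration n (a - b).

End Beauville.

(* Main.v *)
(* Let [k] be multiplication by k and N_k the order of its kernel.  Since [k] is
   etale, [k]^*[x] is the sum of the preimages of x.  A nonzero class in some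
   CH^g_(s)(A) therefore makes every N_k finite, hence [k] surjective, and [k]_*
   acts on CH^g_(s)(A) as N_k k^(s - 2g).  If the difference of the two sums is
   a sum of classes c_s in CH^g_(s)(A) with s > m, applying [k]_* gives
     sum_i [k x_i] - sum_i [k y_i] = sum_(s > m) mu_k k^s c_s,
   where mu_k = N_k / k^(2g) is multiplicative in k.  For the Pontryagin product
   the cycles supported on the subgroup generated by finitely many points are
   values of polynomials, rationally trivial cycles form an ideal, and [k x_i]
   is the k-th power of a variable X_i.  Newton's identities give the left hand
   side a linear recurrence of order m modulo suitable ideals.  A multiplicative
   sequence with a linear recurrence is a power of k, so mu_k = k^u, and for
   u >= 0 a polynomial sequence of degree > m satisfies no such recurrence:
   hence all c_s vanish.

   The inequality u >= 0, that is N_2 >= 4^g, is an entropy count.  Near 0 the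
   addition law is tangent to vector addition, so division by 2^j contracts a
   neighbourhood of 0 by any theta^j with theta < 2, and by compactness A is
   covered by O(N_2^j) translates of sets of size O(theta^-j).  On the other
   hand A maps by polynomials onto a polydisc in K^g. *)

Require Import Defs.
From HB Require Import structures.
From mathcomp Require Import freeg.
From mathcomp Require Import all_boot all_order all_algebra all_field.
From mathcomp Require Import generic_quotient ring_quotient fraction mpoly complex.
From mathcomp Require Import boolp classical_sets reals ring lra zify.

Set Implicit Arguments.
Unset Strict Implicit.
Unset Printing Implicit Defensive.

Import Order.TTheory GRing.Theory Num.Theory.
Local Open Scope ring_scope.

(** * Ideals and residue fields *)

(** The obstacle is that cycles modulo rational equivalence have nilpotents under the Pontryagin
    product. Over a field, a difference of power sums that equals a polynomial without constant term
    vanishes, so passing to residue fields shows only that the [c_s] are nilpotent. The suitable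
    ideals are those maximal among the ideals that miss some [c_s]: modulo such an ideal the [c_s]
    span a simple module, their pairwise products vanish, and Newton's identities become linear in
    the differences of power sums. This brings the order of the recurrence down to [m], from the
    [2 m] that the X_i and Y_i together would give. The orders N_k are not computed by intersection
    theory. Multiplicativity comes from functoriality on one nonzero class, and once mu_k = k^u with
    an integer u, the single inequality for k = 2 fixes the sign of u. The entropy count suffices
    for it because two growth rates are compared, so all constants disappear as j tends to
    infinity. *)

Section PrimeQuotient.

Local Open Scope quotient_scope.

Variable R : comNzRingType.

Definition is_ideal (I : R -> Prop) : Prop :=
  [/\ I 0, forall x y, I x -> I y -> I (x + y) & forall a x, I x -> I (a * x)].

Record prime_ideal := PrimeIdeal {
  prime_car :> R -> Prop;
  prime_is_ideal : is_ideal prime_car;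
  prime_proper : ~ prime_car 1;
  primeP : forall x y, prime_car (x * y) -> prime_car x \/ prime_car y }.

Lemma ideal0 I : is_ideal I -> I 0. Proof. by case. Qed.

Lemma idealD I x y : is_ideal I -> I x -> I y -> I (x + y).
Proof. by case=> _ D _; exact: D. Qed.

Lemma ideal_mull I a x : is_ideal I -> I x -> I (a * x).
Proof. by case=> _ _ M; exact: M. Qed.

Lemma ideal_mulr I a x : is_ideal I -> I x -> I (x * a).
Proof. by rewrite mulrC; exact: ideal_mull. Qed.

Lemma idealN I x : is_ideal I -> I x -> I (- x).
Proof. by rewrite -mulN1r; exact: ideal_mull. Qed.

Lemma idealB I x y : is_ideal I -> I x -> I y -> I (x - y).
Proof. by move=> HI Ix Iy; apply: idealD => //; apply: idealN. Qed.

Lemma ideal_sum I (T : Type) (r : seq T) (P : pred T) F :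
  is_ideal I -> (forall i, P i -> I (F i)) -> I (\sum_(i <- r | P i) F i).
Proof. by move=> HI HF; apply: big_ind => //; [exact: ideal0 | move=> *; exact: idealD]. Qed.

Definition prime_pred (P : prime_ideal) : {pred R} := fun x => `[< P x >].

Variable P : prime_ideal.

Fact prime_idealr_closed_pred : idealr_closed (prime_pred P).
Proof.
have HP := prime_is_ideal P; split.
- by apply/asboolP; exact: ideal0 HP.
- by apply/asboolP; exact: prime_proper.
- move=> a x y /asboolP Px /asboolP Py; apply/asboolP.
  by apply: idealD => //; exact: ideal_mull.
Qed.

HB.instance Definition _ := isIdealr.Build R (prime_pred P) prime_idealr_closed_pred.

Fact prime_prime_pred : prime_idealr_closed (prime_pred P).
Proof. by move=> x y /asboolP /primeP[]h; apply/orP; [left|right]; apply/asboolP. Qed.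

HB.instance Definition _ := isPrimeIdealrClosed.Build R (prime_pred P) prime_prime_pred.

Definition prime_quot := Quotient.quot (prime_pred P).
HB.instance Definition _ := GRing.ComNzRing.on prime_quot.

(** A fraction field is formed over an integral domain, whose structure includes that of a unit
    ring. Inverses are therefore chosen classically, and elements without an inverse are sent to
    themselves. *)
Definition pq_unit : {pred prime_quot} := fun x => `[< exists y, y * x = 1 >].
Definition pq_inv (x : prime_quot) : prime_quot :=
  if pselect (exists y, y * x = 1) is left e then projT1 (cid e) else x.

Fact pq_mulVx : {in pq_unit, left_inverse 1 pq_inv *%R}.
Proof.
move=> x /asboolP ex; rewrite /pq_inv; case: pselect => // e.
by case: (cid e).
Qed.

Fact pq_unitPl (x y : prime_quot) : y * x = 1 -> x \in pq_unit.
Proof. by move=> e; apply/asboolP; exists y. Qed.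

Fact pq_inv_out : {in [predC pq_unit], pq_inv =1 id}.
Proof.
move=> x /asboolP nx; rewrite /pq_inv; case: pselect => // e.
Qed.

HB.instance Definition _ := GRing.ComNzRing_hasMulInverse.Build prime_quot
  pq_mulVx pq_unitPl pq_inv_out.

Fact pq_domain (x y : prime_quot) : x * y = 0 -> (x == 0) || (y == 0).
Proof. exact: Quotient.rquot_IdomainAxiom. Qed.

HB.instance Definition _ := GRing.ComUnitRing_isIntegral.Build prime_quot pq_domain.

Definition to_pq (x : R) : prime_quot := \pi_(prime_quot) x.

Fact to_pq_zmod : zmod_morphism to_pq.
Proof. by move=> x y; rewrite /to_pq raddfB. Qed.
Fact to_pq_mul : monoid_morphism to_pq.
Proof. by split=> [|x y]; rewrite /to_pq ?rmorph1 ?rmorphM. Qed.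
HB.instance Definition _ := GRing.isZmodMorphism.Build R prime_quot to_pq to_pq_zmod.
HB.instance Definition _ := GRing.isMonoidMorphism.Build R prime_quot to_pq to_pq_mul.

Lemma to_pq_eq0 x : (to_pq x = 0) <-> P x.
Proof.
have E := Quotient.idealrBE (prime_pred P) x 0.
rewrite subr0 in E; split=> [h|h].
  apply/asboolP; rewrite -[X in is_true X]/(x \in prime_pred P) E.
  by apply/eqP; rewrite -/(to_pq x) h /to_pq raddf0.
by rewrite -(raddf0 to_pq); apply/eqP; rewrite -[_ == _]E; apply/asboolP.
Qed.

End PrimeQuotient.

Arguments ideal_mull {R I} [a x].
Arguments ideal_mulr {R I} [a x].

(** Serves for the annihilator of a simple module and for the ideal of an affine chart of the
    variety, where the field is the function field. *)
Theorem prime_residue_field (R : comNzRingType) (P : prime_ideal R) :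
  exists (L : fieldType) (h : {rmorphism R -> L}), forall x, h x = 0 <-> P x.
Proof.
exists {fraction (prime_quot P)}, (@tofrac _ \o @to_pq R P)%FUN => x /=.
rewrite -to_pq_eq0; split=> [/eqP|->]; last by rewrite tofrac0.
by rewrite tofrac_eq0 => /eqP.
Qed.

(** * Linear recurrences and Newton's identities *)

Section ShiftAction.

Variable F : fieldType.
Hypothesis F0 : forall n, n.+1%:R != 0 :> F.

Definition shiftp (Q : {poly F}) := Q \Po ('X + 1%:P).

(** The polynomial [r] in the shift operator, applied to [Q]. Its value at an integer is the left
    hand side of the linear recurrence with coefficients [r]. *)
Definition shift_act (r Q : {poly F}) : {poly F} :=
  \sum_(i < size r) r`_i *: iter i shiftp Q.

Lemma shift_act_wide n (r Q : {poly F}) : (size r <= n)%N ->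
  shift_act r Q = \sum_(i < n) r`_i *: iter i shiftp Q.
Proof.
move=> le; rewrite /shift_act (big_ord_widen n (fun i => r`_i *: iter i shiftp Q) le).
rewrite big_mkcond /=; apply: eq_bigr => i _; case: ltnP => // h.
by rewrite nth_default ?scale0r.
Qed.

Lemma shiftpD (P Q : {poly F}) : shiftp (P + Q) = shiftp P + shiftp Q.
Proof. by rewrite /shiftp comp_polyD. Qed.

Lemma iter_shiftpB i (P Q : {poly F}) :
  iter i shiftp (P - Q) = iter i shiftp P - iter i shiftp Q.
Proof. by elim: i => //= i ->; rewrite /shiftp rmorphB. Qed.

Lemma shift_actM_XsubC (r Q : {poly F}) :
  shift_act (r * ('X - 1%:P)) Q = shift_act r (shiftp Q - Q).
Proof.
set n := size r.
have h1 : (size (r * ('X - 1%:P))%R <= n.+1)%N.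
  by apply: leq_trans (size_polyMleq _ _) _; rewrite size_XsubC addn2.
rewrite (shift_act_wide _ h1) /shift_act -/n.
under eq_bigr => i _ do rewrite mulrBr polyC1 mulr1 coefB scalerBl.
rewrite sumrB big_ord_recl coefMX /= scale0r add0r big_ord_recr /=.
rewrite [r`_n]nth_default // scale0r addr0 -sumrB.
apply: eq_bigr => i _; rewrite iter_shiftpB scalerBr coefMX /=.
by rewrite -iterS iterSr.
Qed.

(** Each [(X + 1)^i - X^i] has degree below [i], so only [i = n + 1] contributes to degree [n], with
    the binomial coefficient [n + 1]. *)
Lemma coef_shiftp_diff n (Q : {poly F}) : (size Q <= n.+2)%N ->
  (shiftp Q - Q)`_n = n.+1%:R * Q`_n.+1 /\ (size (shiftp Q - Q)%R <= n.+1)%N.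
Proof.
move=> sQ.
have E : shiftp Q = \sum_(i < n.+2) Q`_i *: ('X + 1) ^+ i.
  rewrite /shiftp comp_polyE (big_ord_widen n.+2 (fun i => Q`_i *: ('X + 1%:P) ^+ i) sQ).
  rewrite big_mkcond /=; apply: eq_bigr => i _; case: ltnP => // h.
  by rewrite nth_default ?scale0r.
have E2 : Q = \sum_(i < n.+2) Q`_i *: 'X^i.
  rewrite -[LHS]coefK poly_def (big_ord_widen n.+2 (fun i => Q`_i *: 'X^i) sQ).
  rewrite big_mkcond /=; apply: eq_bigr => i _; case: ltnP => // h.
  by rewrite nth_default ?scale0r.
have C i k : (('X + 1 : {poly F}) ^+ i - 'X^i)`_k = if (k < i)%N then 'C(i, k)%:R else 0.
  rewrite exprDn coefB coef_sum coefXn.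
  under eq_bigr => j _ do rewrite expr1n mulr1 coefMn coefXn.
  case: (ltngtP k i) => h.
  - rewrite subr0.
    have hk : (i - k < i.+1)%N by rewrite ltnS leq_subr.
    rewrite (bigD1 (Ordinal hk)) //= subKn ?(ltnW h) // eqxx big1 ?addr0 => [|j hj].
      by rewrite bin_sub ?(ltnW h).
    case: eqP => [e|_]; last by rewrite mul0rn.
    by case/eqP: hj; apply: val_inj => /=; rewrite e subKn // -ltnS.
  - rewrite subr0 big1 // => j _; case: eqP => [e|_]; last by rewrite mul0rn.
    by move: h; rewrite e ltnNge leq_subr.
  - rewrite h (bigD1 ord0) //= subn0 eqxx bin0 big1 ?addr0 ?subrr // => j hj.
    case: eqP => [e|_]; last by rewrite mul0rn.
    have ji : (j <= i)%N by rewrite -ltnS ltn_ord.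
    have j0 : j = 0%N :> nat by rewrite -(subKn ji) -e subnn.
    by case/eqP: hj; apply: val_inj.
have D : shiftp Q - Q = \sum_(i < n.+2) Q`_i *: (('X + 1) ^+ i - 'X^i).
  rewrite E {2}E2 -sumrB; apply: eq_bigr => i _; by rewrite scalerBr.
have K k : (shiftp Q - Q)`_k = \sum_(i < n.+2) if (k < i)%N then Q`_i * 'C(i, k)%:R else 0.
  rewrite D coef_sum; apply: eq_bigr => i _; rewrite coefZ C; case: ifP => // _.
  by rewrite mulr0.
split.
  rewrite K big_ord_recr /= ltnSn big1 => [|i _].
    by rewrite add0r binSn mulrC.
  by rewrite ltnNge -ltnS ltn_ord.
apply/leq_sizeP => k hk; rewrite K big1 // => i _.
case: ifP => // h; have := leq_ltn_trans hk h.
by rewrite ltnNge -ltnS ltn_ord.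
Qed.

Lemma size_shiftp_diff (Q : {poly F}) : size (shiftp Q - Q) = (size Q).-1.
Proof.
case E: (size Q) => [|[|n]] /=.
- by move/eqP: E; rewrite size_poly_eq0 => /eqP->; rewrite /shiftp comp_poly0 subrr size_poly0.
- have/size_poly1P[c _ ->] : size Q == 1%N by rewrite E.
  by rewrite /shiftp comp_polyC subrr size_poly0.
- have [|e s] := @coef_shiftp_diff n Q; first by rewrite E.
  apply/eqP; rewrite eqn_leq s /= ltnNge; apply/negP => h.
  move: e; rewrite nth_default // => /esym/eqP; rewrite mulf_eq0 (negbTE (F0 _)) /=.
  have -> : Q`_n.+1 = lead_coef Q by rewrite lead_coefE E.
  by rewrite lead_coef_eq0 -size_poly_eq0 E.
Qed.

(** All shifts of [Q] have the same degree and leading coefficient, so the top coefficient of the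
    result is [s(1)] times that of [Q]. *)
Lemma shift_act_neq0 (s Q : {poly F}) : s.[1] != 0 -> Q != 0 -> shift_act s Q != 0.
Proof.
move=> s1 Q0; apply/eqP => h.
pose n := (size Q).-1.
have sz i : (size (iter i shiftp Q) = size Q) /\ (iter i shiftp Q)`_n = Q`_n.
  elim: i => //= i [IH1 IH2].
  set P := iter i _ _ in IH1 IH2 *.
  have e : shiftp P = P + (shiftp P - P) by rewrite addrCA subrr addr0.
  have P0 : (0 < size P)%N by rewrite IH1 size_poly_gt0.
  have hs : (size (shiftp P - P)%R < size P)%N by rewrite size_shiftp_diff prednK.
  split; first by rewrite e size_polyDl.
  by rewrite e coefD IH2 [X in _ + X]nth_default ?addr0 // size_shiftp_diff IH1.
have /eqP : (shift_act s Q)`_n = 0 by rewrite h coef0.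
rewrite coef_sum; under eq_bigr => i _ do rewrite coefZ (sz i).2.
rewrite -mulr_suml mulf_eq0 -lead_coefE lead_coef_eq0 (negbTE Q0) orbF.
move: s1; rewrite horner_coef.
by under eq_bigr => i _ do rewrite expr1n mulr1; move=> /negbTE ->.
Qed.

Lemma horner_iter_shiftp i (Q : {poly F}) x : (iter i shiftp Q).[x] = Q.[x + i%:R].
Proof.
elim: i x => [|i IH] x; first by rewrite addr0.
rewrite iterS /shiftp horner_comp hornerD hornerX hornerC IH; congr _.[_].
by rewrite mulrS addrA.
Qed.

Lemma poly_nat_eq0 (P : {poly F}) : (forall k : nat, P.[k.+1%:R] = 0) -> P = 0.
Proof.
move=> h; apply: (@roots_geq_poly_eq0 _ _ [seq k.+1%:R : F | k <- iota 0 (size P)]).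
- by apply/allP => _ /mapP[k _ ->]; rewrite rootE h.
- rewrite map_inj_uniq ?iota_uniq //.
  move=> a b /eqP; wlog ab : a b / (a <= b)%N.
    by move=> W; case/orP: (leq_total a b) => /W h2 e; [apply: h2|apply/esym/h2; rewrite eq_sym].
  rewrite eq_sym -subr_eq0 -natrB // subSS; case e: (b - a)%N => [|d].
    by move=> _; apply/eqP; rewrite eqn_leq ab /= -subn_eq0 e.
  by rewrite (negbTE (F0 _)).
- by rewrite size_map size_iota.
Qed.

(** Write [r = q (X - 1)^m] with [q(1) != 0]. Each factor [X - 1] acts as a difference and lowers
    the degree of [Q] by exactly one, and [q] kills no nonzero polynomial; hence [m] must reach
    [size Q]. *)
Lemma recurrence_poly_dvd (r Q : {poly F}) : Q != 0 ->
  (forall k : nat, \sum_(i < size r) r`_i * Q.[(k.+1 + i)%:R] = 0) ->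
  ('X - 1%:P) ^+ size Q %| r.
Proof.
move=> Q0 h.
have A0 : shift_act r Q = 0.
  apply: poly_nat_eq0 => k; rewrite horner_sum -[RHS](h k); apply: eq_bigr => i _.
  by rewrite hornerZ horner_iter_shiftp natrD.
have [->|r0] := eqVneq r 0; first exact: dvdp0.
have [m [q q1 er]] := multiplicity_XsubC r 1.
rewrite r0 /= in q1.
have {h} K : forall j (P : {poly F}), P != 0 -> shift_act (q * ('X - 1%:P) ^+ j) P = 0 ->
  (size P <= j)%N.
  elim=> [|j IH] P P0; first by rewrite expr0 mulr1 => /eqP; rewrite (negbTE (shift_act_neq0 _ _)).
  rewrite exprSr mulrA shift_actM_XsubC => e.
  have [z|nz] := eqVneq (shiftp P - P) 0.
    have := size_shiftp_diff P; rewrite z size_poly0.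
    by case: (size P) => [|[]].
  by have := IH _ nz e; rewrite size_shiftp_diff; case: (size P).
rewrite er; apply: dvdp_mull; apply: dvdp_exp2l; apply: K => //.
by rewrite -er.
Qed.

End ShiftAction.

Section Newton.

Variables (R : comNzRingType) (J : R -> Prop).
Hypothesis HJ : is_ideal J.
Hypothesis R0 : forall n, exists a : R, a * n.+1%:R = 1.

(** The last hypothesis says that [(D / B)'] vanishes modulo [J'] in low degrees, so [D / B] is
    constant there. The induction on the degree replaces the inverse series of [B]; integration
    divides by [n + 1]. *)
Lemma ideal_wronskian (J' : R -> Prop) N (D B : {poly R}) :
  is_ideal J' -> B`_0 = 1 -> J' D`_0 ->
  (forall n, (n < N)%N -> J' (D^`() * B - D * B^`())`_n) ->
  forall n, (n <= N)%N -> J' D`_n.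
Proof.
move=> HJ' B0 D0 h n; have [k] := ubnP n; elim: k n => // k IH [|n] // nk nN.
have := h n nN; rewrite coefB => h1.
have h2 : J' (D * B^`())`_n.
  rewrite coefM; apply: ideal_sum => // i _ /=; apply: (ideal_mulr HJ').
  by apply: IH; [rewrite (leq_trans (ltn_ord i)) | rewrite (leq_trans _ nN) // ltnW].
have := idealD HJ' h1 h2; rewrite subrK coefM big_ord_recr /= subnn B0 mulr1 coef_deriv.
move=> h3.
have h4 : J' (\sum_(i < n) D^`()`_i * B`_(n - i)).
  apply: ideal_sum => // i _ /=; apply: (ideal_mulr HJ'); rewrite coef_deriv -mulr_natl.
  apply: (ideal_mull HJ'); apply: IH; last by rewrite (leq_trans _ nN) // ltnS ltnW.
  by apply: (@leq_trans n.+1); rewrite ?ltnS // ltn_ord.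
have := idealB HJ' h3 h4; rewrite addrAC subrr add0r => h5.
have [a ea] := R0 n.
have -> : D`_n.+1 = a * (D`_n.+1 *+ n.+1) by rewrite -mulr_natl mulrA ea mul1r.
exact: (ideal_mull HJ').
Qed.

Definition recip_poly m (X : 'I_m -> R) : {poly R} := \prod_i (1 - X i *: 'X).

(** Truncation of [- A' / A] for [A = recip_poly X], the generating series of the power sums. *)
Definition psum_poly m (X : 'I_m -> R) N : {poly R} :=
  \poly_(k < N) \sum_i X i ^+ k.+1.

Lemma recip_poly0 m X : (@recip_poly m X)`_0 = 1.
Proof.
rewrite /recip_poly -horner_coef0 horner_prod big1 // => i _.
by rewrite !hornerE ?mulr0 ?subr0.
Qed.

Lemma size_recip_poly m X : (size (@recip_poly m X) <= m.+1)%N.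
Proof.
rewrite /recip_poly.
have h i : (size (1 - X i *: 'X : {poly R})%R <= 2)%N.
  apply: leq_trans (size_polyD _ _) _; rewrite size_polyN geq_max size_poly1 /=.
  by apply: leq_trans (size_scale_leq _ _) _; rewrite size_polyX.
apply: leq_trans (size_prod_leq _ _) _.
rewrite leq_subLR addnS ltnS.
have -> : (#|'I_m| + m = \sum_(i < m) 2)%N by rewrite sum_nat_const card_ord muln2 addnn.
by apply: leq_sum => i _.
Qed.

Lemma recip_poly_deriv m X N : exists U : {poly R},
  (@recip_poly m X)^`() + recip_poly X * psum_poly X N = U * 'X^N.
Proof.
rewrite /recip_poly /psum_poly.
have one (x : R) : (1 - x *: 'X : {poly R})^`() + (1 - x *: 'X) * (\poly_(k < N) x ^+ k.+1)
   = - x ^+ N.+1 *: 'X^N.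
  rewrite derivB derivC derivZ derivX sub0r poly_def.
  elim: N => [|N IH].
    by rewrite !big_ord0 mulr0 addr0 expr1 expr0 scaleNr.
  rewrite big_ord_recr /= mulrDr addrA IH mulrBl mul1r -scalerAl -scalerAr scalerA.
  by rewrite -exprS -exprS !scaleNr addrA addNr sub0r.
elim: m X => [|m IH] X.
  exists 0; rewrite !big_ord0 derivC mul0r add0r mul1r.
  by rewrite poly_def big1 // => k _; rewrite big_ord0 scale0r.
have [U eU] := IH (fun i => X (lift ord_max i)).
have W : forall i : 'I_m, lift ord_max i = widen_ord (leqnSn m) i.
  by move=> i; apply: val_inj => /=; rewrite /bump leqNgt ltn_ord.
rewrite big_ord_recr /=.
have -> : \poly_(k < N) (\sum_(i < m.+1) X i ^+ k.+1) =
  \poly_(k < N) (\sum_(i < m) X (lift ord_max i) ^+ k.+1) + \poly_(k < N) (X ord_max) ^+ k.+1.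
  apply/polyP => k; rewrite coefD !coef_poly; case: ifP; last by rewrite addr0.
  by rewrite big_ord_recr /=; under eq_bigr => i _ do rewrite -W.
under eq_bigr => i _ do rewrite -W.
have := one (X ord_max); move: eU.
set A := \prod_i _; set a := 1 - _; set P := \poly_(_ < _) _; set p := \poly_(_ < _) _.
move=> eU eu; exists (U * a - A * (X ord_max ^+ N.+1)%:P).
rewrite derivM.
have -> : A^`() * a + A * a^`() + A * a * (P + p) = (A^`() + A * P) * a + A * (a^`() + a * p) by ring.
by rewrite eU eu scaleNr -mul_polyC; ring.
Qed.

Variables (m : nat) (X Y : 'I_m -> R).
Let f k := \sum_i X i ^+ k - \sum_i Y i ^+ k.
Hypothesis ff : forall k l, J (f k.+1 * f l.+1).
Variable h : nat -> R.
Hypothesis hE : forall k, J (k.+1%:R * h k.+1 - f k.+1).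

(* log A - log B = - sum_k f(k) t^k / k, and A / B - 1 = log A - log B modulo
   the products f(k) f(l), so the coefficients of B (log A - log B) vanish
   beyond the degrees of A and B. *)
Lemma newton_recurrence n : (m < n)%N ->
  J (\sum_(i < m.+1) (recip_poly Y)`_i * h (n - i)%N).
Proof.
move=> mn; pose N := n.
set A := recip_poly X; set B := recip_poly Y.
have [U eU] := recip_poly_deriv X N; have [V eV] := recip_poly_deriv Y N.
rewrite -/A in eU; rewrite -/B in eV.
set PX := psum_poly X N in eU; set PY := psum_poly Y N in eV.
pose S := PX - PY.
have Sc k : S`_k = if (k < N)%N then f k.+1 else 0.
  by rewrite coefB !coef_poly; case: ifP => //; rewrite subrr.
have XN (W : {poly R}) k : (k < N)%N -> (W * 'X^N)`_k = 0.
  by move=> kN; rewrite coefMXn kN.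
pose D := A - B.
have wr : D^`() * B - D * B^`() = - (A * B * S) + (U * B - A * V) * 'X^N.
  rewrite /D derivB.
  have -> : (A^`() - B^`()) * B - (A - B) * B^`() = A^`() * B - A * B^`() by ring.
  have eA : A^`() = U * 'X^N - A * PX by rewrite -eU addrK.
  have eB : B^`() = V * 'X^N - B * PY by rewrite -eV addrK.
  by rewrite eA eB /S; ring.
(* The [x] with [x f(l + 1)] in [J] form an ideal modulo which all the [f] vanish. There [A] and [B]
   have the same logarithmic derivative up to degree [N], hence the same coefficients. *)
have Df k l : (k <= N)%N -> J (D`_k * f l.+1).
  pose J' x := J (x * f l.+1).
  have HJ' : is_ideal J'.
    split; rewrite /J'.
    - by rewrite mul0r; exact: ideal0.
    - by move=> x y; rewrite mulrDl; exact: idealD.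
    - by move=> a x; rewrite -mulrA; exact: (ideal_mull HJ).
  move=> kN; apply: (@ideal_wronskian J' N D B) => //.
  - exact: recip_poly0.
  - by rewrite coefB !recip_poly0 subrr; exact: ideal0 HJ'.
  move=> j jN; rewrite wr coefD (XN _ _ jN) addr0 coefN; apply: idealN => //.
  rewrite coefM; apply: ideal_sum => // i _ /=; apply: (ideal_mull HJ').
  by rewrite Sc; case: ifP => _; [exact: ff | exact: ideal0 HJ'].
(* Modulo [J], [H] is the integral of [S], and [rho = 0] is the first-order form of
   [A / B = exp (- H)]. The quadratic remainder involves [D S], which is in [J] by the previous
   step. *)
pose H := \poly_(k < N.+1) (if k == 0%N then 0 else h k).
pose rho := D + B * H.
have H1 k : J ((S - H^`())`_k).
  rewrite coefB Sc coef_deriv coef_poly ltnS; case: ifP => _ /=.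
    by rewrite -mulr_natl -opprB; apply: idealN => //; exact: hE.
  by rewrite mul0rn subrr; exact: ideal0.
have Jrho k : (k <= N)%N -> J (rho`_k).
  move=> kN; apply: (@ideal_wronskian J N rho B) => //.
  - exact: recip_poly0.
  - rewrite /rho coefD coefM big_ord1 /= coef_poly /= mulr0 addr0.
    by rewrite coefB !recip_poly0 subrr; exact: ideal0.
  move=> j jN.
  have -> : rho^`() * B - rho * B^`() =
    - (D * S * B) + (U * B - A * V) * 'X^N - B * B * (S - H^`()).
    have -> : rho^`() * B - rho * B^`() = (D^`() * B - D * B^`()) + B * B * H^`().
      by rewrite /rho derivD derivM; ring.
    by rewrite wr /D; ring.
  rewrite coefB coefD (XN _ _ jN) addr0 coefN; apply: idealB => //.
    apply: idealN => //; rewrite coefM; apply: ideal_sum => // i _ /=.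
    apply: (ideal_mulr HJ); rewrite coefM; apply: ideal_sum => // l _ /=.
    rewrite Sc; case: ifP => _; last by rewrite mulr0; exact: ideal0.
    apply: Df; apply: leq_trans (ltnW jN).
    by apply: (@leq_trans i); rewrite -ltnS.
  rewrite coefM; apply: ideal_sum => // i _ /=; apply: (ideal_mull HJ); exact: H1.
have := Jrho N (leqnn N); rewrite /rho coefD [D`_N]coefB.
rewrite [A`_N]nth_default ?[B`_N]nth_default ?subrr ?add0r; first last.
- exact: leq_trans (size_recip_poly _) mn.
- exact: leq_trans (size_recip_poly _) mn.
rewrite coefM => JN.
have hm : (m.+1 <= N.+1)%N by rewrite ltnS ltnW.
rewrite (big_ord_widen N.+1 (fun i => B`_i * h (n - i)%N) hm) big_mkcond /=.
rewrite (_ : \sum_(i < _) _ = \sum_(i < N.+1) B`_i * H`_(N - i)) //.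
apply: eq_bigr => i _; rewrite [H`__]coef_poly [(_ < N.+1)%N]ltnS leq_subr.
case: ifP => [im|/negbT im]; last first.
  by rewrite nth_default ?mul0r // (leq_trans (size_recip_poly _)) // leqNgt.
by rewrite subn_eq0 leqNgt (leq_trans im mn).
Qed.

End Newton.

(** Zorn's lemma. Since [cs] is finite, a union of a chain that contains [cs] would do so at some
    stage. *)
Lemma max_ideal_avoiding (R : comNzRingType) (I : R -> Prop) (cs : seq R) :
  is_ideal I -> ~ (forall c, c \in cs -> I c) ->
  exists J : R -> Prop,
    [/\ is_ideal J, forall x, I x -> J x, ~ (forall c, c \in cs -> J c)
      & forall J', is_ideal J' -> (forall x, J x -> J' x) ->
          (exists x, J' x /\ ~ J x) -> forall c, c \in cs -> J' c].
Proof.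
move=> HI nI.
(* Joining [I] to every candidate makes the empty set, the union of the empty chain, admissible. *)
pose ext (A : set R) : R -> Prop := fun x => A x \/ I x.
pose P (A : set R) := is_ideal (ext A) /\ ~ (forall c, c \in cs -> ext A c).
have [|A [[idA nA] mA]] := @Zorn_bigcup R P.
  move=> F FP tot.
  have dir2 X Y : F X -> F Y -> exists Z, [/\ F Z, (X `<=` Z)%classic & (Y `<=` Z)%classic].
    move=> FX FY; case: (tot X Y FX FY) => h; [exists Y|exists X]; split=> //; exact: subset_refl.
  have [[X0 FX0]|noX] := pselect (exists X, F X); last first.
    have E x : ext (\bigcup_(X in F) X)%classic x <-> I x.
      by split=> [[[X FX]|]|] //; [case: noX; exists X|right].
    split; last by apply: contra_not nI => h c /h /E.
    split=> [|x y /E Ix /E Iy|a x /E Ix]; apply/E; first exact: ideal0 HI.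
      exact: idealD.
    exact: (ideal_mull HI).
  have inX x : ext (\bigcup_(X in F) X)%classic x -> exists X, F X /\ ext X x.
    by move=> [[X FX Xx]|Ix]; [exists X; split=> //; left|exists X0; split=> //; right].
  have Xin X x : F X -> ext X x -> ext (\bigcup_(X in F) X)%classic x.
    by move=> FX [Xx|Ix]; [left; exists X|right].
  have sub X Y x : (X `<=` Y)%classic -> ext X x -> ext Y x.
    by move=> XY [/XY|]; [left|right].
  split.
    split.
    - by right; exact: ideal0.
    - move=> x y /inX[X [FX Xx]] /inX[Y [FY Yy]].
      have [Z [FZ XZ YZ]] := dir2 _ _ FX FY.
      apply: (Xin Z) => //; have [iZ _] := FP _ FZ.
      by apply: idealD => //; [exact: sub Xx|exact: sub Yy].
    - move=> a x /inX[X [FX Xx]]; apply: (Xin X) => //; have [iX _] := FP _ FX.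
      exact: (ideal_mull iX).
  move=> h; have [X [FX]] : exists X, F X /\ forall c, c \in cs -> ext X c.
    elim: cs h {nI P FP} => [|c s IH] h; first by exists X0.
    have [|X [FX hX]] := IH; first by move=> d ds; apply: h; rewrite inE ds orbT.
    have [Y [FY Yc]] := inX _ (h c (mem_head _ _)).
    have [Z [FZ XZ YZ]] := dir2 _ _ FX FY.
    exists Z; split=> // d; rewrite inE => /orP[/eqP->|/hX]; [exact: sub Yc|exact: sub].
  by have [_ nX] := FP _ FX.
exists (ext A); split=> // [x Ix|J' idJ' AJ' [x [J'x nx]] c cc]; first by right.
apply: contrapT => nc; apply: (mA J'); last first.
  have E y : ext J' y <-> J' y by split=> [[//|Iy]|]; [apply: AJ'; right|left].
  split; last by move=> h; apply: nc; apply/E/h.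
  split=> [|y z /E Iy /E Iz|a y /E Iy]; apply/E; first exact: ideal0 idJ'.
    exact: idealD.
  exact: (ideal_mull idJ').
split; first by move=> y Ay; apply: AJ'; left.
by move=> h; apply: nx; left; apply: h.
Qed.

(** * Differences of power sums that are polynomial modulo an ideal *)

Section Rigidity.

Variable R : comNzRingType.
Hypothesis R0 : forall n, exists a : R, a * n.+1%:R = 1.

Lemma residue_char0 (L : fieldType) (h : {rmorphism R -> L}) n : n.+1%:R != 0 :> L.
Proof.
have [a ea] := R0 n; apply/eqP => e.
by move/(congr1 h)/eqP: ea; rewrite rmorphM rmorph_nat e mulr0 rmorph1 eq_sym oner_eq0.
Qed.

(** The product of the [X - u] over the distinct bases annihilates the left hand side, so it is
    divisible by [(X - 1)^(size Q)]. Being squarefree, it forces [Q] to be constant, and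
    [Q(0) = 0]. *)
Lemma power_sum_poly (L : fieldType) (L0 : forall n, n.+1%:R != 0 :> L)
    (zs ws : seq L) (Q : {poly L}) : Q.[0] = 0 ->
  (forall k, \sum_(z <- zs) z ^+ k.+1 - \sum_(w <- ws) w ^+ k.+1 = Q.[k.+1%:R]) -> Q = 0.
Proof.
move=> Q0 h; apply/eqP/negPn/negP => nQ.
pose us := undup (zs ++ ws).
pose r : {poly L} := \prod_(u <- us) ('X - u%:P).
have ru u : u \in zs ++ ws -> r.[u] = 0.
  by rewrite -mem_undup => uu; apply/eqP; rewrite -[_ == 0]/(root r u) root_prod_XsubC.
have rp u k : u \in zs ++ ws -> \sum_(i < size r) r`_i * u ^+ (k.+1 + i) = 0.
  move=> /ru e; under eq_bigr => i _ do rewrite exprD mulrCA.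
  by rewrite -mulr_sumr -horner_coef e mulr0.
have rec k : \sum_(i < size r) r`_i * Q.[(k.+1 + i)%:R] = 0.
  under eq_bigr => i _ do rewrite addSn -h mulrBr !mulr_sumr.
  rewrite sumrB exchange_big /= [X in _ - X]exchange_big /=.
  rewrite big_seq big1 => [|u uz]; last by rewrite -[RHS](@rp u k) ?mem_cat ?uz.
  rewrite big_seq big1 ?subr0 // => u uw; by rewrite -[RHS](@rp u k) ?mem_cat ?uw ?orbT.
have := recurrence_poly_dvd L0 nQ rec.
have s2 : (1 < size Q)%N.
  rewrite ltnNge; apply/negP => /size1_polyC e; move: nQ Q0; rewrite e hornerC polyC_eq0.
  by move=> /eqP.
move=> /(dvdp_trans (dvdp_exp2l ('X - 1%:P) s2)); rewrite expr2 => d.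
have r1 : root r 1 by rewrite -dvdp_XsubCl (dvdp_trans _ d) // dvdp_mulr.
move: r1; rewrite root_prod_XsubC => u1.
move: d; rewrite /r (perm_big _ (perm_to_rem u1)) big_cons dvdp_mul2l ?polyXsubC_eq0 //.
rewrite dvdp_XsubCl root_prod_XsubC mem_rem_uniq ?undup_uniq // inE eqxx //.
Qed.

(** By contradiction, modulo an ideal [J] over [I] that is maximal among those missing some [c_s].
    The [c_s] generate a simple module modulo [J], whose annihilator [M] is prime. The field case
    puts every [c_s] in [M], so products [c_s c_s'] lie in [J]. The linearised Newton identities
    then impose a recurrence of order [m] on a nonzero polynomial sequence of degree at least
    [m]. *)
Theorem power_sum_rigidity (I : R -> Prop) m (X Y : 'I_m -> R) G (c : nat -> R) :
  is_ideal I ->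
  (forall k, I (\sum_i X i ^+ k.+1 - \sum_i Y i ^+ k.+1
                - \sum_(m.+1 <= s < G) k.+1%:R ^+ s * c s)) ->
  forall s, (m < s < G)%N -> I (c s).
Proof.
move=> HI hI s1 hs1; apply: contrapT => nI.
pose cs := [seq c s | s <- index_iota m.+1 G].
have csP s : (m < s < G)%N -> c s \in cs.
  by move=> h; apply/mapP; exists s => //; rewrite mem_index_iota.
have [|J [HJ IJ nJ maxJ]] := @max_ideal_avoiding _ I cs HI.
  by move=> h; apply: nI; apply: h; apply: csP.
have [c0 c0in nc0] : exists2 c0, c0 \in cs & ~ J c0.
  apply: contrapT => h; apply: nJ => d dc; apply: contrapT => nd.
  by apply: h; exists d.
pose M x := J (x * c0).
have HM : is_ideal M.
  split; rewrite /M; first by rewrite mul0r; exact: ideal0.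
    by move=> x y; rewrite mulrDl; exact: idealD.
  by move=> a x; rewrite -mulrA; exact: (ideal_mull HJ).
(* elements outside M act invertibly on the simple module (c_s)/J *)
have simple a : ~ M a -> forall d, d \in cs -> exists b, J (d - b * (a * c0)).
  move=> na d dcs.
  pose J' x := exists b, J (x - b * (a * c0)).
  apply: (maxJ J') => //.
  - split.
    + by exists 0; rewrite mul0r subr0; exact: ideal0.
    + move=> x y [b hb] [b' hb']; exists (b + b').
      have -> : x + y - (b + b') * (a * c0) = (x - b * (a * c0)) + (y - b' * (a * c0)) by ring.
      exact: idealD.
    + move=> e x [b hb]; exists (e * b).
      have -> : e * x - e * b * (a * c0) = e * (x - b * (a * c0)) by ring.
      exact: (ideal_mull HJ).
  - by move=> x Jx; exists 0; rewrite mul0r subr0.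
  - exists (a * c0); split=> //; exists 1; rewrite mul1r subrr; exact: ideal0.
have M1 : ~ M 1 by rewrite /M mul1r.
have Mprime x y : M (x * y) -> M x \/ M y.
  move=> Mxy; apply: contrapT => /not_orP[nx ny].
  have [b hb] := simple y ny c0 c0in.
  apply: nx; rewrite /M.
  have -> : x * c0 = x * (c0 - b * (y * c0)) + b * (x * y * c0) by ring.
  by apply: idealD => //; apply: (ideal_mull HJ).
(* In the simple module every [c_s] is a multiple of [c0]; the factors [g s] are scalars once read
   in the residue field of [M]. *)
have [g hg] : exists g : nat -> R, forall s, (m < s < G)%N -> J (c s - g s * c0).
  have E s : exists b, (m < s < G)%N -> J (c s - b * c0).
    case: (boolP (m < s < G)%N) => [hs|_]; last by exists 0.
    have [b hb] := simple 1 M1 (c s) (csP s hs).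
    by exists b; rewrite mul1r in hb.
  by exists (fun s => projT1 (cid (E s))) => s; case: (cid (E s)).
have [L [pr prP]] := prime_residue_field (PrimeIdeal HM M1 Mprime).
rewrite /= in prP.
have L0 := residue_char0 pr.
pose f k := \sum_i X i ^+ k - \sum_i Y i ^+ k.
have fJ k : J (f k.+1 - \sum_(m.+1 <= s < G) k.+1%:R ^+ s * c s) by exact: IJ (hI k).
have cM s : (m < s < G)%N -> M (c s).
  pose Q : {poly L} := \poly_(s < G) (if (m < s)%N then pr (c s) else 0).
  have Qs k : Q.[k.+1%:R] = \sum_(m.+1 <= s < G) k.+1%:R ^+ s * pr (c s).
    rewrite horner_poly big_nat_cond big_mkcond /= big_geq_mkord /=.
    rewrite [RHS]big_mkcond /=; apply: eq_bigr => u _.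
    by rewrite ltn_ord andbT; case: ifP; rewrite ?mul0r // mulrC.
  have Q0 : Q = 0.
    apply: (@power_sum_poly L L0 [seq pr (X i) | i <- index_enum 'I_m] [seq pr (Y i) | i <- index_enum 'I_m]).
      by rewrite horner_coef0 coef_poly ltn0 if_same.
    move=> k; rewrite !big_map Qs.
    have /prP : M (f k.+1 - \sum_(m.+1 <= s < G) k.+1%:R ^+ s * c s).
      exact: (ideal_mulr HJ).
    rewrite !rmorphB !rmorph_sum /= => /eqP; rewrite subr_eq0 => /eqP e.
    under eq_bigr => i _ do rewrite -rmorphXn.
    under [X in _ - X]eq_bigr => i _ do rewrite -rmorphXn.
    rewrite e; apply: eq_bigr => u _; by rewrite rmorphM rmorphXn rmorph_nat.
  move=> /andP[ms sG]; apply/prP.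
  by have := coef0 L s; rewrite -Q0 coef_poly sG ms.
have cc s s' : (m < s < G)%N -> (m < s' < G)%N -> J (c s * c s').
  move=> hs hs'; have e : c s * c s' = c s * (c s' - g s' * c0) + g s' * (c s * c0) by ring.
  rewrite e; apply: idealD => //; apply: (ideal_mull HJ); [exact: hg | exact: (cM _ hs)].
have ff k l : J (f k.+1 * f l.+1).
  pose S k := \sum_(m.+1 <= s < G) k.+1%:R ^+ s * c s.
  have -> : f k.+1 * f l.+1 = f k.+1 * (f l.+1 - S l) + S l * (f k.+1 - S k) + S k * S l by ring.
  apply: idealD => //; first by apply: idealD => //; apply: (ideal_mull HJ); exact: fJ.
  rewrite mulr_suml !big_nat; apply: ideal_sum => // s hs.
  rewrite mulr_sumr !big_nat; apply: ideal_sum => // s' hs'.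
  rewrite mulrACA; apply: (ideal_mull HJ); exact: cc.
(* Modulo [J] one has [k h(k) = f(k)]. This division by [k], as Newton's identities require, lowers
   the exponents to [s - 1 >= m]. *)
pose h k := \sum_(m.+1 <= s < G) k%:R ^+ s.-1 * (g s * c0).
have hE k : J (k.+1%:R * h k.+1 - f k.+1).
  have -> : k.+1%:R * h k.+1 - f k.+1 =
     - (f k.+1 - \sum_(m.+1 <= s < G) k.+1%:R ^+ s * c s)
     - \sum_(m.+1 <= s < G) k.+1%:R ^+ s * (c s - g s * c0).
    have -> : k.+1%:R * h k.+1 = \sum_(m.+1 <= s < G) k.+1%:R ^+ s * (g s * c0).
      rewrite mulr_sumr !big_nat; apply: eq_bigr => s /andP[ms _].
      by rewrite mulrA -exprS prednK // (leq_ltn_trans _ ms).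
    under [X in _ = _ - X]eq_bigr => s _ do rewrite mulrBr.
    by rewrite sumrB; ring.
  apply: idealB => //; first by apply: idealN.
  rewrite big_nat; apply: ideal_sum => // s hs; apply: (ideal_mull HJ); exact: hg.
have rec := newton_recurrence HJ R0 ff hE.
pose Gm : {poly L} := \poly_(s < G.-1) (if (m <= s)%N then pr (g s.+1) else 0).
have Gmh k : pr (\sum_(m.+1 <= s < G) k%:R ^+ s.-1 * g s) = Gm.[k%:R].
  rewrite horner_poly rmorph_sum /= big_add1.
  rewrite big_geq_mkord /= big_mkcond /=; apply: eq_bigr => s _.
  by case: ifP => _; rewrite ?mul0r // rmorphM rmorphXn rmorph_nat mulrC.
have Gm0 : Gm != 0.
  apply/eqP => e; have [s hs ec] : exists2 s, (m < s < G)%N & c0 = c s.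
    by move/mapP: c0in => [s]; rewrite mem_index_iota => hs e'; exists s.
  have : pr (g s) = 0.
    case/andP: hs; case: s {ec} => // s ms sG.
    have := coef0 L s; rewrite -e coef_poly -ltnS prednK ?sG ?(leq_ltn_trans _ sG) //.
    by move: ms; rewrite ltnS => ->.
  move/prP => Mg; apply: nc0.
  have -> : c0 = (c s - g s * c0) + g s * c0 by rewrite subrK.
  by apply: idealD => //; exact: hg.
have sGm : (m < size Gm)%N.
  rewrite ltnNge; apply/negP => le; have := lead_coef_eq0 Gm; rewrite (negbTE Gm0) lead_coefE.
  rewrite coef_poly; case: ifP; rewrite ?eqxx // => _; case: ifP; rewrite ?eqxx //.
  move=> le2; have := leq_trans le le2; case E: (size Gm) => [|n] /=; last by rewrite ltnn.
  by move/eqP: E; rewrite size_poly_eq0 (negbTE Gm0).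
(* Reversing [recip_poly Y] gives the monic polynomial with roots [Y i], so its size is exactly
   [m + 1]. *)
pose r : {poly L} := \poly_(j < m.+1) pr (recip_poly Y)`_(m - j).
have sr : size r = m.+1.
  by apply: size_poly_eq; rewrite subnn recip_poly0 rmorph1 oner_neq0.
have rk k : \sum_(i < size r) r`_i * Gm.[(k.+1 + i)%:R] = 0.
  rewrite sr.
  have := rec (k.+1 + m)%N; rewrite addSn ltnS leq_addl => /(_ isT) hr.
  have /prP : M (\sum_(i < m.+1) (recip_poly Y)`_i * (\sum_(m.+1 <= s < G) ((k + m).+1 - i)%:R ^+ s.-1 * g s)).
    rewrite /M mulr_suml; congr J: hr; apply: eq_bigr => i _.
    by rewrite -mulrA mulr_suml; congr (_ * _); apply: eq_bigr => s _; rewrite mulrA.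
  rewrite rmorph_sum /= => e0; rewrite -[RHS]e0 [RHS](reindex_inj rev_ord_inj) /=.
  apply: eq_bigr => i _; rewrite rmorphM Gmh coef_poly ltn_ord subSS; congr (_ * Gm.[_%:R]).
  have im : (i <= m)%N by rewrite -ltnS.
  by rewrite -addSn -addnBA ?leq_subr // subKn.
have := recurrence_poly_dvd L0 Gm0 rk.
move=> /dvdp_leq; rewrite -size_poly_eq0 sr => /(_ isT).
by rewrite size_exp_XsubC ltnNge sGm.
Qed.

End Rigidity.

(** * Multiplicative sequences with a linear recurrence *)

Section Antidifference.

Variable F : fieldType.
Hypothesis F0 : forall n, n.+1%:R != 0 :> F.

Lemma shiftpZ (a : F) (P : {poly F}) : shiftp (a *: P) = a *: shiftp P.
Proof. by rewrite /shiftp comp_polyZ. Qed.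

(** The difference of [X^n] has degree exactly [n - 1] in characteristic 0, so a multiple of it
    removes the leading term of [P]. *)
Lemma antidifference (P : {poly F}) : exists Q, shiftp Q - Q = P.
Proof.
have [n] := ubnP (size P); elim: n P => // n IH P; rewrite ltnS => sP.
have [|m] := posnP n.
  move=> n0; move: sP; rewrite n0 leqn0 size_poly_eq0 => /eqP->.
  by exists 0; rewrite /shiftp comp_poly0 subrr.
pose D := shiftp 'X^n - 'X^n : {poly F}.
have sD : size D = n by rewrite size_shiftp_diff // size_polyXn.
have lD : D`_n.-1 != 0.
  by rewrite -[in n.-1]sD -lead_coefE lead_coef_eq0 -size_poly_eq0 sD -lt0n.
pose a := P`_n.-1 / D`_n.-1.
have [|Q eQ] := IH (P - a *: D).
  rewrite -[X in (_ < X)%N](prednK m) ltnS; apply/leq_sizeP => j hj; rewrite coefB coefZ.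
  move: hj; rewrite leq_eqVlt => /orP[/eqP<-|hj]; first by rewrite divfK // subrr.
  rewrite prednK // in hj.
  by rewrite !nth_default ?mulr0 ?subrr ?sD // (leq_trans sP).
exists (Q + a *: 'X^n).
rewrite shiftpD shiftpZ opprD addrACA eQ -scalerBr -/D subrK //.
Qed.

(** One factor [X - 1] is spent on passing to the differences of [w], which are polynomial by
    induction; [w] is then their sum, up to a constant. *)
Lemma unipotent_recurrence_poly b (w : nat -> F) :
  (forall k, \sum_(i < size (('X - 1%:P : {poly F}) ^+ b)) (('X - 1%:P : {poly F}) ^+ b)`_i * w (k + i)%N = 0) ->
  exists P : {poly F}, forall k, w k = P.[k%:R].
Proof.
elim: b w => [|b IH] w h.
  exists 0 => k; have := h k; rewrite expr0 size_poly1 big_ord1 coef1 mul1r addn0.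
  by move->; rewrite horner0.
have [|P eP] := IH (fun k => w k.+1 - w k).
  move=> k; rewrite -[RHS](h k) !size_exp_XsubC exprSr.
  set r := _ ^+ b.
  under [RHS]eq_bigr => i _ do rewrite mulrBr polyC1 mulr1 coefB mulrBl coefMX.
  rewrite [RHS]sumrB [X in X - _]big_ord_recl mul0r add0r [X in _ - X]big_ord_recr /=.
  have -> : r`_b.+1 = 0 by rewrite nth_default // size_exp_XsubC.
  rewrite mul0r addr0 -sumrB; apply: eq_bigr => i _.
  by rewrite /= mulrBr addnS.
have [Q eQ] := antidifference P.
exists (Q + (w 0%N - Q.[0])%:P); elim=> [|k IHk].
  by rewrite hornerD hornerC addrCA subrr addr0.
have e : w k.+1 = w k + P.[k%:R] by rewrite -eP addrCA subrr addr0.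
rewrite e IHk -eQ !hornerD hornerN !hornerC /shiftp horner_comp !hornerD hornerX hornerC natr1.
by ring.
Qed.

End Antidifference.

Section MultiplicativeRecurrence.

(** Characteristic 0 and algebraically closed: the minimal annihilator has to split into linear
    factors. *)
Let F := algC.
Let F0 : forall n, n.+1%:R != 0 :> F. Proof. by move=> n; rewrite pnatr_eq0. Qed.

Variable u : nat -> F.
Hypothesis uM : forall k l, u (k.+1 * l.+1)%N = u k.+1 * u l.+1.
Hypothesis u0 : forall k, u k.+1 != 0.

(** The recurrence starts at index 1, because [u] is multiplicative on positive integers only. *)
Definition annihilates (p : {poly F}) :=
  forall k, \sum_(i < size p) p`_i * u (k.+1 + i)%N = 0.

Lemma annihilatesE n (p : {poly F}) : (size p <= n)%N ->
  annihilates p <-> forall k, \sum_(i < n) p`_i * u (k.+1 + i)%N = 0.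
Proof.
move=> le; suff e k : \sum_(i < size p) p`_i * u (k.+1 + i)%N = \sum_(i < n) p`_i * u (k.+1 + i)%N.
  by split=> h k; [rewrite -e|rewrite e].
rewrite (big_ord_widen n (fun i => p`_i * u (k.+1 + i)%N) le).
rewrite big_mkcond /=; apply: eq_bigr => i _; case: ltnP => // h.
by rewrite nth_default ?mul0r.
Qed.

Lemma annihilatesD p q : annihilates p -> annihilates q -> annihilates (p + q).
Proof.
move=> /(annihilatesE (leq_maxl (size p) (size q))) hp.
move=> /(annihilatesE (leq_maxr (size p) (size q))) hq.
apply/(annihilatesE (size_polyD p q)) => k.
by under eq_bigr => i _ do rewrite coefD mulrDl; rewrite big_split /= hp hq addr0.
Qed.

Lemma annihilatesZ a p : annihilates p -> annihilates (a *: p).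
Proof.
move=> h; apply/(annihilatesE (size_scale_leq a p)) => k.
by under eq_bigr => i _ do rewrite coefZ -mulrA; rewrite -mulr_sumr h mulr0.
Qed.

Lemma annihilatesMX p : annihilates p -> annihilates (p * 'X).
Proof.
move=> h.
have le : (size (p * 'X)%R <= (size p).+1)%N.
  by apply: leq_trans (size_polyMleq _ _) _; rewrite size_polyX addn2.
apply/(annihilatesE le) => k; rewrite big_ord_recl coefMX mul0r add0r -[RHS](h k.+1).
by apply: eq_bigr => i _; rewrite coefMX /= addnS.
Qed.

Lemma annihilatesM p q : annihilates p -> annihilates (p * q).
Proof.
move=> h; elim/poly_ind: q => [|q c IH].
  by rewrite mulr0 => k; rewrite size_poly0 big_ord0.
rewrite mulrDr mulrA; apply: annihilatesD; first exact: annihilatesMX.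
by rewrite mulrC mul_polyC; apply: annihilatesZ.
Qed.

(** Read the recurrence of [q(X^(n+1))] at the multiples of [n + 1]: all indices involved are
    multiples of [n + 1], and the common nonzero factor [u (n + 1)] cancels. *)
Lemma comp_polyXn_annihilates n (q : {poly F}) : annihilates (q \Po 'X^(n.+1)) -> annihilates q.
Proof.
pose qn := q \Po 'X^(n.+1); rewrite -/qn.
have e (h : nat -> F) : \sum_(i < size qn) qn`_i * h i
    = \sum_(j < size q) q`_j * h (j * n.+1)%N.
  pose N := maxn (size qn) (size q * n.+1)%N.
  have -> : \sum_(i < size qn) qn`_i * h i =
      \sum_(i < N) qn`_i * h i.
    rewrite (big_ord_widen N (fun i => qn`_i * h i)) ?leq_maxl //.
    rewrite big_mkcond /=; apply: eq_bigr => i _; case: ltnP => // hh.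
    by rewrite nth_default ?mul0r.
  have c i : qn`_i = \sum_(j < size q) (if i == (j * n.+1)%N then q`_j else 0).
    rewrite /qn comp_polyE coef_sum; apply: eq_bigr => j _.
    by rewrite coefZ -exprM coefXn mulnC; case: eqP; rewrite ?mulr1 ?mulr0.
  under eq_bigr => i _ do rewrite c mulr_suml.
  rewrite exchange_big /=; apply: eq_bigr => j _.
  have jN : (j * n.+1 < N)%N.
    by rewrite leq_max; apply/orP; right; rewrite ltn_pmul2r.
  rewrite (bigD1 (Ordinal jN)) //= eqxx big1 ?addr0 // => i.
  by rewrite -val_eqE /= => /negbTE ->; rewrite mul0r.
move=> h k; have := h (n.+1 * k.+1).-1.
rewrite prednK ?muln_gt0 // (e (fun i => u (n.+1 * k.+1 + i)%N)).
under eq_bigr => j _ do rewrite [(val j * _)%N]mulnC -mulnDr addSn uM mulrCA.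
by rewrite -mulr_sumr => /eqP; rewrite mulf_eq0 (negbTE (u0 _)) /= => /eqP.
Qed.

(** All positive powers of an element of [rs] stay in the finite list [rs], so two of them agree,
    and the element is 0 or a root of unity. The product of the individual exponents serves for
    all. *)
Lemma common_exponent (rs : seq F) :
  (forall n, perm_eq rs [seq x ^+ n.+1 | x <- rs]) ->
  exists n, forall x, x \in rs -> (x ^+ n.+1 == 0) || (x ^+ n.+1 == 1).
Proof.
move=> h.
have one x : x \in rs -> exists n, (x ^+ n.+1 == 0) || (x ^+ n.+1 == 1).
  move=> xr; pose f (i : 'I_(size rs).+1) := x ^+ i.+1.
  have fin i : f i \in rs by rewrite (perm_mem (h i)); apply/mapP; exists x.
  have : ~~ injectiveb (fun i => index (f i) rs).
    apply/negP => /injectiveP inj.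
    have inj2 : injective (fun i => Ordinal (etrans (index_mem (f i) rs) (fin i))).
      by move=> i j /(congr1 val) /= /inj.
    by have := leq_card _ inj2; rewrite !card_ord ltnn.
  move=> /injectivePn[i [j nij e]].
  have {e}e : f i = f j by rewrite -(nth_index 0 (fin i)) e nth_index.
  wlog ij : i j nij e / (i < j)%N.
    move=> W; case: (ltngtP i j) => hij; [exact: W hij|apply: W hij => //|]; rewrite 1?eq_sym //.
    by move: nij; rewrite -val_eqE /= hij eqxx.
  have [->|x0] := eqVneq x 0; first by exists 0%N; rewrite expr1 eqxx.
  exists (j - i).-1; rewrite prednK ?subn_gt0 //; apply/orP; right.
  have : x ^+ i.+1 * x ^+ (j - i) = x ^+ i.+1 * 1.
    by rewrite -exprD mulr1 addSn subnKC ?(ltnW ij).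
  by move=> /(mulfI (expf_neq0 _ x0)) ->.
suff H (s : seq F) : {subset s <= rs} -> exists n, forall x, x \in s -> (x ^+ n.+1 == 0) || (x ^+ n.+1 == 1).
  exact: (H rs).
elim: s => [|x s IH] hs; first by exists 0%N.
have [|n hn] := IH; first by move=> y ys; apply: hs; rewrite inE ys orbT.
have [m hm] := one x (hs _ (mem_head _ _)).
exists (n.+1 * m.+1).-1 => y; rewrite prednK ?muln_gt0 // inE => /orP[/eqP->|/hn].
  by rewrite mulnC exprM; case/orP: hm => /eqP->; rewrite ?expr0n ?expr1n eqxx ?orbT.
by rewrite exprM => /orP[]/eqP->; rewrite ?expr0n ?expr1n eqxx ?orbT.
Qed.

Lemma dvdp_prod_map (s : seq F) (f g : F -> {poly F}) :
  (forall x, f x %| g x) -> \prod_(x <- s) f x %| \prod_(x <- s) g x.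
Proof.
by move=> h; elim: s => [|x s IH]; rewrite ?big_nil ?big_cons // dvdp_mul.
Qed.

(* The roots of the minimal annihilator are permuted by every power map,
   because dilation by n turns the shift into its n-th power. *)
Lemma root_of_unity_annihilator : (exists2 p, p != 0 & annihilates p) ->
  exists a, annihilates ('X^a * ('X - 1%:P) ^+ a).
Proof.
move=> ex.
pose P n := `[< exists p, [/\ p != 0, annihilates p & size p = n] >].
have exP : exists n, P n by case: ex => p p0 ap; exists (size p); apply/asboolP; exists p.
case: (ex_minnP exP) => n /asboolP[p0 [p0nz ap0 sp0]] minP.
have [rs ep0] := closed_field_poly_normal p0.
have l0 : lead_coef p0 != 0 by rewrite lead_coef_eq0.
pose p := \prod_(x <- rs) ('X - x%:P) : {poly F}.
have ap : annihilates p.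
  have -> : p = (lead_coef p0)^-1 *: p0 by rewrite {2}ep0 scalerA mulVf // scale1r.
  exact: annihilatesZ.
have sp : size p = n by rewrite -sp0 ep0 size_scale.
have min q : annihilates q -> p %| q.
  move=> aq; apply/modp_eq0P; apply/eqP/negPn/negP => nz.
  have am : annihilates (q %% p).
    have -> : q %% p = q + p * (- (q %/ p)) by rewrite {2}(divp_eq q p); ring.
    by apply: annihilatesD => //; exact: annihilatesM.
  have := minP (size (q %% p)); rewrite leqNgt -{1}sp ltn_modp -size_poly_eq0 sp -sp0.
  by rewrite size_poly_eq0 p0nz => /(_ _)/negP; apply => //; apply/asboolP; exists (q %% p).
have perm k : perm_eq rs [seq x ^+ k.+1 | x <- rs].
  pose q := \prod_(x <- [seq x ^+ k.+1 | x <- rs]) ('X - x%:P) : {poly F}.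
  have aq : annihilates q.
    apply: (@comp_polyXn_annihilates k).
    have /dvdpP[w ->] : p %| (q \Po 'X^(k.+1)).
      rewrite /q big_map rmorph_prod; apply: dvdp_prod_map => x /=.
      by rewrite rmorphB /= comp_polyX comp_polyC dvdp_XsubCl rootE !hornerE subrr.
    by rewrite mulrC; exact: annihilatesM.
  have mp : p \is monic by exact: monic_prod_XsubC.
  have mq : q \is monic by exact: monic_prod_XsubC.
  have sq : size p = size q by rewrite !size_prod_XsubC size_map.
  have eqpq : p = q.
    apply/eqP; rewrite -eqp_monic // -dvdp_size_eqp ?sq //; exact: min.
  by apply: prod_XsubC_eq; rewrite -/p eqpq.
have [N hN] := common_exponent perm.
(* The power map of exponent [N + 1] permutes [rs] and takes only the values 0 and 1, so [rs] itself
   consists of zeros and ones. *)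
have r01 x : x \in rs -> (x == 0) || (x == 1).
  by rewrite (perm_mem (perm N)) => /mapP[y /hN hy ->].
exists (size rs).
suff /dvdpP[w ->] : p %| 'X^(size rs) * ('X - 1%:P) ^+ size rs.
  by rewrite mulrC; exact: annihilatesM.
rewrite /p; elim: rs r01 {ep0 p ap sp min perm hN} => [|x s IH] r01.
  by rewrite big_nil dvd1p.
rewrite big_cons /= !exprS mulrACA dvdp_mul //.
  have := r01 x (mem_head _ _) => /orP[]/eqP->; first by rewrite subr0 dvdp_mulr.
  by rewrite dvdp_mull.
by apply: IH => y ys; apply: r01; rewrite inE ys orbT.
Qed.

(** Beyond the index [a] the sequence is a polynomial [P']. From [P'(2 X) = u(2) P'(X)] it has a
    single monomial, and multiplicativity makes its coefficient 1. Small indices are reached through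
    the multiples [(k + 1) (a + 1)]. *)
Lemma multiplicative_recurrence : (exists2 p, p != 0 & annihilates p) ->
  exists t, forall k, u k.+1 = k.+1%:R ^+ t.
Proof.
move=> /root_of_unity_annihilator[a ha].
have [|P eP] := @unipotent_recurrence_poly F F0 a (fun k => u (k.+1 + a)%N).
  move=> k; have sz : (size ('X^a * ('X - 1%:P : {poly F}) ^+ a)%R <= a + a.+1)%N.
    by apply: leq_trans (size_polyMleq _ _) _; rewrite size_polyXn size_exp_XsubC.
  have /(_ k) := (annihilatesE sz).1 ha.
  rewrite big_split_ord /= big1 ?add0r => [|i _]; last by rewrite coefXnM ltn_ord mul0r.
  move=> e0; rewrite size_exp_XsubC -[RHS]e0; apply: eq_bigr => i _.
  rewrite coefXnM ltnNge leq_addr /= addKn; congr (_ * u _).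
  by rewrite !addSn -addnA [(i + a)%N]addnC.
pose P' := P \Po ('X - (a.+1)%:R%:P).
have eP' k : (a < k)%N -> u k = P'.[k%:R].
  move=> ak; rewrite horner_comp !hornerE -natrB // -eP; congr u.
  by rewrite addSnnS subnK.
have P2 : P' \Po (2%:R *: 'X) = u 2 *: P'.
  apply/eqP; rewrite -subr_eq0; apply/eqP.
  set D := _ - _.
  have D0 : D \Po ('X + a%:R%:P) = 0.
    apply: (poly_nat_eq0 F0) => k.
    have ak : (a < (k + a).+1)%N by rewrite ltnS leq_addl.
    have ak2 : (a < 2 * (k + a).+1)%N by rewrite (leq_trans ak) // leq_pmull.
    rewrite horner_comp; have -> : ('X + a%:R%:P : {poly F}).[k.+1%:R] = (k + a).+1%:R.
      by rewrite hornerD hornerX hornerC -natrD addSn.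
    rewrite /D hornerD hornerN hornerZ horner_comp hornerZ hornerX -natrM.
    by rewrite -!eP' // uM subrr.
  clearbody D; have := congr1 (fun p => p \Po ('X - a%:R%:P)) D0.
  by rewrite comp_poly0 -comp_polyA comp_polyD comp_polyX comp_polyC subrK comp_polyXr.
have c2 i : P'`_i != 0 -> 2%:R ^+ i = u 2.
  move=> nz; have := congr1 (fun p : {poly F} => p`_i) P2; rewrite coefZ.
  rewrite comp_polyE coef_sum.
  under eq_bigr => j _ do rewrite exprZn coefZ coefZ coefXn.
  have iP : (i < size P')%N by rewrite ltnNge; apply: contra nz => h; rewrite nth_default.
  rewrite (bigD1 (Ordinal iP)) //= eqxx mulr1 big1 ?addr0 => [|j].
    by rewrite mulrC => /(mulIf nz).
  by rewrite -val_eqE /= eq_sym => /negbTE ->; rewrite !mulr0.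
have [t [al eA]] : exists t al, P' = al *: 'X^t.
  have [P0|nz] := eqVneq P' 0; first by exists 0%N, 0; rewrite scale0r.
  exists (size P').-1, (lead_coef P'); apply/polyP => i; rewrite coefZ coefXn.
  case: eqP => [->|ne]; first by rewrite mulr1 lead_coefE.
  rewrite mulr0; apply/eqP/negPn/negP => /c2 e1.
  have : P'`_(size P').-1 != 0 by rewrite -lead_coefE lead_coef_eq0.
  move=> /c2; rewrite -e1 -!natrX => /eqP; rewrite eqr_nat eqn_exp2l // => /eqP e2.
  by rewrite e2 in ne.
have {eP'} E k : (a < k)%N -> u k = al * k%:R ^+ t.
  by move=> /eP' ->; rewrite eA !hornerE.
have al1 : al = 1.
  have h1 := E a.+1 (leqnn _).
  have : u (a.+1 * a.+1)%N = u a.+1 * u a.+1 by rewrite uM.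
  rewrite E ?ltn_Pmulr //; last by rewrite mulnS (leq_trans _ (leq_addr _ _)).
  rewrite h1 natrM exprMn mulrACA => e.
  have nz : al != 0 by apply: contra_neq (u0 a) => z; rewrite h1 z mul0r.
  have k0 : (a.+1%:R ^+ t * a.+1%:R ^+ t : F) != 0 by rewrite mulf_neq0 // expf_neq0.
  by have := mulIf k0 e; rewrite -{1}[al]mulr1 => /(mulfI nz).
exists t => k; rewrite al1 in E.
have := uM k a; rewrite (E a.+1) // (E (k.+1 * a.+1)%N); last first.
  by rewrite mulSn (leq_trans _ (leq_addr _ _)).
rewrite !mul1r natrM exprMn => /mulIf -> //; exact: expf_neq0.
Qed.

End MultiplicativeRecurrence.

(** * Rational recurrences out of recurrences over a ring *)

Section RationalRecurrence.

Variables (R : comNzRingType) (inQ : {rmorphism rat -> R}).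

(* A finite set of rational vectors either spans or is orthogonal to a nonzero
   vector; spanning is excluded because it would put [chi L = 1] into [A]. *)
Lemma rational_recurrence (A : R -> Prop) L (chi : nat -> R) (nu : nat -> rat) :
  is_ideal A -> ~ A 1 -> chi L = 1 ->
  (forall k, A (\sum_(i < L.+1) chi i * inQ (nu (k.+1 + i)%N))) ->
  exists2 b : {poly rat}, b != 0 &
    forall k, \sum_(i < size b) b`_i * nu (k.+1 + i)%N = 0.
Proof.
move=> HA nA1 chiL rec.
pose N k : 'rV[rat]_L.+1 := \row_i nu (k.+1 + i)%N.
pose P r := `[< exists n (W : 'M[rat]_(n, L.+1)),
  (forall i, exists k, row i W = N k) /\ \rank W = r >].
have exP : exists r, P r.
  by exists 0%N; apply/asboolP; exists 0%N, 0; split=> [[]//|]; rewrite mxrank0.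
have bP r : P r -> (r <= L.+1)%N by move=> /asboolP[n [W [_ <-]]]; exact: rank_leq_col.
case: (ex_maxnP exP bP) => r /asboolP[n [W [rW rkW]]] maxr.
have NW k : (N k <= W)%MS.
  have le : (\rank (col_mx W (N k)) <= \rank W)%N.
    rewrite rkW; apply: maxr; apply/asboolP; exists (n + 1)%N, (col_mx W (N k)); split=> // i.
    rewrite -(splitK i); case: (split i) => j /=.
      by have [k' e] := rW j; exists k'; rewrite rowKu.
    by exists k; rewrite rowKd; apply/rowP => l; rewrite !mxE.
  have s1 : (W <= col_mx W (N k))%MS.
    by apply/row_subP => i; rewrite -(rowKu i W (N k)) row_sub.
  have /leqifP := mxrank_leqif_sup s1.
  case: ifP => [h _|_]; last by rewrite ltnNge le.
  have e : N k = row (rshift n 0) (col_mx W (N k)).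
    by rewrite rowKd; apply/rowP => l; rewrite !mxE.
  by apply: submx_trans h; rewrite [X in (X <= _)%MS]e; exact: row_sub.
have [full|nfull] := boolP (row_full W).
  case: nA1; rewrite -chiL.
  have /submxP[D eD] : ((delta_mx 0 ord_max : 'rV[rat]_L.+1) <= W)%MS by exact: submx_full.
  have -> : chi L = \sum_(j < n) inQ (D 0 j) * \sum_(i < L.+1) chi i * inQ (W j i).
    have -> : chi L = \sum_(i < L.+1) chi i * inQ ((delta_mx 0 ord_max : 'rV[rat]_L.+1) 0 i).
      rewrite (bigD1 ord_max) //= big1 => [|i ni].
        by rewrite mxE !eqxx rmorph1 mulr1 addr0.
      by rewrite mxE (negbTE ni) rmorph0 mulr0.
    rewrite eD; under eq_bigr => i _ do rewrite mxE rmorph_sum mulr_sumr.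
    rewrite exchange_big /=; apply: eq_bigr => j _; rewrite mulr_sumr.
    by apply: eq_bigr => i _; rewrite rmorphM mulrCA.
  apply: ideal_sum => // j _; apply: (ideal_mull HA).
  have [k e] := rW j; have := rec k; congr A.
  by apply: eq_bigr => i _; move/rowP/(_ i): e; rewrite !mxE => ->.
have : kermx W^T != 0.
  by rewrite kermx_eq0 /row_free mxrank_tr; move: nfull.
move=> /rowV0Pn[v /sub_kermxP vW v0].
exists (\poly_(i < L.+1) v 0 (inord i)).
  apply: contra v0 => /eqP e; apply/eqP/rowP => i; rewrite mxE.
  by have := coef0 rat i; rewrite -e coef_poly ltn_ord inord_val.
move=> k; set b := \poly_(_ < _) _.
have -> : \sum_(i < size b) b`_i * nu (k.+1 + i)%N = \sum_(i < L.+1) b`_i * nu (k.+1 + i)%N.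
  rewrite (big_ord_widen L.+1 (fun i => b`_i * nu (k.+1 + i)%N)) ?size_poly //.
  rewrite big_mkcond /=; apply: eq_bigr => i _; case: ltnP => // h.
  by rewrite nth_default ?mul0r.
have /submxP[D eD] := NW k.
have : v *m (N k)^T = 0 by rewrite eD trmx_mul mulmxA vW mul0mx.
move=> /matrixP/(_ 0 0); rewrite !mxE => e; rewrite -[RHS]e.
by apply: eq_bigr => i _; rewrite coef_poly ltn_ord inord_val !mxE.
Qed.

Variables (I : R -> Prop) (m : nat) (X Y : 'I_m -> R) (G : nat) (c : nat -> R).
Variable mu : nat -> rat.
Hypothesis HI : is_ideal I.
Hypothesis mu1 : mu 1 = 1.
Hypothesis muM : forall k l, mu (k.+1 * l.+1)%N = mu k.+1 * mu l.+1.
Hypothesis mu0 : forall k, mu k.+1 != 0.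

Let f k := \sum_i X i ^+ k - \sum_i Y i ^+ k.
Let nu s k := mu k * k%:R ^+ s : rat.

Hypothesis hf : forall k,
  I (f k.+1 - \sum_(m.+1 <= s < G) inQ (nu s k.+1) * c s).

(** Dilation by 2 multiplies the term [c_s] by [nu s 2], and these numbers are distinct, so a
    combination of the dilations by [2^j] isolates [c_s0]. What remains is still a combination of
    power sums and satisfies a monic recurrence over [R]; modulo the annihilator of [c_s0] it
    becomes one for the rational sequence [nu s0]. *)
Lemma multiplier_power s0 : (m < s0 < G)%N -> ~ I (c s0) ->
  exists t, forall k, nu s0 k.+1 = k.+1%:R ^+ t.
Proof.
move=> hs0 nI.
have nuM s k l : nu s (k.+1 * l.+1)%N = nu s k.+1 * nu s l.+1.
  by rewrite /nu muM natrM exprMn mulrACA.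
have nu0 s k : nu s k.+1 != 0 by rewrite mulf_neq0 // expf_neq0 // pnatr_eq0.
have nu1 s : nu s 1 = 1 by rewrite /nu mu1 expr1n mulr1.
have nu2 s j k : nu s (2 ^ j * k.+1)%N = nu s 2 ^+ j * nu s k.+1.
  elim: j => [|j IH]; first by rewrite expn0 mul1n expr0 mul1r.
  have h : (2 ^ j * k.+1 = (2 ^ j * k.+1).-1.+1)%N by rewrite prednK // muln_gt0 expn_gt0.
  by rewrite expnS -mulnA h nuM -h IH exprS mulrA.
pose x s := nu s 2.
have xinj s s' : x s = x s' -> s = s'.
  rewrite /x /nu => /(mulfI (mu0 1)) /eqP; rewrite -!natrX eqr_nat eqn_exp2l //.
  by move/eqP.
pose p : {poly rat} := \prod_(s <- index_iota m.+1 G | s != s0) ('X - (x s)%:P).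
have px s : (m < s < G)%N -> s != s0 -> p.[x s] = 0.
  move=> hs ns; rewrite horner_prod (big_rem s) ?mem_index_iota //= ns.
  by rewrite !hornerE subrr mul0r.
have px0 : p.[x s0] != 0.
  rewrite horner_prod.
  rewrite prodf_seq_neq0; apply/allP => s _; apply/implyP => ns.
  by rewrite !hornerE subr_eq0; apply: contra ns => /eqP/xinj ->.
pose g k := \sum_(j < size p) inQ p`_j * f (2 ^ j * k)%N.
have hg k : I (g k.+1 - inQ (p.[x s0] * nu s0 k.+1) * c s0).
  have -> : inQ (p.[x s0] * nu s0 k.+1) * c s0 =
     \sum_(j < size p) inQ p`_j * \sum_(m.+1 <= s < G) inQ (nu s (2 ^ j * k.+1)%N) * c s.
    transitivity (\sum_(m.+1 <= s < G) inQ (p.[x s] * nu s k.+1) * c s).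
      rewrite (big_rem s0) ?mem_index_iota //= big_seq_cond big1 ?addr0 // => s.
      rewrite mem_rem_uniq ?iota_uniq // inE mem_index_iota andbT => /andP[ns hs].
      by rewrite px // mul0r rmorph0 mul0r.
    under [RHS]eq_bigr => j _ do rewrite mulr_sumr.
    rewrite exchange_big /=; apply: eq_bigr => s _.
    rewrite horner_coef mulr_suml rmorph_sum mulr_suml; apply: eq_bigr => j _.
    by rewrite nu2 !rmorphM !mulrA.
  rewrite /g -sumrB; apply: ideal_sum => // j _; rewrite -mulrBr.
  apply: (ideal_mull HI); have := hf (2 ^ j * k.+1).-1%N.
  by rewrite prednK // muln_gt0 expn_gt0.
(* Its roots include all the bases that occur in [g], so it annihilates [g] exactly. Its leading
   coefficient 1 is the entry outside the proper ideal [A] that [rational_recurrence] asks for. *)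
pose chi : {poly R} := \prod_(j < size p)
  ((\prod_i ('X - (X i ^+ (2 ^ j))%:P)) * \prod_i ('X - (Y i ^+ (2 ^ j))%:P)).
have mchi : chi \is monic.
  by apply: monic_prod => j _; apply: rpredM; apply: monic_prod => i _; exact: monicXsubC.
have rX (j : 'I_(size p)) i : chi.[X i ^+ (2 ^ j)] = 0.
  rewrite horner_prod (bigD1 j) //= hornerM horner_prod (bigD1 i) //=.
  by rewrite !hornerE subrr !mul0r.
have rY (j : 'I_(size p)) i : chi.[Y i ^+ (2 ^ j)] = 0.
  have e : (\prod_l ('X - (Y l ^+ (2 ^ j))%:P)).[Y i ^+ (2 ^ j)] = 0.
    by rewrite horner_prod (bigD1 i) //= !hornerE subrr mul0r.
  by rewrite horner_prod (bigD1 j) //= hornerM e mulr0 mul0r.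
have sum0 z k : chi.[z] = 0 -> \sum_(l < size chi) chi`_l * z ^+ (k + l) = 0.
  move=> z0; under eq_bigr => l _ do rewrite exprD mulrCA.
  by rewrite -mulr_sumr -horner_coef z0 mulr0.
have kill k : \sum_(l < size chi) chi`_l * g (k.+1 + l)%N = 0.
  rewrite /g; under eq_bigr => l _ do rewrite mulr_sumr.
  rewrite exchange_big /= big1 // => j _.
  under eq_bigr => l _ do rewrite mulrCA.
  rewrite -mulr_sumr /f; under eq_bigr => l _ do rewrite mulrBr !mulr_sumr.
  rewrite sumrB exchange_big [X in _ - X]exchange_big /= !big1 ?subrr ?mulr0 // => i _.
    by rewrite -[RHS](sum0 _ k.+1 (rY j i)); apply: eq_bigr => l _; rewrite -exprM.
  by rewrite -[RHS](sum0 _ k.+1 (rX j i)); apply: eq_bigr => l _; rewrite -exprM.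
pose A r := I (r * c s0).
have HA : is_ideal A.
  split; rewrite /A; first by rewrite mul0r; exact: ideal0.
    by move=> a b; rewrite mulrDl; exact: idealD.
  by move=> a b; rewrite -mulrA; exact: (ideal_mull HI).
have schi : size chi = (size chi).-1.+1.
  by rewrite prednK // size_poly_gt0 monic_neq0.
have [|||b b0 hb] := @rational_recurrence A (size chi).-1 (fun i => chi`_i)
    (fun k => p.[x s0] * nu s0 k) HA.
- by rewrite /A mul1r.
- by rewrite -lead_coefE (monicP mchi).
- move=> k; rewrite /A -schi mulr_suml.
  have -> : \sum_(l < size chi) chi`_l * inQ (p.[x s0] * nu s0 (k.+1 + l)%N) * c s0 =
     - \sum_(l < size chi) chi`_l * (g (k.+1 + l)%N - inQ (p.[x s0] * nu s0 (k.+1 + l)%N) * c s0).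
    under [in RHS]eq_bigr => l _ do rewrite mulrBr.
    by rewrite sumrB kill sub0r opprK; apply: eq_bigr => l _; rewrite -mulrA.
  apply: idealN => //; apply: ideal_sum => // l _; apply: (ideal_mull HI).
  by rewrite addSn; exact: hg.
pose u k : algC := ratr (nu s0 k).
have [|||t ht] := @multiplicative_recurrence u.
- by move=> k l; rewrite /u nuM rmorphM.
- by move=> k; rewrite /u fmorph_eq0.
- exists (map_poly ratr b); first by rewrite map_poly_eq0.
  move=> k; rewrite size_map_poly.
  transitivity (ratr (\sum_(i < size b) b`_i * nu s0 (k.+1 + i)%N) : algC).
    rewrite rmorph_sum; apply: eq_bigr => i _; rewrite coef_map rmorphM //.
  suff -> : \sum_(i < size b) b`_i * nu s0 (k.+1 + i)%N = 0 by rewrite rmorph0.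
  apply: (mulfI px0); rewrite mulr0 -[RHS](hb k) mulr_sumr; apply: eq_bigr => i _.
  by rewrite mulrCA.
exists t => k; have := ht k; rewrite /u -[k.+1%:R](ratr_nat algC) -rmorphXn.
exact: fmorph_inj.
Qed.

End RationalRecurrence.

(** If some [c_s0] is not in [I], then [mu k = k^(t - s0)], and [1 <= mu 2] makes the exponent
    nonnegative. The multiplier only raises the exponents [s], which therefore stay above [m], and
    rigidity applies. *)
Theorem power_sum_multiplier (R : comNzRingType) (inQ : {rmorphism rat -> R})
    (I : R -> Prop) (m : nat) (X Y : 'I_m -> R) (G : nat) (c : nat -> R) (mu : nat -> rat) :
  is_ideal I -> mu 1 = 1 -> 1 <= mu 2 -> (forall k, mu k.+1 != 0) ->
  (forall k l, mu (k.+1 * l.+1)%N = mu k.+1 * mu l.+1) ->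
  (forall k, I (\sum_i X i ^+ k.+1 - \sum_i Y i ^+ k.+1
     - \sum_(m.+1 <= s < G) inQ (mu k.+1 * k.+1%:R ^+ s) * c s)) ->
  I (\sum_i X i - \sum_i Y i).
Proof.
move=> HI mu1 mu2 mu0 muM hf.
have suffc : (forall s, (m < s < G)%N -> I (c s)) -> I (\sum_i X i - \sum_i Y i).
  move=> hc; have := hf 0%N.
  under eq_bigr => i _ do rewrite expr1.
  under [X in _ - X - _]eq_bigr => i _ do rewrite expr1.
  move=> h; rewrite -[X in I X](subrK (\sum_(m.+1 <= s < G) inQ (mu 1 * 1%:R ^+ s) * c s)).
  apply: idealD => //; rewrite big_nat; apply: ideal_sum => // s hs.
  by apply: (ideal_mull HI); exact: hc.
have [all|] := pselect (forall s, (m < s < G)%N -> I (c s)); first exact: suffc.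
move=> /existsNP[s0 /not_implyP[hs0 nI]].
have [t ht] := multiplier_power HI mu1 muM mu0 hf hs0 nI.
have st : (s0 <= t)%N.
  have := ht 1%N; rewrite -!natrX => e2.
  rewrite -(leq_exp2l (m:=2)) // -(ler_nat rat) -e2.
  by rewrite ler_peMl // ler0n.
have muE k : mu k.+1 = k.+1%:R ^+ (t - s0).
  have nz : (k.+1%:R ^+ s0 : rat) != 0 by rewrite expf_neq0 // pnatr_eq0.
  by apply: (mulIf nz); rewrite ht -exprD subnK.
pose v := (t - s0)%N.
apply: suffc => s hs.
have R0 n : exists a : R, a * n.+1%:R = 1.
  exists (inQ (n.+1%:R^-1)); rewrite -(rmorph_nat inQ) -rmorphM mulVf ?rmorph1 //.
  by rewrite pnatr_eq0.
(* The terms are relabelled by their new exponents [s + v]; the exponents from [m + 1] to [m + v]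
   receive the coefficient 0. *)
pose c' j := if (m + v < j)%N then c (j - v)%N else 0.
have := @power_sum_rigidity R R0 I m X Y (G + v)%N c' HI _ (s + v)%N.
rewrite /c' !ltn_add2r addnK; case/andP: (hs) => ms sG; rewrite ms sG andbT; apply; last by rewrite ltn_addr.
move=> k; have := hf k; congr (I (_ - _)).
rewrite [RHS](big_cat_nat (n := (m + v).+1)) /=; first last.
- by rewrite -addSn leq_add2r (leq_trans ms (ltnW sG)).
- by rewrite ltnS leq_addr.
rewrite [X in _ = X + _](_ : _ = 0) ?add0r; last first.
  by rewrite big_nat big1 // => j /andP[_ hj]; rewrite ltnNge -ltnS hj mulr0.
rewrite -addSn big_addn addnK big_nat [RHS]big_nat; apply: eq_bigr => j /andP[mj jG].
rewrite ltn_add2r mj addnK; congr (_ * _).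
by rewrite muE -exprD rmorphXn rmorph_nat addnC.
Qed.

(** * Regular germs and morphisms *)

Section Germs.

Variables (K : closedFieldType) (N : nat) (T : Type) (c : T -> 'rV[K]_N).

Lemma form_evalM (F G : {mpoly K[N]}) v : form_eval (F * G) v = form_eval F v * form_eval G v.
Proof. by rewrite /form_eval mevalM. Qed.

Lemma form_evalD (F G : {mpoly K[N]}) v : form_eval (F + G) v = form_eval F v + form_eval G v.
Proof. by rewrite /form_eval mevalD. Qed.

Lemma form_evalX i v : form_eval ('X_i : {mpoly K[N]}) v = v 0 i.
Proof. by rewrite /form_eval mevalXU. Qed.

Lemma meval_homog d (F : {mpoly K[N]}) (a : K) (v w : 'I_N -> K) :
  F \is d.-homog -> (forall i, w i = a * v i) -> F.@[w] = a ^+ d * F.@[v].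
Proof.
move=> /dhomogP hF hw; rewrite !mevalE mulr_sumr !big_seq; apply: eq_bigr => m ms.
rewrite mulrCA; congr (_ * _).
under eq_bigr => i _ do rewrite hw exprMn.
rewrite big_split /= prodrXr; congr (_ ^+ _ * _).
by rewrite -mdegE; exact: hF.
Qed.

Lemma dhomogXi i : ('X_i : {mpoly K[N]}) \is 1.-homog.
Proof. by rewrite dhomogX /= mdeg1. Qed.

Lemma near_pt_sub x (P Q : T -> Prop) : (forall y, P y -> Q y) ->
  near_pt c x P -> near_pt c x Q.
Proof. by move=> PQ [d [H [hH Hx HP]]]; exists d, H; split=> // y /HP/PQ. Qed.

Lemma near_ptT x (P : T -> Prop) : (forall y, P y) -> near_pt c x P.
Proof.
move=> hP; exists 0%N, 1; split; rewrite ?dhomog1 // /form_eval meval1 oner_neq0 //.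
Qed.

Lemma near_ptI x (P Q : T -> Prop) :
  near_pt c x P -> near_pt c x Q -> near_pt c x (fun y => P y /\ Q y).
Proof.
move=> [d [H [hH Hx HP]]] [e [G [hG Gx GQ]]].
exists (d + e)%N, (H * G); split; first exact: dhomogM.
  by rewrite form_evalM mulf_neq0.
by move=> y; rewrite form_evalM mulf_eq0 negb_or => /andP[/HP ? /GQ ?].
Qed.

Lemma near_pt_self x P : near_pt c x P -> P x.
Proof. by move=> [d [H [_ Hx]]]; apply. Qed.

Lemma near_pt_form d (F : {mpoly K[N]}) x : F \is d.-homog -> form_eval F (c x) != 0 ->
  near_pt c x (fun y => form_eval F (c y) != 0).
Proof. by move=> hF Fx; exists d, F. Qed.

Lemma near_pt_coord p x : c x 0 p != 0 -> near_pt c x (fun y => c y 0 p != 0).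
Proof.
move=> h; have := @near_pt_form 1 'X_p x (dhomogXi p); rewrite form_evalX => /(_ h).
by apply: near_pt_sub => y; rewrite form_evalX.
Qed.

Lemma regular_near x phi psi : regular_at c x phi ->
  near_pt c x (fun y => psi y = phi y) -> regular_at c x psi.
Proof.
move=> [d [F [G [hF hG h]]]] e; exists d, F, G; split=> //.
by apply: near_pt_sub (near_ptI h e) => y [[Gy <-] ->].
Qed.

Lemma regular_ext x phi psi : regular_at c x phi -> (forall y, psi y = phi y) -> regular_at c x psi.
Proof. by move=> h e; apply: regular_near h _; exact: near_ptT. Qed.

Lemma regular_const x (a : K) : regular_at c x (fun _ => a).
Proof.
exists 0%N, a%:MP, 1; split; rewrite ?dhomog1 //.
  by rewrite -[a%:MP]mulr1 mul_mpolyC dhomogZ // dhomog1.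
by apply: near_ptT => y; rewrite /form_eval mevalC meval1 oner_neq0 divr1.
Qed.

Lemma regular_form d (F G : {mpoly K[N]}) x : F \is d.-homog -> G \is d.-homog ->
  form_eval G (c x) != 0 ->
  regular_at c x (fun y => form_eval F (c y) / form_eval G (c y)).
Proof.
by move=> hF hG Gx; exists d, F, G; split=> //; apply: near_pt_sub (near_pt_form hG Gx).
Qed.

Lemma regularD x phi psi : regular_at c x phi -> regular_at c x psi ->
  regular_at c x (fun y => phi y + psi y).
Proof.
move=> [d [F [G [hF hG h]]]] [e [F' [G' [hF' hG' h']]]].
exists (d + e)%N, (F * G' + F' * G), (G * G'); split.
- by apply: dhomogD; [exact: dhomogM|rewrite addnC; exact: dhomogM].
- exact: dhomogM.
apply: near_pt_sub (near_ptI h h') => y [[Gy ->] [Gy' ->]].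
by rewrite form_evalD !form_evalM mulf_neq0 //; split=> //; field; rewrite Gy Gy'.
Qed.

Lemma regularM x phi psi : regular_at c x phi -> regular_at c x psi ->
  regular_at c x (fun y => phi y * psi y).
Proof.
move=> [d [F [G [hF hG h]]]] [e [F' [G' [hF' hG' h']]]].
exists (d + e)%N, (F * F'), (G * G'); split; try exact: dhomogM.
apply: near_pt_sub (near_ptI h h') => y [[Gy ->] [Gy' ->]].
by rewrite !form_evalM mulf_neq0 //; split=> //; field; rewrite Gy Gy'.
Qed.

Lemma regular_neq0 x phi : regular_at c x phi -> phi x != 0 ->
  near_pt c x (fun y => phi y != 0).
Proof.
move=> [d [F [G [hF hG h]]]] nz.
have [Gx ex] := near_pt_self h.
have Fx : form_eval F (c x) != 0 by apply: contra_neq nz => e; rewrite ex e mul0r.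
apply: near_pt_sub (near_ptI h (near_pt_form hF Fx)) => y [[Gy ->] Fy].
by rewrite mulf_neq0 // invr_eq0.
Qed.

Lemma regularV x phi : regular_at c x phi -> phi x != 0 ->
  regular_at c x (fun y => (phi y)^-1).
Proof.
move=> [d [F [G [hF hG h]]]] nz.
have [Gx ex] := near_pt_self h.
have Fx : form_eval F (c x) != 0 by apply: contra_neq nz => e; rewrite ex e mul0r.
exists d, G, F; split=> //.
apply: near_pt_sub (near_ptI h (near_pt_form hF Fx)) => y [[Gy ->] Fy].
by split=> //; rewrite invfM invrK mulrC.
Qed.

Lemma regularN x phi : regular_at c x phi -> regular_at c x (fun y => - phi y).
Proof.
move=> h; apply: regular_ext (regularM (regular_const x (-1)) h) _ => y.
by rewrite mulN1r.
Qed.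

Lemma regularB x phi psi : regular_at c x phi -> regular_at c x psi ->
  regular_at c x (fun y => phi y - psi y).
Proof. by move=> h /regularN; exact: regularD. Qed.

Lemma regular_sum (I : Type) (r : seq I) (P : pred I) (F : I -> T -> K) x :
  (forall i, P i -> regular_at c x (F i)) ->
  regular_at c x (fun y => \sum_(i <- r | P i) F i y).
Proof.
move=> h; elim: r => [|i r IH].
  by apply: regular_ext (regular_const x 0) _ => y; rewrite big_nil.
case Pi: (P i); last by apply: regular_ext IH _ => y; rewrite big_cons Pi.
by apply: regular_ext (regularD (h i Pi) IH) _ => y; rewrite big_cons Pi.
Qed.

Lemma regular_prod (I : Type) (r : seq I) (P : pred I) (F : I -> T -> K) x :
  (forall i, P i -> regular_at c x (F i)) ->
  regular_at c x (fun y => \prod_(i <- r | P i) F i y).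
Proof.
move=> h; elim: r => [|i r IH].
  by apply: regular_ext (regular_const x 1) _ => y; rewrite big_nil.
case Pi: (P i); last by apply: regular_ext IH _ => y; rewrite big_cons Pi.
by apply: regular_ext (regularM (h i Pi) IH) _ => y; rewrite big_cons Pi.
Qed.

Lemma regularX x phi n : regular_at c x phi -> regular_at c x (fun y => phi y ^+ n).
Proof.
move=> h; elim: n => [|n IH]; first by apply: regular_ext (regular_const x 1) _ => y.
by apply: regular_ext (regularM h IH) _ => y; rewrite exprS.
Qed.

Lemma regular_meval n (H : {mpoly K[n]}) (h : 'I_n -> T -> K) x :
  (forall i, regular_at c x (h i)) -> regular_at c x (fun y => H.@[h^~ y]).
Proof.
move=> hh; apply: regular_ext (_ : regular_at c x
  (fun y => \sum_(m <- msupp H) H@_m * \prod_i h i y ^+ m i)) _ => [|y]; last exact: mevalE.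
apply: regular_sum => m _; apply: regularM; first exact: regular_const.
by apply: regular_prod => i _; exact: regularX.
Qed.

Definition aff (p i : 'I_N) (y : T) : K := c y 0 i / c y 0 p.

Lemma regular_aff p i x : c x 0 p != 0 -> regular_at c x (aff p i).
Proof.
move=> h; apply: regular_ext (@regular_form 1 'X_i 'X_p x _ _ _) _;
  rewrite ?dhomogXi ?form_evalX // => y.
by rewrite !form_evalX.
Qed.

Lemma form_eval_aff d (F : {mpoly K[N]}) p y : F \is d.-homog -> c y 0 p != 0 ->
  form_eval F (c y) = c y 0 p ^+ d * F.@[(aff p)^~ y].
Proof.
move=> hF h; apply: meval_homog hF _ => i.
by rewrite /aff mulrC divfK.
Qed.

(** The local ring at [x] is generated by the affine coordinates under sums, products, and inverses
    of functions nonzero at [x]. Statements about germs are thus checked on generators instead of on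
    quotients of forms. *)
Lemma regular_ind (x : T) (p : 'I_N) (P : (T -> K) -> Prop) : c x 0 p != 0 ->
  (forall a, P (fun=> a)) -> (forall i, P (aff p i)) ->
  (forall f g, P f -> P g -> P (fun y => f y + g y)) ->
  (forall f g, P f -> P g -> P (fun y => f y * g y)) ->
  (forall f, P f -> f x != 0 -> P (fun y => (f y)^-1)) ->
  (forall f g, P f -> near_pt c x (fun y => g y = f y) -> P g) ->
  forall phi, regular_at c x phi -> P phi.
Proof.
move=> xp Pc Pa PD PM PV Pn phi [d [F [G [hF hG h]]]].
have Pe f g : P f -> (forall y, g y = f y) -> P g.
  by move=> Pf e; apply: Pn Pf _; exact: near_ptT.
have Ppoly (H : {mpoly K[N]}) : P (fun y => H.@[(aff p)^~ y]).
  have PX f n : P f -> P (fun y => f y ^+ n).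
    move=> Pf; elim: n => [|n IH]; first by apply: Pe (Pc 1) _ => y.
    by apply: Pe (PM _ _ Pf IH) _ => y; rewrite exprS.
  have Ppr (m : 'X_{1..N}) : P (fun y => \prod_i aff p i y ^+ m i).
    elim: (index_enum 'I_N) => [|i r IH].
      by apply: Pe (Pc 1) _ => y; rewrite big_nil.
    by apply: Pe (PM _ _ (PX _ (m i) (Pa i)) IH) _ => y; rewrite big_cons.
  apply: (Pe (fun y => \sum_(m <- msupp H) H@_m * \prod_i aff p i y ^+ m i)); last first.
    by move=> y; exact: mevalE.
  elim: (msupp H : seq _) => [|m r IH].
    by apply: Pe (Pc 0) _ => y; rewrite big_nil.
  by apply: Pe (PD _ _ (PM _ _ (Pc H@_m) (Ppr m)) IH) _ => y; rewrite big_cons.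
have [Gx _] := near_pt_self h.
have Gx' : G.@[(aff p)^~ x] != 0.
  by apply: contra_neq Gx => e; rewrite (form_eval_aff hG xp) e mulr0.
apply: Pn (PM _ _ (Ppoly F) (PV _ (Ppoly G) Gx')) _.
apply: near_pt_sub (near_ptI h (near_pt_coord xp)) => y [[Gy ->] yp].
by rewrite (form_eval_aff hF yp) (form_eval_aff hG yp) -mulf_div divff ?mul1r // expf_neq0.
Qed.

End Germs.

Section Segre.

Variables (K : closedFieldType) (M N : nat) (T U : Type).
Variables (c : T -> 'rV[K]_M) (c' : U -> 'rV[K]_N).

Lemma segreE y i j : segre c c' y 0 (mxvec_index i j) = c y.1 0 i * c' y.2 0 j.
Proof. by rewrite /segre mxvecE mxE big_ord1 mxE. Qed.

(** An affine Segre coordinate is the product of an affine coordinate of each factor, so functions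
    of one factor generate the local rings of the product. *)
Lemma segre_regular_ind x (p : 'I_M) (q : 'I_N) (P : (T * U -> K) -> Prop) :
  c x.1 0 p != 0 -> c' x.2 0 q != 0 ->
  (forall a, P (fun=> a)) -> (forall i, P (fun y => aff c p i y.1)) ->
  (forall j, P (fun y => aff c' q j y.2)) ->
  (forall f g, P f -> P g -> P (fun y => f y + g y)) ->
  (forall f g, P f -> P g -> P (fun y => f y * g y)) ->
  (forall f, P f -> f x != 0 -> P (fun y => (f y)^-1)) ->
  (forall f g, P f -> near_pt (segre c c') x (fun y => g y = f y) -> P g) ->
  forall phi, regular_at (segre c c') x phi -> P phi.
Proof.
move=> xp xq Pc P1 P2 PD PM PV Pn.
apply: (@regular_ind _ _ _ _ x (mxvec_index p q)) => //.
  by rewrite segreE mulf_neq0.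
move=> k; case/mxvec_indexP: k => i j.
apply: Pn (PM _ _ (P1 i) (P2 j)) _; apply: near_ptT => y.
by rewrite /aff !segreE mulf_div.
Qed.

Lemma exists_coord n (v : 'rV[K]_n) : v != 0 -> exists p, v 0 p != 0.
Proof. by move=> /rV0Pn. Qed.

End Segre.

Section Morphisms.

Variables (K : closedFieldType) (M N L : nat) (T U V : Type).
Variables (c : T -> 'rV[K]_M) (d : U -> 'rV[K]_N) (e : V -> 'rV[K]_L).

(** Continuity: divided by a power of a coordinate, the form that defines the neighbourhood is a
    regular function, and its pull-back is nonzero at [x]. *)
Lemma morphism_near (f : T -> U) x P : (forall y, d y != 0) ->
  is_morphism c d f -> near_pt d (f x) P -> near_pt c x (fun y => P (f y)).
Proof.
move=> d0 mf [n [H [hH Hx HP]]].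
have [p fp] := exists_coord (d0 (f x)).
have hp : ('X_p : {mpoly K[N]}) ^+ n \is n.-homog.
  by have := dhomogMn n (dhomogXi K p); rewrite mul1n.
have hx : form_eval ('X_p ^+ n) (d (f x)) != 0.
  by rewrite /form_eval rmorphXn /= mevalXU expf_neq0.
have reg := regular_form hH hp hx.
have := regular_neq0 (mf _ _ reg); rewrite mulf_neq0 ?invr_eq0 // => /(_ isT).
apply: near_pt_sub => y nz; apply: HP; by apply: contra_neq nz => ->; rewrite mul0r.
Qed.

Lemma morphism_comp (f : T -> U) (g : U -> V) :
  is_morphism c d f -> is_morphism d e g -> is_morphism c e (g \o f).
Proof. by move=> mf mg x phi /mg /mf. Qed.

Lemma morphism_id : is_morphism c c id.
Proof. by []. Qed.

Lemma morphism_const (a : U) : is_morphism c d (fun=> a).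
Proof. by move=> x phi _; exact: regular_const. Qed.

Lemma morphism_ext (f g : T -> U) : (forall x, f x = g x) -> is_morphism c d f -> is_morphism c d g.
Proof. by move=> /funext ->. Qed.

End Morphisms.

Section PairMorphism.

Variables (K : closedFieldType) (M N L : nat) (T U V : Type).
Variables (c : T -> 'rV[K]_M) (d : U -> 'rV[K]_N) (e : V -> 'rV[K]_L).

Lemma morphism_pair (f : T -> U) (g : T -> V) :
  (forall y, d y != 0) -> (forall y, e y != 0) ->
  is_morphism c d f -> is_morphism c e g ->
  is_morphism c (segre d e) (fun x => (f x, g x)).
Proof.
move=> d0 e0 mf mg x phi.
have [p fp] := exists_coord (d0 (f x)); have [q gq] := exists_coord (e0 (g x)).
have rf i : regular_at c x (fun y => aff d p i (f y)) by apply: mf; exact: regular_aff.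
have rg j : regular_at c x (fun y => aff e q j (g y)) by apply: mg; exact: regular_aff.
apply: (@segre_regular_ind _ _ _ _ _ d e (f x, g x) p q
  (fun phi => regular_at c x (fun y => phi (f y, g y)))) => //.
- by move=> a; exact: regular_const.
- by move=> *; exact: regularD.
- by move=> *; exact: regularM.
- by move=> *; exact: regularV.
move=> h1 h2 rh1 [n [H [hH Hx HP]]]; apply: regular_near rh1 _.
pose k0 := mxvec_index p q.
pose hh k y := aff (segre d e) k0 k (f y, g y).
have rh k : regular_at c x (hh k).
  rewrite /hh; case/mxvec_indexP: k => i j.
  apply: regular_ext (regularM (rf i) (rg j)) _ => y.
  by rewrite /aff !segreE mulf_div.
have k0nz y : d (f y) 0 p != 0 -> e (g y) 0 q != 0 -> segre d e (f y, g y) 0 k0 != 0.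
  by move=> h h'; rewrite segreE mulf_neq0.
have nz : H.@[hh^~ x] != 0.
  by apply: contra_neq Hx => z; rewrite (form_eval_aff hH (k0nz _ fp gq)) z mulr0.
have np := morphism_near d0 mf (near_pt_coord fp).
have nq := morphism_near e0 mg (near_pt_coord gq).
apply: near_pt_sub (near_ptI (near_ptI np nq) (regular_neq0 (regular_meval H rh) nz)).
move=> y [[hp hq] hy]; apply: HP.
by rewrite (form_eval_aff hH (k0nz _ hp hq)) mulf_neq0 // expf_neq0 // k0nz.
Qed.

End PairMorphism.

Section AbelianVarietyMorphisms.

Variables (K : closedFieldType) (A : abelianVariety K).

Notation c := (@av_coord K A).

Lemma av_coord_neq0 (x : A) : c x != 0.
Proof. by case: (av_axiom A) => h _ _ _; exact: h. Qed.

Lemma av_coord_inj (x y : A) (a : K) : c y = a *: c x -> x = y.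
Proof. by case: (av_axiom A) => _ h _ _; exact: h. Qed.

Lemma morphism_addr (f g : A -> A) : is_morphism c c f -> is_morphism c c g ->
  is_morphism c c (fun x => f x + g x).
Proof.
move=> mf mg.
have mp := morphism_pair av_coord_neq0 av_coord_neq0 mf mg.
exact: (morphism_comp mp (@av_add K A)).
Qed.

Lemma morphism_translation (a : A) : is_morphism c c (fun x : A => x + a).
Proof. by apply: morphism_addr => //; exact: morphism_const. Qed.

Lemma morphism_mulz (k : int) : is_morphism c c (@mulz_pt K A k).
Proof.
have mn (n : nat) : is_morphism c c (fun x : A => x *+ n).
  elim: n => [|n IH]; first by apply: morphism_const.
  apply: morphism_ext (morphism_addr (@morphism_id _ _ _ c) IH) => x.
  by rewrite mulrS.
case: k => n; first exact: mn.
exact: (morphism_comp (mn n.+1) (@av_opp K A)).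
Qed.

End AbelianVarietyMorphisms.

(** * Multiplication by an integer is etale *)

Lemma segre_neq0 (K : closedFieldType) (M N : nat) (T U : Type)
    (c : T -> 'rV[K]_M) (c' : U -> 'rV[K]_N) (y : T * U) :
  c y.1 != 0 -> c' y.2 != 0 -> segre c c' y != 0.
Proof.
move=> /exists_coord[p hp] /exists_coord[q hq]; apply/rV0Pn; exists (mxvec_index p q).
by rewrite segreE mulf_neq0.
Qed.

Lemma regular_det (K : closedFieldType) (N : nat) (T : Type) (c : T -> 'rV[K]_N)
    n (B : T -> 'M[K]_n) x :
  (forall i j, regular_at c x (fun y => B y i j)) -> regular_at c x (fun y => \det (B y)).
Proof.
move=> h; rewrite /determinant; apply: regular_sum => s _; apply: regularM.
  exact: regular_const.
by apply: regular_prod => i _.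
Qed.

Lemma regular_adj (K : closedFieldType) (N : nat) (T : Type) (c : T -> 'rV[K]_N)
    n (B : T -> 'M[K]_n) x i j :
  (forall i j, regular_at c x (fun y => B y i j)) -> regular_at c x (fun y => (\adj (B y)) i j).
Proof.
move=> h; apply: (@regular_ext _ _ _ _ _ (fun y => cofactor (B y) j i)) => [|y]; last by rewrite mxE.
rewrite /cofactor; apply: regularM; first exact: regular_const.
apply: regular_det => a b.
by apply: regular_ext (h (lift j a) (lift i b)) _ => y; rewrite !mxE.
Qed.

Section Etale.

Variables (K : closedFieldType) (A : abelianVariety K).
Notation c := (@av_coord K A).
Notation N := (@av_size K A).

Variable p : 'I_N.
Hypothesis p0 : c 0 0 p != 0.

(** These [N] functions generate the maximal ideal at 0 ([regular_loc_gen]). They are not a system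
    of parameters: [N] usually exceeds the dimension. *)
Definition loc (i : 'I_N) (y : A) : K := aff c p i y - aff c p i 0.

Lemma loc0 i : loc i 0 = 0. Proof. exact: subrr. Qed.

Lemma regular_loc i : regular_at c 0 (loc i).
Proof. by apply: regularB; [exact: regular_aff | exact: regular_const]. Qed.

Definition in_m (phi : A -> K) := regular_at c 0 phi /\ phi 0 = 0.

Definition in_m2 (phi : A -> K) := exists n : 'I_N -> A -> K,
  (forall i, in_m (n i)) /\ near_pt c 0 (fun y => phi y = \sum_i loc i y * n i y).

Lemma regular_loc_gen phi : regular_at c 0 phi -> exists psi : 'I_N -> A -> K,
  (forall i, regular_at c 0 (psi i)) /\
  near_pt c 0 (fun y => phi y - phi 0 = \sum_i loc i y * psi i y).
Proof.
move=> h; suff : regular_at c 0 phi /\ exists psi : 'I_N -> A -> K,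
  (forall i, regular_at c 0 (psi i)) /\
  near_pt c 0 (fun y => phi y - phi 0 = \sum_i loc i y * psi i y) by case.
move: phi h; apply: (regular_ind p0).
- move=> a; split; first exact: regular_const.
  exists (fun _ _ => 0); split=> [i|]; first exact: regular_const.
  by apply: near_ptT => y; rewrite subrr big1 // => i _; rewrite mulr0.
- move=> i; split; first exact: regular_aff.
  exists (fun j _ => (j == i)%:R); split=> [j|]; first exact: regular_const.
  apply: near_ptT => y; rewrite (bigD1 i) //= eqxx mulr1 big1 ?addr0 // => j /negbTE ->.
  by rewrite mulr0.
- move=> f g [rf [ps [rps hps]]] [rg [ps' [rps' hps']]]; split; first exact: regularD.
  exists (fun i y => ps i y + ps' i y); split=> [i|]; first exact: regularD.
  apply: near_pt_sub (near_ptI hps hps') => y [e e'].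
  under eq_bigr => i _ do rewrite mulrDr.
  by rewrite big_split /= -e -e'; ring.
- move=> f g [rf [ps [rps hps]]] [rg [ps' [rps' hps']]]; split; first exact: regularM.
  exists (fun i y => f y * ps' i y + g 0 * ps i y); split=> [i|].
    by apply: regularD; apply: regularM => //; exact: regular_const.
  apply: near_pt_sub (near_ptI hps hps') => y [e e'].
  under eq_bigr => i _ do rewrite mulrDr mulrCA [_ * (g 0 * _)]mulrCA.
  by rewrite big_split /= -!mulr_sumr -e -e'; ring.
- move=> f [rf [ps [rps hps]]] f0; split; first exact: regularV.
  exists (fun i y => - (f y)^-1 * (f 0)^-1 * ps i y); split=> [i|].
    apply: regularM => //; apply: regularM; last exact: regular_const.
    by apply: regularN; exact: regularV.
  apply: near_pt_sub (near_ptI hps (regular_neq0 rf f0)) => y [e fy].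
  under eq_bigr => i _ do rewrite mulrCA.
  by rewrite -mulr_sumr -e; field; rewrite fy f0.
- move=> f g [rf [ps [rps hps]]] e; split; first exact: regular_near e.
  exists ps; split=> //; apply: near_pt_sub (near_ptI hps e) => y [h ->].
  by rewrite (near_pt_self e).
Qed.

Lemma in_m2_near f g : in_m2 f -> near_pt c 0 (fun y => g y = f y) -> in_m2 g.
Proof.
move=> [n [hn h]] e; exists n; split=> //.
by apply: near_pt_sub (near_ptI h e) => y [<- ->].
Qed.

Lemma in_m2_ext f g : in_m2 f -> (forall y, g y = f y) -> in_m2 g.
Proof. by move=> h e; apply: in_m2_near h _; exact: near_ptT. Qed.

Lemma in_m2D f g : in_m2 f -> in_m2 g -> in_m2 (fun y => f y + g y).
Proof.
move=> [n [hn h]] [n' [hn' h']]; exists (fun i y => n i y + n' i y); split=> [i|].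
  have [r z] := hn i; have [r' z'] := hn' i; split; first exact: regularD.
  by rewrite z z' addr0.
apply: near_pt_sub (near_ptI h h') => y [-> ->].
by rewrite -big_split /=; apply: eq_bigr => i _; rewrite mulrDr.
Qed.

Lemma in_m2Ml f g : regular_at c 0 f -> in_m2 g -> in_m2 (fun y => f y * g y).
Proof.
move=> rf [n [hn h]]; exists (fun i y => f y * n i y); split=> [i|].
  by have [r z] := hn i; split; [exact: regularM|rewrite z mulr0].
apply: near_pt_sub h => y ->; rewrite mulr_sumr; apply: eq_bigr => i _.
by rewrite mulrCA.
Qed.

Lemma in_m2N f : in_m2 f -> in_m2 (fun y => - f y).
Proof.
move=> h; apply: in_m2_ext (in_m2Ml (regular_const c 0 (-1)) h) _ => y.
by rewrite mulN1r.
Qed.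

Lemma in_m2M f g : in_m f -> in_m g -> in_m2 (fun y => f y * g y).
Proof.
move=> [rf f0] [rg g0]; have [ps [rps h]] := regular_loc_gen rg.
exists (fun i y => f y * ps i y); split=> [i|].
  by split; [exact: regularM | rewrite f0 mul0r].
apply: near_pt_sub h => y; rewrite g0 subr0 => ->; rewrite mulr_sumr.
by apply: eq_bigr => i _; rewrite mulrCA.
Qed.

Lemma in_m2_0 : in_m2 (fun=> 0).
Proof.
exists (fun _ _ => 0); split=> [i|].
  by split=> //; exact: regular_const.
by apply: near_ptT => y; rewrite big1 // => i _; rewrite mulr0.
Qed.

Section Mixed.

Variables (f1 f2 : A -> A).
Hypotheses (m1 : is_morphism c c f1) (m2 : is_morphism c c f2).
Hypotheses (f10 : f1 0 = 0) (f20 : f2 0 = 0).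

(** For a function of one factor the mixed difference is 0. Sums, products and inverses change it
    only by multiples of mixed differences and by products of increments along the two axes, which
    lie in the square of the maximal ideal. *)
Lemma mixed_difference (phi : A * A -> K) : regular_at (segre c c) (0, 0) phi ->
  in_m2 (fun y => phi (f1 y, f2 y) - phi (f1 y, 0) - phi (0, f2 y) + phi (0, 0)).
Proof.
move=> h; pose P phi := regular_at (segre c c) (0, 0) phi /\
  in_m2 (fun y => phi (f1 y, f2 y) - phi (f1 y, 0) - phi (0, f2 y) + phi (0, 0)).
suff : P phi by case.
have cn := @av_coord_neq0 K A.
have sn (y : A * A) : segre c c y != 0 by exact: segre_neq0.
have mp12 := morphism_pair cn cn m1 m2.
have mp1 := morphism_pair cn cn m1 (@morphism_const _ _ _ _ _ c c 0).
have mp2 := morphism_pair cn cn (@morphism_const _ _ _ _ _ c c 0) m2.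
have pb1 (f : A * A -> K) : regular_at (segre c c) (0, 0) f -> in_m (fun y => f (f1 y, 0) - f (0, 0)).
  move=> rf; split; last by rewrite f10 subrr.
  by apply: regularB; [apply: mp1; rewrite f10 | exact: regular_const].
have pb2 (f : A * A -> K) : regular_at (segre c c) (0, 0) f -> in_m (fun y => f (0, f2 y) - f (0, 0)).
  move=> rf; split; last by rewrite f20 subrr.
  by apply: regularB; [apply: mp2; rewrite f20 | exact: regular_const].
have pb12 (f : A * A -> K) : regular_at (segre c c) (0, 0) f -> regular_at c 0 (fun y => f (f1 y, f2 y)).
  by move=> rf; apply: mp12; rewrite f10 f20.
have nb (f g : A * A -> K) : near_pt (segre c c) (0, 0) (fun y => g y = f y) ->
   near_pt c 0 (fun y => (g (f1 y, f2 y) = f (f1 y, f2 y)) /\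
     (g (f1 y, 0) = f (f1 y, 0) /\ g (0, f2 y) = f (0, f2 y))).
  move=> e; apply: near_ptI; [|apply: near_ptI].
  - by apply: (morphism_near (P := fun z => g z = f z) sn mp12); rewrite f10 f20.
  - by apply: (morphism_near (P := fun z => g z = f z) sn mp1); rewrite f10.
  - by apply: (morphism_near (P := fun z => g z = f z) sn mp2); rewrite f20.
move: phi h; apply: (@segre_regular_ind _ _ _ _ _ c c (0, 0) p p P) => //.
- move=> a; split; first exact: regular_const.
  by apply: in_m2_ext in_m2_0 _ => y; ring.
- move=> i; split.
    have := @regular_aff _ _ _ (segre c c) (mxvec_index p p) (mxvec_index i p) (0, 0).
    rewrite segreE mulf_neq0 // => /(_ isT) h; apply: regular_near h _.
    have h : near_pt (segre c c) (0, 0) (fun y => segre c c y 0 (mxvec_index p p) != 0).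
      by apply: near_pt_coord; rewrite segreE mulf_neq0.
    apply: near_pt_sub h => y; rewrite segreE mulf_eq0 negb_or => /andP[h1 h2].
    by rewrite /aff !segreE; field; rewrite h1 h2.
  by apply: in_m2_ext in_m2_0 _ => y /=; ring.
- move=> i; split.
    have := @regular_aff _ _ _ (segre c c) (mxvec_index p p) (mxvec_index p i) (0, 0).
    rewrite segreE mulf_neq0 // => /(_ isT) h; apply: regular_near h _.
    have h : near_pt (segre c c) (0, 0) (fun y => segre c c y 0 (mxvec_index p p) != 0).
      by apply: near_pt_coord; rewrite segreE mulf_neq0.
    apply: near_pt_sub h => y; rewrite segreE mulf_eq0 negb_or => /andP[h1 h2].
    by rewrite /aff !segreE; field; rewrite h1 h2.
  by apply: in_m2_ext in_m2_0 _ => y /=; ring.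
- move=> f g [rf hf] [rg hg]; split; first exact: regularD.
  by apply: in_m2_ext (in_m2D hf hg) _ => y; ring.
- move=> f g [rf hf] [rg hg]; split; first exact: regularM.
  have h1 := in_m2Ml (pb12 _ rg) hf; have h2 := in_m2Ml (pb12 _ rf) hg.
  (* With p, q the increments of f and p', q' those of g along the axes,
     f g = (f00 + p + q + m2) (g00 + p' + q' + m2), and the products of
     increments lie in m2. *)
  have e1 := in_m2M (pb1 _ rf) (pb2 _ rg).
  have e2 := in_m2M (pb2 _ rf) (pb1 _ rg).
  pose u y := f (f1 y, 0) - f (0, 0); pose v y := f (0, f2 y) - f (0, 0).
  have ru : regular_at c 0 (fun y => f (0, 0) + u y + v y).
    apply: regularD; last exact: (pb2 _ rf).1.
    by apply: regularD; [exact: regular_const | exact: (pb1 _ rf).1].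
  apply: in_m2_ext (in_m2D (in_m2D h1 (in_m2Ml ru hg)) (in_m2D e1 e2)) _ => y.
  by rewrite /u /v; ring.
- move=> f [rf hf] f0; split; first exact: regularV.
  have r1 : regular_at c 0 (fun y => (f (f1 y, f2 y))^-1).
    by apply: regularV; [exact: pb12 | rewrite f10 f20].
  have r2 : regular_at c 0 (fun y => (f (f1 y, 0))^-1).
    by apply: regularV; [by apply: mp1; rewrite f10 | rewrite f10].
  have r3 : regular_at c 0 (fun y => (f (0, f2 y))^-1).
    by apply: regularV; [by apply: mp2; rewrite f20 | rewrite f20].
  have e := in_m2M (pb1 _ rf) (pb2 _ rf).
  have n1 := regular_neq0 (pb12 _ rf) (_ : f (f1 0, f2 0) != 0).
  rewrite f10 f20 in n1; have {}n1 := n1 f0.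
  have rr1 : regular_at c 0 (fun y => f (f1 y, 0)) by apply: mp1; rewrite f10.
  have rr2 : regular_at c 0 (fun y => f (0, f2 y)) by apply: mp2; rewrite f20.
  have n2 : near_pt c 0 (fun y => f (f1 y, 0) != 0) by apply: regular_neq0 => //; rewrite f10.
  have n3 : near_pt c 0 (fun y => f (0, f2 y) != 0) by apply: regular_neq0 => //; rewrite f20.
  (* The mixed difference of [1 / f], over the common denominator: one multiple of the product of
     the two increments of [f] and one of the mixed difference of [f]. *)
  pose w y := (f (f1 y, f2 y))^-1 * (f (f1 y, 0))^-1 * (f (0, f2 y))^-1 * (f (0, 0))^-1.
  have rw : regular_at c 0 w.
    by apply: regularM; [apply: regularM => //; exact: regularM | exact: regular_const].
  have rs : regular_at c 0 (fun y => w y * (f (f1 y, 0) + f (0, f2 y))).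
    by apply: regularM => //; exact: regularD.
  have rt : regular_at c 0 (fun y => w y * (f (f1 y, 0) * f (0, f2 y)
      - (f (f1 y, 0) + f (0, f2 y)) * f (0, 0))).
    apply: regularM => //; apply: regularB; first exact: regularM.
    by apply: regularM; [exact: regularD | exact: regular_const].
  apply: in_m2_near (in_m2D (in_m2Ml rs e) (in_m2Ml rt hf)) _.
  apply: near_pt_sub (near_ptI n1 (near_ptI n2 n3)) => y [h1 [h2 h3]].
  by rewrite /w; field; rewrite h1 h2 h3 f0.
- move=> f g [rf hf] e; split; first exact: regular_near e.
  apply: in_m2_near hf _; apply: near_pt_sub (nb _ _ e) => y [-> [-> ->]].
  by rewrite (near_pt_self e).
Qed.

(** To first order at 0 the group law is vector addition. *)
Lemma loc_addr i : in_m2 (fun y => loc i (f1 y + f2 y) - loc i (f1 y) - loc i (f2 y)).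
Proof.
have reg : regular_at (segre c c) (0, 0) (fun y : A * A => loc i (y.1 + y.2)).
  by apply: (@av_add K A (0, 0) (loc i)); rewrite /= addr0; exact: regular_loc.
apply: in_m2_ext (mixed_difference reg) _ => y /=.
by rewrite !addr0 add0r loc0 addr0.
Qed.

End Mixed.

Lemma loc_mulz i (k : int) : in_m2 (fun y => loc i (mulz_pt k y) - k%:~R * loc i y).
Proof.
have mn (n : nat) := @morphism_mulz K A n.
have n0 (k' : int) : mulz_pt k' (0 : A) = 0 by rewrite /mulz_pt mul0rz.
have nat_case (n : nat) : in_m2 (fun y => loc i (mulz_pt n y) - n%:R * loc i y).
  elim: n => [|n IH].
    by apply: in_m2_ext in_m2_0 _ => y; rewrite /mulz_pt mulr0z loc0 mul0r subrr.
  have h := loc_addr (@morphism_id _ _ _ c) (mn n) (erefl 0) (n0 _) i.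
  apply: in_m2_ext (in_m2D h IH) _ => y /=.
  have -> : mulz_pt n.+1 y = y + mulz_pt n y by rewrite /mulz_pt -!pmulrn mulrS.
  by rewrite mulrS; ring.
case: k => n; first exact: nat_case.
have mm := @morphism_mulz K A (Negz n).
have h := loc_addr (mn n.+1) mm (n0 _) (n0 _) i.
apply: in_m2_ext (in_m2N (in_m2D h (nat_case n.+1))) _ => y /=.
have -> : mulz_pt n.+1 y + mulz_pt (Negz n) y = 0.
  by rewrite /mulz_pt NegzE mulrNz subrr.
by rewrite loc0 NegzE mulrNz; ring.
Qed.

Section NonzeroMultiple.

Variable k : int.
Hypothesis k0 : k%:~R != 0 :> K.

(** The pull-backs of the [loc j] are [k + n] applied to the vector of the [loc j], where the matrix
    [n] vanishes at 0. As [k] is invertible in [K], so is this matrix near 0, and Cramer's rule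
    recovers [loc i]. *)
Lemma loc_fibre_ideal i : exists q : 'I_N -> A -> K,
  (forall j, regular_at c 0 (q j)) /\
  near_pt c 0 (fun y => loc i y = \sum_j loc j (mulz_pt k y) * q j y).
Proof.
have E j : exists n : 'I_N -> A -> K, (forall l, in_m (n l)) /\
    near_pt c 0 (fun y => loc j (mulz_pt k y) - k%:~R * loc j y = \sum_l loc l y * n l y).
  exact: loc_mulz.
have [n hn] : exists n : 'I_N -> 'I_N -> A -> K, forall j, (forall l, in_m (n j l)) /\
    near_pt c 0 (fun y => loc j (mulz_pt k y) - k%:~R * loc j y = \sum_l loc l y * n j l y).
  by exists (fun j => projT1 (cid (E j))) => j; case: (cid (E j)).
pose B y : 'M[K]_N := \matrix_(j, l) (k%:~R * (j == l)%:R + n j l y).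
have rB j l : regular_at c 0 (fun y => B y j l).
  apply: (@regular_ext _ _ _ _ _ (fun y => k%:~R * (j == l)%:R + n j l y)) => [|y]; last by rewrite mxE.
  by apply: regularD; [exact: regular_const | exact: ((hn j).1 l).1].
have rdet := regular_det rB.
have det0 : \det (B 0) != 0.
  have -> : B 0 = (k%:~R)%:M.
    by apply/matrixP => j l; rewrite !mxE ((hn j).1 l).2 addr0 mulr_natr.
  by rewrite det_scalar expf_neq0.
exists (fun j y => (\adj (B y)) i j / \det (B y)); split=> [j|].
  by apply: regularM; [exact: regular_adj | exact: regularV].
have all : near_pt c 0 (fun y => forall j,
    loc j (mulz_pt k y) - k%:~R * loc j y = \sum_l loc l y * n j l y).
  have s (r : seq 'I_N) : near_pt c 0 (fun y => forall j, j \in r ->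
    loc j (mulz_pt k y) - k%:~R * loc j y = \sum_l loc l y * n j l y).
    elim: r => [|j r IH]; first exact: near_ptT.
    apply: near_pt_sub (near_ptI (hn j).2 IH) => y [h1 h2] l.
    by rewrite inE => /orP[/eqP->|/h2].
  by apply: near_pt_sub (s (enum 'I_N)) => y h j; apply: h; rewrite mem_enum.
apply: near_pt_sub (near_ptI all (regular_neq0 rdet det0)) => y [h dy].
pose tv : 'cV[K]_N := \col_j loc j y.
pose Tv : 'cV[K]_N := \col_j loc j (mulz_pt k y).
have eT : B y *m tv = Tv.
  apply/colP => j; rewrite !mxE.
  under eq_bigr => l _ do rewrite !mxE mulrDl.
  rewrite big_split /= (bigD1 j) //= eqxx mulr1 [X in _ + X + _]big1 ?addr0 => [|l].
    have -> : \sum_l n j l y * loc l y = \sum_l loc l y * n j l y.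
      by apply: eq_bigr => l _; rewrite mulrC.
    by rewrite -h addrCA subrr addr0.
  by rewrite eq_sym => /negbTE ->; rewrite mulr0 mul0r.
have : \adj (B y) *m Tv = \det (B y) *: tv by rewrite -eT mulmxA mul_adj_mx mul_scalar_mx.
move=> /colP/(_ i); rewrite !mxE => e.
apply: (mulfI dy); rewrite -e mulr_sumr; apply: eq_bigr => j _; rewrite !mxE.
by field.
Qed.

(** [[k]] is unramified: the fibre ideal is the whole maximal ideal. Translations move the case of
    the origin to [x], because [[k]] is additive. *)
Lemma fibre_ideal_mulz (x : A) phi : regular_at c x phi -> phi x = 0 ->
  @fibre_ideal K A A (mulz_pt k) x phi.
Proof.
move=> rphi phix.
have mt (a : A) := @morphism_translation K A a.
have r0 : regular_at c 0 (fun z => phi (z + x)) by apply: (mt x 0); rewrite add0r.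
have [ps [rps hps]] := regular_loc_gen r0.
have [q hq] : exists q : 'I_N -> 'I_N -> A -> K, forall i,
  (forall j, regular_at c 0 (q i j)) /\
  near_pt c 0 (fun y => loc i y = \sum_j loc j (mulz_pt k y) * q i j y).
  by exists (fun i => projT1 (cid (loc_fibre_ideal i))) => i; case: (cid _).
have all : near_pt c 0 (fun y => forall i, loc i y = \sum_j loc j (mulz_pt k y) * q i j y).
  have s (r : seq 'I_N) : near_pt c 0 (fun y => forall i, i \in r ->
      loc i y = \sum_j loc j (mulz_pt k y) * q i j y).
    elim: r => [|i r IH]; first exact: near_ptT.
    apply: near_pt_sub (near_ptI (hq i).2 IH) => y [h1 h2] l.
    by rewrite inE => /orP[/eqP->|/h2].
  by apply: near_pt_sub (s (enum 'I_N)) => y h j; apply: h; rewrite mem_enum.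
pose Q j y := \sum_i ps i y * q i j y.
have rQ j : regular_at c 0 (Q j).
  by apply: regular_sum => i _; apply: regularM => //; exact: (hq i).1.
have e0 : near_pt c 0 (fun z => phi (z + x) = \sum_j loc j (mulz_pt k z) * Q j z).
  apply: near_pt_sub (near_ptI hps all) => z [h1 h2].
  move: h1; rewrite add0r phix subr0 => ->.
  under eq_bigr => i _ do rewrite h2 mulr_suml.
  rewrite exchange_big /=; apply: eq_bigr => j _; rewrite mulr_sumr.
  by apply: eq_bigr => i _; ring.
exists [seq ((fun w => loc j (w - mulz_pt k x)), (fun y => Q j (y - x))) | j <- enum 'I_N].
split.
  move=> i; rewrite size_map => hi.
  have [j0 hj] : exists j : 'I_N, true by move: hi; case: (enum 'I_N) => // j; exists j.
  rewrite (nth_map j0) //=; split.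
  - apply: (mt (- mulz_pt k x)); rewrite subrr; exact: regular_loc.
  - by rewrite subrr loc0.
  - by apply: (mt (- x)); rewrite subrr.
have := morphism_near (@av_coord_neq0 K A) (mt (- x)) (x := x) 
  (P := fun z => phi (z + x) = \sum_j loc j (mulz_pt k z) * Q j z).
rewrite /= subrr => /(_ e0); apply: near_pt_sub => y; rewrite subrK => ->.
rewrite big_map big_enum /=; apply: eq_bigr => j _.
by rewrite /mulz_pt mulrzBl.
Qed.

Lemma fibre_ideal_value (f : A -> A) (x : A) phi : @fibre_ideal K A A f x phi -> phi x = 0.
Proof.
move=> [s [hs hn]]; have /= -> := near_pt_self hn.
rewrite (big_nth (fun=> 0, fun=> 0)) big_nat big1 // => i /andP[_ hi].
by have [_ -> _] := hs i hi; rewrite mul0r.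
Qed.

Lemma fibre_mult_mulz (x : A) : @fibre_mult K A A (mulz_pt k) x 1.
Proof.
exists (fun _ _ => 1); split=> [j|phi rphi]; first exact: regular_const.
exists (const_mx (phi x)); split.
  apply: fibre_ideal_mulz.
    apply: regularB => //; apply: regular_sum => j _; apply: regularM; exact: regular_const.
  by rewrite big_ord1 mxE mulr1 subrr.
move=> v /fibre_ideal_value; rewrite big_ord1 mulr1 => /eqP; rewrite subr_eq0 => /eqP e.
by apply/rowP => j; rewrite mxE e [j]ord1.
Qed.

(** A pull-back cycle comes with some multiplicity, which must be identified. The local ring modulo
    the fibre ideal is [K] by evaluation at [x], and two basis germs would have proportional values
    there. *)
Lemma fibre_mult_mulz_unique (x : A) e : @fibre_mult K A A (mulz_pt k) x e -> e = 1%N.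
Proof.
move=> [b [rb hb]].
have [v [hv uv]] := hb _ (regular_const _ x 1).
have ev := fibre_ideal_value hv.
have uniq (w : 'rV[K]_e) : \sum_j w 0 j * b j x = 0 -> w = 0.
  move=> hw; have e2 : v = v + w; last first.
    by apply: (addrI v); rewrite addr0.
  apply: uv; apply: fibre_ideal_mulz.
    apply: regularB; first exact: regular_const.
    by apply: regular_sum => j _; apply: regularM => //; exact: regular_const.
  rewrite -[RHS]ev; congr (_ - _).
  under eq_bigr => j _ do rewrite mxE mulrDl.
  by rewrite big_split /= hw addr0.
case: e b rb hb v hv uv ev uniq => [|[|e]] // b rb hb v hv uv ev uniq.
  by move: ev; rewrite big_ord0 subr0 => /eqP; rewrite oner_eq0.
pose i0 : 'I_e.+2 := ord0; pose i1 : 'I_e.+2 := lift ord0 ord0.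
have n01 : (i0 == i1) = false by [].
have n10 : (i1 == i0) = false by [].
pose w : 'rV[K]_e.+2 := \row_j (b i1 x * (j == i0)%:R - b i0 x * (j == i1)%:R).
have w0 : w = 0.
  apply: uniq; rewrite (bigD1 i0) //= (bigD1 i1) //= big1 => [|j /andP[j0 j1]].
    by rewrite !mxE !eqxx n01 n10 /=; ring.
  by rewrite mxE (negbTE j0) (negbTE j1) !mulr0 subrr mul0r.
have b1 : b i1 x = 0.
  by move/rowP/(_ i0): w0; rewrite !mxE eqxx n01 mulr1 mulr0 subr0.
have : delta_mx 0 i1 = 0 :> 'rV[K]_e.+2.
  apply: uniq; rewrite (bigD1 i1) //= big1 => [|j j1]; first by rewrite b1 mulr0 addr0.
  by rewrite mxE (negbTE j1) mul0r.
by move=> /rowP/(_ i1); rewrite !mxE !eqxx => /eqP; rewrite oner_eq0.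
Qed.

End NonzeroMultiple.

End Etale.

(** * Push-forward and pull-back of zero-cycles *)

Section FreegLift.

Variables (T : choiceType) (M : lmodType rat) (f : T -> M).

Lemma fgliftB D E : fglift f (D - E) = fglift f D - fglift f E.
Proof. exact: lift_is_additive. Qed.

Lemma fglift0 : fglift f 0 = 0.
Proof. by rewrite -(subrr 0) fgliftB subrr. Qed.

Lemma fgliftD D E : fglift f (D + E) = fglift f D + fglift f E.
Proof. by rewrite -{1}(opprK E) fgliftB -(sub0r E) fgliftB fglift0 sub0r opprK. Qed.

Lemma fglift_sum (I : Type) (r : seq I) (P : pred I) F :
  fglift f (\sum_(i <- r | P i) F i) = \sum_(i <- r | P i) fglift f (F i).
Proof. by apply: big_morph; [exact: fgliftD | exact: fglift0]. Qed.

Lemma fgliftE D : fglift f D = \sum_(x <- dom D) coeff x D *: f x.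
Proof. by rewrite -{1}(freeg_sumE D) fglift_sum; apply: eq_bigr => x _; rewrite liftU. Qed.

Lemma freegUZ (q : rat) (x : T) : << q *g x >> = q *: << x >> :> {freeg T / rat}.
Proof. by apply/eqP/freeg_eqP => y; rewrite coeffZ !coeffU mul1r. Qed.

Lemma freeg_sumZ (D : {freeg T / rat}) : D = \sum_(x <- dom D) coeff x D *: << x >>.
Proof. by rewrite -[LHS]freeg_sumE; apply: eq_bigr => x _; rewrite freegUZ. Qed.

Lemma fgliftZ q D : fglift f (q *: D) = q *: fglift f D.
Proof.
rewrite [in LHS](freeg_sumZ D) scaler_sumr fglift_sum fgliftE scaler_sumr.
by apply: eq_bigr => x _; rewrite scalerA -freegUZ liftU scalerA.
Qed.

End FreegLift.

Section Push.

Variables (K : closedFieldType).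

Lemma push_cycleU (X Y : projVariety K) (f : X -> Y) x :
  push_cycle f << x >> = << f x >>.
Proof. by rewrite /push_cycle liftU scale1r. Qed.

Lemma push_cycleD (X Y : projVariety K) (f : X -> Y) D E :
  push_cycle f (D + E) = push_cycle f D + push_cycle f E.
Proof. exact: fgliftD. Qed.

Lemma push_cycleB (X Y : projVariety K) (f : X -> Y) D E :
  push_cycle f (D - E) = push_cycle f D - push_cycle f E.
Proof. exact: fgliftB. Qed.

Lemma push_cycleZ (X Y : projVariety K) (f : X -> Y) q D :
  push_cycle f (q *: D) = q *: push_cycle f D.
Proof. exact: fgliftZ. Qed.

Lemma push_cycle_sum (X Y : projVariety K) (f : X -> Y) (I : Type) (r : seq I) (P : pred I) F :
  push_cycle f (\sum_(i <- r | P i) F i) = \sum_(i <- r | P i) push_cycle f (F i).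
Proof. exact: fglift_sum. Qed.

Lemma push_cycleE (X Y : projVariety K) (f : X -> Y) D :
  push_cycle f D = \sum_(x <- dom D) coeff x D *: << f x >>.
Proof. exact: fgliftE. Qed.

Lemma push_cycle_comp (X Y Z : projVariety K) (f : X -> Y) (g : Y -> Z) D :
  push_cycle g (push_cycle f D) = push_cycle (g \o f) D.
Proof.
rewrite [push_cycle f D]push_cycleE push_cycle_sum push_cycleE; apply: eq_bigr => x _.
by rewrite push_cycleZ push_cycleU.
Qed.

(** Principal cycles are themselves push-forwards from smooth curves, so composing [nu] with [f]
    suffices. *)
Lemma push_rat_trivial (X Y : projVariety K) (f : X -> Y) alpha :
  is_morphism (@pv_coord K X) (@pv_coord K Y) f ->
  rat_trivial alpha -> rat_trivial (push_cycle f alpha).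
Proof.
move=> mf [s [hs ->]]; exists [seq (p.1, push_cycle f p.2) | p <- s]; split.
  move=> _ /mapP[p /hs [C [nu [d [F [G [D [[sC mnu] FG nz dv e]]]]]]] ->].
  exists C, (f \o nu), d, F, G, D; split=> //=; first by split=> //; exact: morphism_comp mf.
  by rewrite e push_cycle_comp.
rewrite push_cycle_sum big_map; apply: eq_bigr => p _; exact: push_cycleZ.
Qed.

Definition push_class (X Y : projVariety K) (f : X -> Y) (a : CH0 X) : CH0 Y :=
  CH0_class (push_cycle f (repr a)).

Section Class.

Variables (X Y : projVariety K) (f : X -> Y).
Hypothesis mf : is_morphism (@pv_coord K X) (@pv_coord K Y) f.

Lemma push_classE D : push_class f (CH0_class D) = CH0_class (push_cycle f D).
Proof.
apply/CH0_classP; rewrite -push_cycleB; apply: push_rat_trivial => //.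
by apply/CH0_classP; rewrite CH0_class_repr.
Qed.

Lemma push_classD a b : push_class f (a + b) = push_class f a + push_class f b.
Proof.
rewrite -(CH0_class_repr a) -(CH0_class_repr b) -CH0_classD !push_classE.
by rewrite push_cycleD CH0_classD.
Qed.

Lemma push_classZ q a : push_class f (q *: a) = q *: push_class f a.
Proof.
have e (Z : projVariety K) (b : CH0 Z) : q *: b = CH0_scale q b by [].
rewrite !e -(CH0_class_repr a) -CH0_classZ !push_classE push_cycleZ CH0_classZ //.
Qed.

Lemma push_class0 : push_class f 0 = 0.
Proof. by rewrite -(scale0r (0 : CH0 X)) push_classZ scale0r. Qed.

Lemma push_class_sum (I : Type) (r : seq I) (P : pred I) F :
  push_class f (\sum_(i <- r | P i) F i) = \sum_(i <- r | P i) push_class f (F i).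
Proof. by apply: big_morph; [exact: push_classD | exact: push_class0]. Qed.

Lemma push_class_pt x : push_class f (pt_class x) = pt_class (f x).
Proof. by rewrite /pt_class push_classE push_cycleU. Qed.

End Class.

End Push.

Section MultiplicationPullback.

Variables (K : closedFieldType) (A : abelianVariety K) (g : nat).
Notation c := (@av_coord K A).
Variable n : nat.
Hypothesis n0 : n.+1%:R != 0 :> K.

Let k : int := n.+1.

Let k0 : k%:~R != 0 :> K. Proof. by rewrite -pmulrn. Qed.

Lemma pullback_coeff alpha beta x : @pullback_cycle K A g k alpha beta ->
  coeff x beta = coeff (x *+ n.+1) alpha.
Proof.
rewrite /pullback_cycle /= => h; have [e fe ->] := h x.
have [p p0] := exists_coord (@av_coord_neq0 K A 0).
by rewrite (fibre_mult_mulz_unique p0 k0 fe) mul1r.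
Qed.

(** The coefficient of [beta] at [x] depends only on the multiple [x *+ n.+1], so the finite support
    of [beta] contains the coset of the kernel through any of its points. *)
Lemma pullback_finite_kernel alpha beta : @pullback_cycle K A g k alpha beta ->
  beta != 0 -> exists ker : seq A, uniq ker /\ forall z, (z \in ker) = (z *+ n.+1 == 0).
Proof.
move=> hp b0.
have [x0 hx0] : exists x0, x0 \in dom beta.
  case e: (dom beta) => [|x s]; last by exists x; rewrite mem_head.
  by move: b0; rewrite -dom_eq0 e.
exists [seq z <- [seq x - x0 | x <- dom beta] | z *+ n.+1 == 0]; split.
  by rewrite filter_uniq // map_inj_uniq ?uniq_dom //; exact: addIr.
move=> z; rewrite mem_filter; case: eqP => //= hz.
apply/mapP; exists (x0 + z); last by rewrite addrAC subrr add0r.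
rewrite mem_dom (pullback_coeff _ hp) mulrnDl hz addr0 -(pullback_coeff _ hp).
by rewrite -mem_dom.
Qed.

(** By surjectivity each fibre is a nonempty coset of the kernel, and [beta] is constant on it. *)
Lemma push_pullback alpha beta (ker : seq A) :
  uniq ker -> (forall z, (z \in ker) = (z *+ n.+1 == 0)) ->
  (forall y : A, exists x, y = x *+ n.+1) ->
  @pullback_cycle K A g k alpha beta ->
  @push_cycle K A A (@mulz_pt K A k) beta = (size ker)%:R *: alpha.
Proof.
move=> uker hker surj hp; apply/eqP/freeg_eqP => y /=.
have [x0 ey] := surj y.
rewrite push_cycleE (big_morph (coeff y) (coeffD y) (coeff0 _ y)) coeffZ.
rewrite (eq_bigr (fun x => if x *+ n.+1 == y then coeff x beta else 0)); last first.
  move=> x _; rewrite coeffZ coeffU mul1r /mulz_pt -pmulrn.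
  by case: eqP => _; rewrite ?mulr1 ?mulr0.
rewrite -big_mkcond /=.
have e1 : \sum_(x <- dom beta | x *+ n.+1 == y) coeff x beta
    = \sum_(x <- [seq x0 + z | z <- ker] | x \in dom beta) coeff x beta.
  rewrite -[LHS]big_filter -[RHS]big_filter; apply: perm_big; apply: uniq_perm.
  - by rewrite filter_uniq // uniq_dom.
  - by rewrite filter_uniq // map_inj_uniq //; exact: addrI.
  move=> x; rewrite !mem_filter andbC; congr (_ && _).
  apply/eqP/mapP => [e|[z]].
    by exists (x - x0); [rewrite hker mulrnBl e ey subrr | rewrite addrCA subrr addr0].
  by rewrite hker => /eqP hz ->; rewrite mulrnDl hz addr0 ey.
rewrite e1 big_mkcond /= big_map.
rewrite (eq_big_seq (fun=> coeff y alpha)) => [|z]; last first.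
  rewrite hker => /eqP hz; have e : coeff (x0 + z) beta = coeff y alpha.
    by rewrite (pullback_coeff _ hp) mulrnDl hz addr0 ey.
  by case: ifP => // /negbT; rewrite -e => h; rewrite coeff_outdom.
by rewrite big_const_seq count_predT iter_addr_0 mulr_natl.
Qed.

End MultiplicationPullback.

(** * Zero-cycles as values of polynomials *)

Section CycleRing.

Variables (K : closedFieldType) (A : abelianVariety K) (n : nat) (z : 'I_n -> A).

(* Monomials in the z_i give points and polynomials give cycles; multiplication
   of polynomials becomes the Pontryagin product. *)
Definition mon_pt (m : 'X_{1..n}) : A := \sum_i z i *+ m i.

Definition mon_cycle (p : {mpoly rat[n]}) : cycle0 A :=
  fglift (fun m => << mon_pt m >> : cycle0 A) (mpoly_val p).

Lemma mon_cycleD p q : mon_cycle (p + q) = mon_cycle p + mon_cycle q.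
Proof. by rewrite /mon_cycle -fgliftD. Qed.

Lemma mon_cycleZ a p : mon_cycle (a *: p) = a *: mon_cycle p.
Proof. by rewrite /mon_cycle -fgliftZ. Qed.

Lemma mon_cycle0 : mon_cycle 0 = 0.
Proof. by rewrite -(scale0r (0 : {mpoly rat[n]})) mon_cycleZ scale0r. Qed.

Lemma mon_cycleB p q : mon_cycle (p - q) = mon_cycle p - mon_cycle q.
Proof. by rewrite -scaleN1r mon_cycleD mon_cycleZ scaleN1r. Qed.

Lemma mon_cycle_sum (I : Type) (r : seq I) (P : pred I) F :
  mon_cycle (\sum_(i <- r | P i) F i) = \sum_(i <- r | P i) mon_cycle (F i).
Proof. by apply: big_morph; [exact: mon_cycleD | exact: mon_cycle0]. Qed.

Lemma mon_cycleX m : mon_cycle 'X_[m] = << mon_pt m >>.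
Proof. by rewrite -['X_[m]]scale1r -MPolyU /mon_cycle /= liftU scale1r. Qed.

Lemma mon_cycleXn i k : mon_cycle ('X_i ^+ k) = << z i *+ k >>.
Proof.
rewrite mpolyXn mon_cycleX /mon_pt (bigD1 i) //= big1 => [|j ji].
  by rewrite mulmnE mnm1E eqxx mul1n addr0.
by rewrite mulmnE mnm1E eq_sym (negbTE ji) mul0n mulr0n.
Qed.

Lemma mon_cycleXM m p : mon_cycle ('X_[m] * p) = @push_cycle K A A (fun x : A => x + mon_pt m) (mon_cycle p).
Proof.
elim/mpolyind: p => [|a m' p _ _ IH].
  by rewrite mulr0 mon_cycle0 /push_cycle fglift0.
rewrite mulrDr !mon_cycleD push_cycleD IH; congr (_ + _).
rewrite -scalerAr -mpolyXD !mon_cycleZ push_cycleZ !mon_cycleX push_cycleU.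
congr (_ *: << _ >>); rewrite /mon_pt -big_split /=; apply: eq_bigr => i _.
by rewrite mnmDE mulrnDr addrC.
Qed.

Lemma rat_trivial0 (X : projVariety K) : rat_trivial (0 : cycle0 X).
Proof. by exists [::]; split=> //; rewrite big_nil. Qed.

Lemma rat_trivialD (X : projVariety K) (a b : cycle0 X) :
  rat_trivial a -> rat_trivial b -> rat_trivial (a + b).
Proof.
move=> [s [hs ->]] [t [ht ->]]; exists (s ++ t); split; last by rewrite big_cat.
by move=> p; rewrite mem_cat => /orP[/hs|/ht].
Qed.

Definition mon_ideal (p : {mpoly rat[n]}) : Prop := rat_trivial (mon_cycle p).

(** By linearity only multiplication by a monomial matters. It is push-forward along a translation,
    which preserves rational triviality. *)
Lemma mon_ideal_is_ideal : is_ideal mon_ideal.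
Proof.
split; rewrite /mon_ideal; first by rewrite mon_cycle0; exact: rat_trivial0.
  by move=> p q; rewrite mon_cycleD; exact: rat_trivialD.
move=> a p hp; elim/mpolyind: a => [|a m q _ _ IH].
  by rewrite mul0r mon_cycle0; exact: rat_trivial0.
rewrite mulrDl mon_cycleD; apply: rat_trivialD => //.
rewrite -scalerAl mon_cycleZ; apply: rat_trivialZ; rewrite mon_cycleXM.
apply: push_rat_trivial => //; exact: morphism_translation.
Qed.

Lemma mon_cycle_supported (D : cycle0 A) :
  (forall x, x \in dom D -> exists i, z i = x) -> exists p, mon_cycle p = D.
Proof.
move=> h; rewrite (freeg_sumZ D).
have : {subset dom D <= dom D} by [].
elim: {1 3}(dom D) => [|x s IH] hs; first by exists 0; rewrite mon_cycle0 big_nil.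
have [|p ep] := IH; first by move=> y ys; apply: hs; rewrite inE ys orbT.
have [i ei] := h x (hs _ (mem_head _ _)).
exists (coeff x D *: 'X_i + p); rewrite mon_cycleD ep big_cons mon_cycleZ; congr (_ *: _ + _).
by rewrite -['X_i]expr1 mon_cycleXn mulr1n ei.
Qed.

End CycleRing.

(** * Extension of homomorphisms with bounds *)

(** The last field makes the absolute value archimedean and forces characteristic 0. *)
Record is_norm (R : realType) (K : fieldType) (nrm : K -> R) : Prop := IsNorm {
  nrm_ge0 : forall x, 0 <= nrm x;
  nrm_eq0 : forall x, nrm x = 0 -> x = 0;
  nrmD : forall x y, nrm (x + y) <= nrm x + nrm y;
  nrmM : forall x y, nrm (x * y) = nrm x * nrm y;
  nrm_nat : forall n : nat, nrm n%:R = n%:R }.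

Section NormTheory.

Variables (R : realType) (K : fieldType) (nrm : K -> R).
Hypothesis hn : is_norm nrm.

Lemma nrm0 : nrm 0 = 0. Proof. exact: nrm_nat hn 0. Qed.
Lemma nrm1 : nrm 1 = 1. Proof. exact: nrm_nat hn 1. Qed.

Lemma nrmN x : nrm (- x) = nrm x.
Proof.
have e : nrm (-1) = 1.
  have h : nrm (-1) ^+ 2 = 1 by rewrite expr2 -(nrmM hn) mulrNN mulr1 nrm1.
  have := nrm_ge0 hn (-1); move/eqP: h; rewrite sqrf_eq1 => /orP[/eqP //|/eqP ->].
  by rewrite oppr_ge0 ler10.
by rewrite -mulN1r (nrmM hn) e mul1r.
Qed.

Lemma nrmB x y : nrm (x - y) <= nrm x + nrm y.
Proof. by rewrite -[nrm y]nrmN; exact: nrmD. Qed.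

Lemma nrmBC x y : nrm (x - y) = nrm (y - x).
Proof. by rewrite -nrmN opprB. Qed.

Lemma nrm_gt0 x : x != 0 -> 0 < nrm x.
Proof.
move=> x0; rewrite lt_def (nrm_ge0 hn) andbT; apply: contra_neq x0; exact: nrm_eq0.
Qed.

Lemma nrmV x : nrm x^-1 = (nrm x)^-1.
Proof.
have [->|x0] := eqVneq x 0; first by rewrite invr0 nrm0 invr0.
apply: (mulfI (lt0r_neq0 (nrm_gt0 x0))).
by rewrite -(nrmM hn) !divff ?nrm1 // lt0r_neq0 // nrm_gt0.
Qed.

Lemma nrmX x n : nrm (x ^+ n) = nrm x ^+ n.
Proof. by elim: n => [|n IH]; rewrite ?nrm1 // !exprS (nrmM hn) IH. Qed.

Lemma nrm_sum (I : Type) (r : seq I) (P : pred I) (F : I -> K) :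
  nrm (\sum_(i <- r | P i) F i) <= \sum_(i <- r | P i) nrm (F i).
Proof.
apply: (big_ind2 (fun x y => nrm x <= y)) => //; first by rewrite nrm0.
move=> x1 y1 x2 y2 h1 h2; apply: le_trans (nrmD hn _ _) _; exact: lerD.
Qed.

Lemma nrm_horner (p : {poly K}) (x : K) n (C D : R) : (size p <= n)%N ->
  (forall i, nrm p`_i <= C) -> nrm x <= D -> nrm p.[x] <= \sum_(i < n) C * D ^+ i.
Proof.
move=> sp hp hx.
have C0 : 0 <= C by apply: le_trans (hp 0%N); exact: nrm_ge0.
have D0 : 0 <= D by apply: le_trans hx; exact: nrm_ge0.
rewrite (horner_coef_wide _ sp); apply: le_trans (nrm_sum _ _ _) _.
apply: ler_sum => i _; rewrite (nrmM hn) nrmX; apply: ler_pM => //.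
- exact: nrm_ge0.
- by apply: exprn_ge0; exact: nrm_ge0.
- by apply: lerXn2r => //; rewrite nnegrE //; exact: nrm_ge0.
Qed.

(** A form of Cauchy's bound: if [nrm x > 1], the leading term is balanced by [n + 1] terms of size
    at most [C * nrm x ^+ n]. *)
Lemma root_bound (p : {poly K}) (x : K) n (C g : R) : size p = n.+2 ->
  (forall i, nrm p`_i <= C) -> 0 < g -> g <= nrm (lead_coef p) -> root p x ->
  nrm x <= 1 + (n.+1)%:R * C / g.
Proof.
move=> sp hp g0 hg /rootP px.
have C0 : 0 <= C by apply: le_trans (hp 0%N); exact: nrm_ge0.
have [x1|x1] := leP (nrm x) 1.
  by rewrite ler_wpDr // divr_ge0 ?(ltW g0) // mulr_ge0.
rewrite lead_coefE sp /= in hg.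
move: px; rewrite horner_coef sp big_ord_recr /= => /eqP; rewrite addrC addr_eq0 => /eqP e.
have h1 : nrm (p`_n.+1 * x ^+ n.+1) <= (n.+1)%:R * C * nrm x ^+ n.
  rewrite e nrmN; apply: le_trans (nrm_sum _ _ _) _.
  have -> : n.+1%:R * C * nrm x ^+ n = \sum_(i < n.+1) C * nrm x ^+ n.
    by rewrite sumr_const card_ord -mulrA mulr_natl.
  apply: ler_sum => i _; rewrite (nrmM hn) nrmX; apply: ler_pM => //.
  - exact: nrm_ge0.
  - by apply: exprn_ge0; exact: nrm_ge0.
  - by apply: ler_weXn2l; [exact: ltW|rewrite -ltnS].
move: h1; rewrite (nrmM hn) nrmX exprS mulrA ler_pM2r; last by rewrite exprn_gt0 // (lt_trans _ x1).
move=> h1; apply: (@le_trans _ _ (n.+1%:R * C / g)); last by rewrite lerDr.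
rewrite ler_pdivlMr //; apply: le_trans h1; rewrite mulrC.
by rewrite ler_wpM2r // (ltW (lt_trans _ x1)).
Qed.

End NormTheory.

Section Extension.

Variables (R : realType) (K : closedFieldType) (nrm : K -> R).
Hypothesis hn : is_norm nrm.
Variables (L : fieldType) (emb : {rmorphism K -> L}).

Record is_subalg (O : L -> Prop) : Prop := IsSubalg {
  sub_emb : forall a, O (emb a);
  subD : forall x y, O x -> O y -> O (x + y);
  subM : forall x y, O x -> O y -> O (x * y) }.

(** The map is total on [L] but constrained on [O] only, so extending it to a larger subalgebra does
    not change its type. *)
Record is_hom (O : L -> Prop) (phi : L -> K) : Prop := IsHom {
  hom_emb : forall a, phi (emb a) = a;
  homD : forall x y, O x -> O y -> phi (x + y) = phi x + phi y;
  homM : forall x y, O x -> O y -> phi (x * y) = phi x * phi y }.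

Definition polyO (O : L -> Prop) (p : {poly L}) := forall i, O p`_i.

Definition adjoin (O : L -> Prop) (u : L) (x : L) := exists2 p, polyO O p & x = p.[u].

Section Ring.

Variable O : L -> Prop.
Hypothesis hO : is_subalg O.

Lemma sub0 : O 0. Proof. by rewrite -(rmorph0 emb); exact: sub_emb. Qed.
Lemma sub1 : O 1. Proof. by rewrite -(rmorph1 emb); exact: sub_emb. Qed.
Lemma subN x : O x -> O (- x).
Proof.
by move=> h; rewrite -mulN1r -(rmorph1 emb) -rmorphN; apply: subM => //; exact: sub_emb.
Qed.
Lemma sub_sum (I : Type) (r : seq I) (P : pred I) (F : I -> L) :
  (forall i, P i -> O (F i)) -> O (\sum_(i <- r | P i) F i).
Proof. by move=> h; apply: big_ind => //; [exact: sub0 | exact: subD]. Qed.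
Lemma subX x n : O x -> O (x ^+ n).
Proof. by move=> h; elim: n => [|n IH]; [exact: sub1 | rewrite exprS; exact: subM]. Qed.

Lemma polyOD p q : polyO O p -> polyO O q -> polyO O (p + q).
Proof. by move=> hp hq i; rewrite coefD; exact: subD. Qed.
Lemma polyON p : polyO O p -> polyO O (- p).
Proof. by move=> hp i; rewrite coefN; exact: subN. Qed.
Lemma polyOB p q : polyO O p -> polyO O q -> polyO O (p - q).
Proof. by move=> hp /polyON; exact: polyOD. Qed.
Lemma polyOM p q : polyO O p -> polyO O q -> polyO O (p * q).
Proof. by move=> hp hq i; rewrite coefM; apply: sub_sum => j _; exact: subM. Qed.
Lemma polyOC a : O a -> polyO O a%:P.
Proof. by move=> ha i; rewrite coefC; case: ifP => // _; exact: sub0. Qed.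
Lemma polyOX : polyO O 'X.
Proof. by move=> i; rewrite coefX; case: (i == 1)%N; [exact: sub1|exact: sub0]. Qed.
Lemma polyOXn n : polyO O 'X^n.
Proof. by move=> i; rewrite coefXn; case: (_ == _); [exact: sub1|exact: sub0]. Qed.
Lemma polyOZ a p : O a -> polyO O p -> polyO O (a *: p).
Proof. by move=> ha hp i; rewrite coefZ; exact: subM. Qed.

Lemma adjoin_subalg u : is_subalg (adjoin O u).
Proof.
split.
- by move=> a; exists (emb a)%:P; [apply: polyOC; exact: sub_emb|rewrite hornerC].
- by move=> x y [p hp ->] [q hq ->]; exists (p + q); [exact: polyOD|rewrite hornerD].
- by move=> x y [p hp ->] [q hq ->]; exists (p * q); [exact: polyOM|rewrite hornerM].
Qed.

Lemma adjoin_sub u x : O x -> adjoin O u x.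
Proof. by move=> h; exists x%:P; [exact: polyOC | rewrite hornerC]. Qed.

Lemma adjoin_gen u : adjoin O u u.
Proof. by exists 'X; [exact: polyOX|rewrite hornerX]. Qed.

Lemma pseudo_division (p q : {poly L}) : polyO O p -> polyO O q -> q != 0 ->
  exists n s r, [/\ polyO O s, polyO O r, lead_coef q ^+ n *: p = s * q + r & (size r < size q)%N].
Proof.
move=> + hq q0; have [k] := ubnP (size p); elim: k p => // k IH p; rewrite ltnS => sk hp.
have [lt|le] := ltnP (size p) (size q).
  exists 0%N, 0, p; split=> //; last by rewrite expr0 scale1r mul0r add0r.
  by move=> i; rewrite coef0; exact: sub0.
pose p' := lead_coef q *: p - (lead_coef p *: 'X^(size p - size q)) * q.
have hp' : polyO O p'.
  apply: polyOB; first by apply: polyOZ => //; exact: hq.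
  by apply: polyOM => //; apply: polyOZ; [exact: hp | exact: polyOXn].
have p0 : p != 0 by apply: contraTneq le => ->; rewrite size_poly0 -ltnNge size_poly_gt0.
have sp' : (size p' < size p)%N.
  rewrite -(prednK (_ : 0 < size p)%N) ?size_poly_gt0 // ltnS; apply/leq_sizeP => j hj.
  rewrite coefB coefZ -scalerAl coefZ coefXnM.
  have sq : (0 < size q)%N by rewrite size_poly_gt0.
  have sp : (0 < size p)%N by rewrite size_poly_gt0.
  case: ltnP => [hj2|hj2].
    exfalso; move: (leq_trans hj2 (leq_subr _ _)) hj sq; move: (size p) (size q) le hj2 sp => a b.
    case: a => // a; case: b => // b; rewrite subSS /= => _ h _ h2 h3 _.
    by have := leq_ltn_trans h3 (leq_trans h (leq_subr _ _)); rewrite ltnn.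
  move: hj; rewrite leq_eqVlt => /orP[/eqP<-|hj].
    have -> : ((size p).-1 - (size p - size q) = (size q).-1)%N.
      move: (size p) (size q) le sq sp => [|a] [|b] //= le _ _.
      by rewrite subSS subKn.
    by rewrite -!lead_coefE mulrC subrr.
  rewrite !nth_default ?mulr0 ?subrr //; last by move: hj; rewrite prednK.
  rewrite leq_subRL //.
  by rewrite subnK //; move: hj; rewrite prednK.
have [|n [s [r [hs hr e sr]]]] := IH p' _ hp'; first exact: leq_trans sp' sk.
exists n.+1, (s + lead_coef q ^+ n *: (lead_coef p *: 'X^(size p - size q))), r; split=> //.
  apply: polyOD => //; apply: polyOZ; first by apply: subX; exact: hq.
  by apply: polyOZ; [exact: hp | exact: polyOXn].
rewrite exprSr -scalerA.
have -> : lead_coef q *: p = p' + (lead_coef p *: 'X^(size p - size q)) * q by rewrite subrK.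
by rewrite scalerDr e mulrDl [in RHS]addrAC -[in RHS](scalerAl (lead_coef q ^+ n)).
Qed.

End Ring.

Lemma hom0 O phi : is_hom O phi -> phi 0 = 0.
Proof. by move=> h; have := hom_emb h 0; rewrite rmorph0. Qed.

Lemma hom1 O phi : is_hom O phi -> phi 1 = 1.
Proof. by move=> h; have := hom_emb h 1; rewrite rmorph1. Qed.

Lemma hom_sum O phi (I : Type) (r : seq I) (F : I -> L) : is_subalg O -> is_hom O phi ->
  (forall i, O (F i)) -> phi (\sum_(i <- r) F i) = \sum_(i <- r) phi (F i).
Proof.
move=> hO hp hF; elim: r => [|i r IH]; first by rewrite !big_nil (hom0 hp).
by rewrite !big_cons (homD hp) ?IH //; exact: sub_sum.
Qed.

Lemma hom_coef O phi p i : is_hom O phi -> (map_poly phi p)`_i = phi p`_i.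
Proof. by move=> /hom0; exact: coef_map_id0. Qed.

Lemma hom_mapD O phi p q : is_hom O phi -> polyO O p -> polyO O q ->
  map_poly phi (p + q) = map_poly phi p + map_poly phi q.
Proof.
move=> h hp hq; apply/polyP => i.
by rewrite coefD !(hom_coef _ _ h) coefD (homD h).
Qed.

Lemma homB O phi x y : is_subalg O -> is_hom O phi -> O x -> O y ->
  phi (x - y) = phi x - phi y.
Proof.
move=> hO h hx hy; have := homD h (subD hO hx (subN hO hy)) hy.
by rewrite subrK => ->; rewrite addrK.
Qed.

Lemma hom_mapB O phi p q : is_subalg O -> is_hom O phi -> polyO O p -> polyO O q ->
  map_poly phi (p - q) = map_poly phi p - map_poly phi q.
Proof.
move=> hO h hp hq; apply/polyP => i.
by rewrite coefB !(hom_coef _ _ h) coefB (homB hO h).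
Qed.

Lemma hom_mapM O phi p q : is_subalg O -> is_hom O phi -> polyO O p -> polyO O q ->
  map_poly phi (p * q) = map_poly phi p * map_poly phi q.
Proof.
move=> hO h hp hq; apply/polyP => i.
rewrite (hom_coef _ _ h) !coefM (hom_sum _ hO h) => [|j]; last exact: subM.
by apply: eq_bigr => j _; rewrite !(hom_coef _ _ h) (homM h).
Qed.

Lemma hom_mapC O phi a : is_hom O phi -> map_poly phi a%:P = (phi a)%:P.
Proof.
move=> h; apply/polyP => i; rewrite (hom_coef _ _ h) !coefC.
by case: ifP => // _; exact: hom0 h.
Qed.

Lemma hom_mapX O phi : is_hom O phi -> map_poly phi 'X = 'X.
Proof.
move=> h; apply/polyP => i; rewrite (hom_coef _ _ h) !coefX.
by case: eqP => _; [exact: hom1 h | exact: hom0 h].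
Qed.

Lemma hom_size O phi p : is_hom O phi -> phi (lead_coef p) != 0 ->
  size (map_poly phi p) = size p /\ lead_coef (map_poly phi p) = phi (lead_coef p).
Proof.
move=> h nz; have sp : size (map_poly phi p) = size p.
  apply/eqP; rewrite eqn_leq size_poly /= leqNgt; apply/negP => lt.
  move/negP: nz; apply; rewrite lead_coefE -(hom_coef _ _ h) nth_default //.
  by rewrite -ltnS prednK // (leq_ltn_trans _ lt).
by split=> //; rewrite !lead_coefE sp (hom_coef _ _ h).
Qed.

Lemma hom_horner O u phi phi' p : is_subalg O -> is_hom O phi -> is_hom (adjoin O u) phi' ->
  (forall x, O x -> phi' x = phi x) -> polyO O p -> phi' p.[u] = (map_poly phi p).[phi' u].
Proof.
move=> hO hp hp' ext pp.
have hA := adjoin_subalg hO u.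
have Apow i : adjoin O u (u ^+ i) by apply: (subX hA); exact: adjoin_gen.
have pow i : phi' (u ^+ i) = phi' u ^+ i.
  elim: i => [|i IH]; first by rewrite (hom1 hp').
  by rewrite !exprS (homM hp') ?IH //; exact: adjoin_gen.
rewrite horner_coef (horner_coef_wide _ (size_poly _ _)).
rewrite (hom_sum _ hA hp') => [|i]; last first.
  by apply: (subM hA) => //; apply: adjoin_sub.
apply: eq_bigr => i _; rewrite (homM hp') //; last by apply: (adjoin_sub hO).
by rewrite pow (ext p`_i) // (hom_coef _ _ hp).
Qed.

(** Sending [p.[u]] to the value at [t] of the image of [p] is well defined exactly when relations
    of [u] map to relations of [t]; a representative [p] is chosen classically. *)
Lemma extend_hom O u phi t : is_subalg O -> is_hom O phi ->
  (forall q, polyO O q -> q.[u] = 0 -> (map_poly phi q).[t] = 0) ->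
  exists phi', [/\ is_hom (adjoin O u) phi', forall x, O x -> phi' x = phi x & phi' u = t].
Proof.
move=> hO hp wd.
have ch x : exists p, adjoin O u x -> polyO O p /\ x = p.[u].
  have [[p hpp e]|n] := pselect (adjoin O u x); first by exists p.
  by exists 0.
pose rep x := projT1 (cid (ch x)).
have repP x : adjoin O u x -> polyO O (rep x) /\ x = (rep x).[u].
  by rewrite /rep; case: (cid (ch x)) => p /= h /h.
pose phi' x := (map_poly phi (rep x)).[t].
have E p : polyO O p -> phi' p.[u] = (map_poly phi p).[t].
  move=> pp; have [|p' e] := repP p.[u]; first by exists p.
  have := wd (rep p.[u] - p); rewrite hornerD hornerN -e subrr.
  move=> /(_ (polyOB hO p' pp) erefl); rewrite (hom_mapB hO hp) // hornerD hornerN.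
  by move/eqP; rewrite subr_eq0 => /eqP.
exists phi'; split.
- split.
  + move=> a; rewrite -[emb a](hornerC (emb a) u) E; last by apply: (polyOC hO); exact: sub_emb.
    by rewrite (hom_mapC _ hp) hornerC (hom_emb hp).
  + move=> _ _ [p pp ->] [q qq ->]; rewrite -hornerD !E //; last exact: (polyOD hO).
    by rewrite (hom_mapD hp) // hornerD.
  + move=> _ _ [p pp ->] [q qq ->]; rewrite -hornerM !E //; last exact: (polyOM hO).
    by rewrite (hom_mapM hO hp) // hornerM.
- move=> x hx; rewrite -[in LHS](hornerC x u) E; last exact: (polyOC hO).
  by rewrite (hom_mapC _ hp) hornerC.
- by rewrite -[in LHS](hornerX u) E ?(hom_mapX hp) ?hornerX //; exact: (polyOX hO).
Qed.

(** Among the [d + 1] even integers [0, 2, .., 2 d], two cannot lie within distance less than 1 of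
    the same root, so one of them keeps distance 1 from all [d] roots. *)
Lemma far_point (p : {poly K}) d : size p = d.+1 ->
  exists2 t : nat, (t <= 2 * d)%N & nrm (lead_coef p) <= nrm p.[t%:R].
Proof.
move=> sp; have [rs ep] := closed_field_poly_normal p.
have p0 : p != 0 by rewrite -size_poly_gt0 sp.
have lp0 : lead_coef p != 0 by rewrite lead_coef_eq0.
have srs : size rs = d.
  by move: sp; rewrite ep size_scale // size_prod_XsubC => -[].
have [j hj] : exists j : 'I_d.+1, forall r, r \in rs -> 1 <= nrm ((2 * j)%N%:R - r).
  apply: contrapT => /forallNP h.
  have F (j : 'I_d.+1) : exists i : 'I_d, nrm ((2 * j)%N%:R - rs`_i) < 1.
    have /existsNP[r /not_implyP[hr /negP]] := h j; rewrite -ltNge => lt.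
    have lr : (index r rs < d)%N by rewrite -srs index_mem.
    by exists (Ordinal lr); rewrite nth_index.
  pose f j := projT1 (cid (F j)).
  have fP (j : 'I_d.+1) : nrm ((2 * j)%N%:R - rs`_(f j)) < 1 by rewrite /f; case: (cid (F j)).
  have inj : injective f.
    move=> a b e; apply: contrapT => ne.
    have : nrm ((2 * a)%N%:R - (2 * b)%N%:R) < 2.
      have -> : (2 * a)%N%:R - (2 * b)%N%:R = ((2 * a)%N%:R - rs`_(f a)) - ((2 * b)%N%:R - rs`_(f b)) :> K.
        by rewrite e; ring.
      apply: le_lt_trans (nrmB hn _ _) _; have := fP a; have := fP b; lra.
    wlog ab : a b e ne / (a < b)%N.
      move=> W; case: (ltngtP a b) => hab; first exact: W.
        by rewrite (nrmBC hn); apply: W => //; exact/nesym.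
      by case: ne; apply: val_inj.
    rewrite (nrmBC hn) -natrB ?leq_mul2l ?(ltnW ab) ?orbT // (nrm_nat hn) -mulnBr.
    rewrite ltr_nat -[X in (_ < X)%N]muln1 ltn_pmul2l // ltnS leqn0 subn_eq0.
    by rewrite leqNgt ab.
  by have := leq_card _ inj; rewrite !card_ord ltnn.
exists (2 * j)%N; first by rewrite leq_mul2l -ltnS ltn_ord.
rewrite [in leRHS]ep hornerZ (nrmM hn) ler_peMr ?(nrm_ge0 hn) //.
elim: rs hj {ep srs} => [|r rs IH] hj; first by rewrite big_nil hornerC (nrm1 hn).
rewrite big_cons hornerM (nrmM hn) !hornerE -[1]mulr1; apply: ler_pM => //.
  by apply: hj; rewrite mem_head.
by apply: IH => r' hr'; apply: hj; rewrite inE hr' orbT.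
Qed.

Section MinimalRelation.

Variables (O : L -> Prop) (u : L) (P : {poly L}).
Hypothesis hO : is_subalg O.
Hypotheses (PO : polyO O P) (P0 : P != 0) (Pu : P.[u] = 0).
Hypothesis Pmin : forall q, polyO O q -> q != 0 -> q.[u] = 0 -> (size P <= size q)%N.

(** Euclid's algorithm for [P] and [B] with pseudo-divisions. Minimality of [P] takes the place of
    irreducibility: no remainder vanishes at [u] before the algorithm reaches a constant. *)
Lemma minimal_bezout B : polyO O B -> B.[u] != 0 ->
  exists U r, [/\ polyO O U, O r, r != 0 & U.[u] * B.[u] = r].
Proof.
have lX (q : {poly L}) n : q != 0 -> lead_coef q ^+ n != 0.
  by move=> q0; rewrite expf_neq0 // lead_coef_eq0.
suff small : forall C, polyO O C -> C.[u] != 0 -> (size C < size P)%N ->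
    exists U r, [/\ polyO O U, O r, r != 0 & U.[u] * C.[u] = r].
  move=> BO Bu; have [n [s [r [hs hr e sr]]]] := pseudo_division hO BO PO P0.
  have eu : lead_coef P ^+ n * B.[u] = r.[u].
    by have := congr1 (horner^~ u) e; rewrite hornerD hornerM Pu mulr0 add0r hornerZ.
  have [|U [v [hU hv v0 ev]]] := small r hr _ sr; first by rewrite -eu mulf_neq0 // lX.
  exists (lead_coef P ^+ n *: U), v; split=> //.
    by apply: (polyOZ hO) => //; apply: (subX hO); exact: PO.
  by rewrite hornerZ mulrAC eu mulrC.
move=> C; have [k] := ubnP (size C); elim: k C => // k IH C; rewrite ltnS => sk CO Cu sC.
have C0 : C != 0 by apply: contra_neq Cu => ->; rewrite horner0.
have [s1|s1] := leqP (size C) 1.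
  exists 1, C`_0; split=> //.
  - exact: (polyOC hO (sub1 hO)).
  - by move: Cu; rewrite (size1_polyC s1) hornerC coefC.
  - by rewrite [in LHS](size1_polyC s1) !hornerC mul1r.
have [n [s [r [hs hr e sr]]]] := pseudo_division hO PO CO C0.
have eu : r.[u] = - s.[u] * C.[u].
  have := congr1 (horner^~ u) e; rewrite hornerZ Pu mulr0 hornerD hornerM => /esym/eqP.
  by rewrite addrC addr_eq0 => /eqP->; rewrite mulNr.
have sP : size (lead_coef C ^+ n *: P) = size P by rewrite size_scale // lX.
have [r0|r0] := eqVneq r 0.
  exfalso; have su : s.[u] = 0.
    by move/esym/eqP: eu; rewrite r0 horner0 mulf_eq0 (negbTE Cu) orbF oppr_eq0 => /eqP.
  have s0 : s != 0.
    apply: contraTneq P0 => sz; rewrite -size_poly_eq0 -sP e sz r0 mul0r addr0 size_poly0 //.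
  have := Pmin hs s0 su; rewrite -sP e r0 addr0 size_proper_mul ?mulf_neq0 ?lead_coef_eq0 //.
  move: s1; case: (size C) => [|[|c]] // _.
  have : (0 < size s)%N by rewrite size_poly_gt0.
  by case: (size s) => // a _; rewrite addSn addnS /= addnS ltnNge leq_addr.
have ru : r.[u] != 0.
  apply/eqP => z; have := Pmin hr r0 z; rewrite leqNgt => /negP; apply.
  exact: ltn_trans sr sC.
have [||U [v [hU hv v0 ev]]] := IH r _ hr ru; first exact: leq_trans sr sk.
  exact: ltn_trans sr sC.
exists (- (U * s)), v; split=> //; first by apply: (polyON hO); exact: (polyOM hO).
by rewrite hornerN hornerM -ev eu; ring.
Qed.

End MinimalRelation.

(* Homomorphisms O -> K extend to O[u] with control of the new values.  Over a
   transcendental u any image of u is allowed, and it is chosen away from the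
   roots of the image of b; over an algebraic u the image of u is a root of the
   image of a minimal relation, and b divides a nonzero element of O. *)
Lemma adjoin_step O u b : is_subalg O -> adjoin O u b -> b != 0 ->
  exists h (cs : seq L), [/\ O h, h != 0, forall c, c \in cs -> O c &
    forall C g : R, 0 < g -> exists C' g' : R, 0 < g' /\ forall phi, is_hom O phi ->
      (forall c, c \in cs -> nrm (phi c) <= C) -> g <= nrm (phi h) ->
      exists phi', [/\ is_hom (adjoin O u) phi', forall x, O x -> phi' x = phi x,
        nrm (phi' u) <= C' & g' <= nrm (phi' b)]].
Proof.
move=> hO [B BO eb] b0; rewrite eb in b0.
have [tr|alg] := pselect (forall q, polyO O q -> q.[u] = 0 -> q = 0).
  have B0 : B != 0 by apply: contra_neq b0 => ->; rewrite horner0.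
  exists (lead_coef B), [::]; split=> //; [exact: BO | by rewrite lead_coef_eq0|].
  move=> C g g0; exists (2 * (size B).-1)%N%:R, g; split=> // phi hp _ hg.
  have nz : phi (lead_coef B) != 0.
    by apply: contraTneq hg => ->; rewrite (nrm0 hn) -ltNge.
  have [sz lc] := hom_size hp nz.
  have [|t ht le] := @far_point (map_poly phi B) (size B).-1.
    by rewrite sz prednK // size_poly_gt0.
  have [|phi' [hp' ext pu]] := @extend_hom O u phi t%:R hO hp.
    by move=> q qO /(tr q qO) ->; rewrite map_poly0 horner0.
  exists phi'; split=> //; first by rewrite pu (nrm_nat hn) ler_nat.
  rewrite eb (hom_horner hO hp hp' ext BO) pu; apply: le_trans le; by rewrite lc.
have [P [PO P0 Pu Pmin]] : exists P, [/\ polyO O P, P != 0, P.[u] = 0 &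
    forall q, polyO O q -> q != 0 -> q.[u] = 0 -> (size P <= size q)%N].
  pose S n := `[< exists q, [/\ polyO O q, q != 0, q.[u] = 0 & size q = n] >].
  have exS : exists n, S n.
    move/existsNP: alg => [q /not_implyP[qO /not_implyP[qu q0]]].
    by exists (size q); apply/asboolP; exists q; split=> //; apply/eqP.
  case: (ex_minnP exS) => n /asboolP[q [q1 q2 q3 q4]] mn.
  exists q; split=> // q' h1 h2 h3; rewrite q4; apply: mn; apply/asboolP; by exists q'.
have [U [r [UO rO r0 eU]]] := minimal_bezout hO PO P0 Pu Pmin BO b0.
have sP : exists n, size P = n.+2.
  case E: (size P) => [|[|n]]; last by exists n.
    by move/eqP: E; rewrite size_poly_eq0 (negbTE P0).
  move: Pu P0; have := size1_polyC (eq_leq E) => ->; rewrite hornerC => ->.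
  by rewrite eqxx.
have [n sPn] := sP.
pose a := lead_coef P.
exists (a * r), [:: a, r & (P : seq L) ++ (U : seq L)]; split.
- by apply: (subM hO) => //; exact: PO.
- by rewrite mulf_neq0 // lead_coef_eq0.
- move=> c; rewrite !inE mem_cat => /or4P[/eqP->|/eqP->|/(nthP 0)[i _ <-]|/(nthP 0)[i _ <-]] //.
  exact: PO.
move=> C g g0.
(* The images of [a] and [r] are at most [C2] and their product is at least [g], so each is at least
   [g1]. Then [D] bounds the chosen root and [E] the value of [U] there; from [U b = r] the image of
   [b] is at least [g1 / (E + 1)]. *)
pose C2 := 1 + `|C|.
have C20 : 0 < C2 by rewrite /C2 ltr_pwDl.
have CC2 : C <= C2 by rewrite /C2; apply: le_trans (ler_norm C) _; rewrite lerDr.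
pose g1 := g / C2.
have g10 : 0 < g1 by rewrite divr_gt0.
pose D := 1 + n.+1%:R * C2 / g1.
pose E := \sum_(i < size U) C2 * D ^+ i.
have D0 : 0 <= D by rewrite addr_ge0 // divr_ge0 ?(ltW g10) // mulr_ge0 // ltW.
have E0 : 0 <= E.
  by apply: sumr_ge0 => i _; rewrite mulr_ge0 ?exprn_ge0 // ltW.
exists D, (g1 / (E + 1)); split; first by rewrite divr_gt0 // ltr_wpDl.
move=> phi hp hc hg.
have hc2 c : c \in [:: a, r & (P : seq L) ++ (U : seq L)] -> nrm (phi c) <= C2.
  by move=> h; exact: le_trans (hc c h) CC2.
have ha2 : nrm (phi a) <= C2 by apply: hc2; rewrite mem_head.
have hr2 : nrm (phi r) <= C2 by apply: hc2; rewrite !inE eqxx orbT.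
move: hg; rewrite (homM hp) ?(nrmM hn) //; last exact: PO.
move=> hg.
have ha1 : g1 <= nrm (phi a).
  rewrite ler_pdivrMr //; apply: le_trans hg _; apply: ler_wpM2l => //; exact: nrm_ge0 hn _.
have hr1 : g1 <= nrm (phi r).
  rewrite ler_pdivrMr //; apply: le_trans hg _; rewrite mulrC.
  by apply: ler_wpM2l => //; exact: nrm_ge0 hn _.
have a0 : phi a != 0 by apply: contraTneq ha1 => ->; rewrite (nrm0 hn) -ltNge.
have [sz lc] := hom_size hp a0.
have coefP (q : {poly L}) i : (forall x, x \in (q : seq L) -> nrm (phi x) <= C2) ->
    nrm (map_poly phi q)`_i <= C2.
  move=> h; rewrite (hom_coef _ _ hp); have [lt|ge] := ltnP i (size q).
    by apply: h; exact: mem_nth.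
  by rewrite nth_default // (hom0 hp) (nrm0 hn) ltW.
have [t rt] : exists t, root (map_poly phi P) t.
  by apply/closed_rootP; rewrite sz sPn.
have tD : nrm t <= D.
  apply: (root_bound hn (etrans sz sPn)) rt => //; last by rewrite lc.
  by move=> i; apply: coefP => x hx; apply: hc2; rewrite !inE mem_cat hx !orbT.
have [|phi' [hp' ext pu]] := @extend_hom O u phi t hO hp.
  (* Times a power of [a], any relation [q] of [u] is a multiple of [P]. Its image vanishes at [t],
     and [phi a] is nonzero. *)
  move=> q qO qu; have [k [s [v [hs hv e sv]]]] := pseudo_division hO qO PO P0.
  have v0 : v = 0.
    apply/eqP; apply: contraTT isT => nv.
    have vu : v.[u] = 0.
      have := congr1 (horner^~ u) e.
      by rewrite hornerZ qu mulr0 hornerD hornerM Pu mulr0 add0r => ->.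
    by have := Pmin v hv nv vu; rewrite leqNgt sv.
  have := congr1 (map_poly phi) e; rewrite v0 addr0 -mul_polyC.
  have lO : O (lead_coef P ^+ k) by apply: (subX hO); exact: PO.
  rewrite (hom_mapM hO hp (polyOC hO lO) qO) (hom_mapM hO hp hs PO) (hom_mapC _ hp).
  move=> /(congr1 (horner^~ t)); rewrite !hornerM hornerC (rootP rt) mulr0.
  move/eqP; rewrite mulf_eq0 => /orP[|/eqP //].
  have -> : phi (lead_coef P ^+ k) = phi a ^+ k.
    elim: k {e lO} => [|k IH]; first by rewrite (hom1 hp).
    by rewrite !exprS (homM hp) ?IH //; [exact: PO | apply: (subX hO); exact: PO].
  by rewrite expf_eq0 (negbTE a0) andbF.
exists phi'; split=> //; first by rewrite pu.
have Ub : nrm (phi' U.[u]) <= E.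
  rewrite (hom_horner hO hp hp' ext UO) pu.
  apply: (nrm_horner hn) => //; first exact: size_poly.
  by move=> i; apply: coefP => x hx; apply: hc2; rewrite !inE mem_cat hx !orbT.
have : phi' U.[u] * phi' b = phi r.
  rewrite -(homM hp') ?eb ?eU ?ext //; by [exists U | exists B].
move=> /(congr1 nrm); rewrite (nrmM hn) => e.
rewrite ler_pdivrMr; last by rewrite ltr_wpDl.
apply: le_trans hr1 _; rewrite -e mulrC; apply: ler_wpM2l; first exact: nrm_ge0 hn _.
by apply: le_trans Ub _; rewrite lerDl.
Qed.

Definition adjoin_seq (O : L -> Prop) (us : seq L) := foldl adjoin O us.

Lemma adjoin_seq_subalg O us : is_subalg O -> is_subalg (adjoin_seq O us).
Proof. by elim: us O => [|u us IH] O hO //=; apply: IH; exact: adjoin_subalg. Qed.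

Lemma adjoin_seq_sub O us x : is_subalg O -> O x -> adjoin_seq O us x.
Proof.
elim: us O => [|u us IH] O hO //= hx; apply: IH; first exact: adjoin_subalg.
exact: (adjoin_sub hO).
Qed.

Lemma adjoin_seq_gen O us u : is_subalg O -> u \in us -> adjoin_seq O us u.
Proof.
elim: us O => [|v us IH] O hO //=; rewrite inE => /orP[/eqP->|]; last first.
  by apply: IH; exact: adjoin_subalg.
apply: adjoin_seq_sub; [exact: adjoin_subalg | exact: (adjoin_gen hO)].
Qed.

(** A quantitative form of the extension theorem behind Chevalley's theorem on images: every
    homomorphism with [phi h] nonzero lifts, and bounds on [O] control the new values. *)
Theorem adjoin_seq_extend O us b : is_subalg O -> adjoin_seq O us b -> b != 0 ->
  exists h (cs : seq L), [/\ O h, h != 0, forall c, c \in cs -> O c &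
    forall C g : R, 0 < g -> exists C' g' : R, 0 < g' /\ forall phi, is_hom O phi ->
      (forall c, c \in cs -> nrm (phi c) <= C) -> g <= nrm (phi h) ->
      exists phi', [/\ is_hom (adjoin_seq O us) phi', forall x, O x -> phi' x = phi x,
        forall u, u \in us -> nrm (phi' u) <= C' & g' <= nrm (phi' b)]].
Proof.
elim: us O => [|u us IH] O hO /= hb b0.
  exists b, [::]; split=> // C g g0; exists 0, g; split=> // phi hp _ hg.
  by exists phi; split.
have hA := adjoin_subalg hO u.
have [h2 [cs2 [O2 h20 hcs2 ext2]]] := IH _ hA hb b0.
have [h1 [cs1 [O1 h10 hcs1 ext1]]] := adjoin_step hO O2 h20.
(* The later stages need bounds on elements of [O[u]]. They follow from the bound on [u] and from
   bounds on the coefficients of representing polynomials, which are therefore added to the list. *)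
have [rep hrep] : exists rep : L -> {poly L}, forall c, c \in cs2 -> polyO O (rep c) /\ c = (rep c).[u].
  have ch c : exists p, c \in cs2 -> polyO O p /\ c = p.[u].
    case: (boolP (c \in cs2)) => [/hcs2[p hp e]|_]; [by exists p|by exists 0].
  by exists (fun c => projT1 (cid (ch c))) => c; case: (cid (ch c)).
exists h1, (cs1 ++ flatten [seq (rep c : seq L) | c <- cs2]); split=> //.
  move=> c; rewrite mem_cat => /orP[/hcs1 //|/flattenP[s /mapP[d hd ->] /(nthP 0)[i _ <-]]].
  exact: (hrep d hd).1.
move=> C g g0; have [C1 [g1 [g10 ex1]]] := ext1 C g g0.
pose Cm := `|C|; pose D1 := `|C1|.
pose C2 := \sum_(c <- cs2) \sum_(i < size (rep c)) Cm * D1 ^+ i.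
have [C3 [g3 [g30 ex3]]] := ext2 C2 g1 g10.
exists (Num.max C1 C3), g3; split=> // phi hp hc hg.
have [|phi1 [hp1 e1 n1 m1]] := ex1 phi hp _ hg.
  by move=> c cc; apply: hc; rewrite mem_cat cc.
have [|phi2 [hp2 e2 n2 m2]] := ex3 phi1 hp1 _ m1.
  move=> c cc; have [rO ec] := hrep c cc.
  have t0 d : 0 <= \sum_(i < size (rep d)) Cm * D1 ^+ i.
    by apply: sumr_ge0 => i _; rewrite mulr_ge0 ?exprn_ge0 //; exact: normr_ge0.
  apply: (@le_trans _ _ (\sum_(i < size (rep c)) Cm * D1 ^+ i)); last first.
    by rewrite /C2 (big_rem c) //= lerDl; apply: sumr_ge0 => d _; exact: t0.
  rewrite {1}ec (hom_horner hO hp hp1 e1 rO); apply: (nrm_horner hn).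
  - exact: size_poly.
  - move=> i; rewrite (hom_coef _ _ hp); have [lt|ge] := ltnP i (size (rep c)).
      apply: le_trans (ler_norm C); apply: hc; rewrite mem_cat; apply/orP; right.
      by apply/flattenP; exists (rep c : seq L); [exact: map_f | exact: mem_nth].
    by rewrite nth_default // (hom0 hp) (nrm0 hn) normr_ge0.
  - exact: le_trans n1 (ler_norm _).
exists phi2; split=> //.
  by move=> x hx; rewrite e2 ?e1 //; exact: (adjoin_sub hO).
move=> v; rewrite inE le_max => /orP[/eqP->|/n2 ->]; rewrite ?orbT //.
by rewrite e2 ?n1 //; exact: (adjoin_gen hO).
Qed.

End Extension.

(** * Irreducible sets and function fields *)

Section Closed.

Variables (K : closedFieldType) (N : nat) (T : Type) (c : T -> 'rV[K]_N).

Lemma zclosed_open (Z : T -> Prop) x : zclosed c Z -> ~ Z x -> near_pt c x (fun y => ~ Z y).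
Proof.
move=> [S [hS hZ]] nx.
have [F [SF Fx]] : exists F, S F /\ form_eval F (c x) != 0.
  apply: contrapT => /forallNP h; apply: nx; apply/hZ => F SF.
  by apply/eqP/negPn/negP => nz; apply: (h F).
have [d hd] := hS F SF.
exists d, F; split=> // y Fy /hZ/(_ F SF) e; by rewrite e eqxx in Fy.
Qed.

Lemma open_zclosed (Z : T -> Prop) :
  (forall x, ~ Z x -> near_pt c x (fun y => ~ Z y)) -> zclosed c Z.
Proof.
move=> h; exists (fun F => (exists d, F \is d.-homog) /\ forall x, Z x -> form_eval F (c x) = 0).
split=> [F [] //|x]; split=> [Zx F [_ hF]|hx]; first exact: hF.
apply: contrapT => nx; have [d [H [hH Hx HZ]]] := h x nx.
have e : form_eval H (c x) = 0.
  apply: hx; split; first by exists d.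
  by move=> y Zy; apply/eqP/negPn/negP => /HZ.
by rewrite e eqxx in Hx.
Qed.

Lemma zclosed_or (Z1 Z2 : T -> Prop) : zclosed c Z1 -> zclosed c Z2 -> zclosed c (fun x => Z1 x \/ Z2 x).
Proof.
move=> h1 h2; apply: open_zclosed => x /not_orP[n1 n2].
apply: near_pt_sub (near_ptI (zclosed_open h1 n1) (zclosed_open h2 n2)) => y [y1 y2] [].
  exact: y1.
exact: y2.
Qed.

Definition zclosure (P : T -> Prop) (x : T) : Prop :=
  forall Z, zclosed c Z -> (forall y, P y -> Z y) -> Z x.

Lemma zclosure_sub P x : P x -> zclosure P x.
Proof. by move=> Px Z _; apply. Qed.

Lemma zclosure_closed P : zclosed c (zclosure P).
Proof.
apply: open_zclosed => x /existsNP[Z /not_implyP[hZ /not_implyP[PZ nx]]].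
apply: near_pt_sub (zclosed_open hZ nx) => y ny h; apply: ny; exact: h.
Qed.

Lemma irreducible_open Z (P1 P2 : T -> Prop) : irreducible_closed c Z ->
  (forall x, ~ P1 x -> near_pt c x (fun y => ~ P1 y)) ->
  (forall x, ~ P2 x -> near_pt c x (fun y => ~ P2 y)) ->
  (forall x, Z x -> P1 x \/ P2 x) ->
  (forall x, Z x -> P1 x) \/ (forall x, Z x -> P2 x).
Proof. by move=> [_ _ h] h1 h2; apply: h; exact: open_zclosed. Qed.

(** The implication adds the complement of the chart, which makes the zero set of an affine function
    closed in the projective variety. *)
Definition aff_zero p (q : {mpoly K[N]}) (y : T) : Prop := c y 0 p != 0 -> q.@[(aff c p)^~ y] = 0.

Lemma aff_zero_open p q x : ~ aff_zero p q x -> near_pt c x (fun y => ~ aff_zero p q y).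
Proof.
move=> /not_implyP[xp /eqP nz].
have r : regular_at c x (fun y => q.@[(aff c p)^~ y]).
  by apply: regular_meval => i; exact: regular_aff.
apply: near_pt_sub (near_ptI (near_pt_coord xp) (regular_neq0 r nz)) => y [yp hy] h.
by rewrite (h yp) eqxx in hy.
Qed.

End Closed.

Lemma preimage_zclosed (K : closedFieldType) (M N : nat) (T U : Type)
    (c : T -> 'rV[K]_M) (d : U -> 'rV[K]_N) (f : T -> U) Z :
  (forall y, d y != 0) -> is_morphism c d f -> zclosed d Z -> zclosed c (fun x => Z (f x)).
Proof.
move=> d0 mf hZ; apply: open_zclosed => x nx.
by have := morphism_near d0 mf (zclosed_open hZ nx).
Qed.

Lemma image_closure_irreducible (K : closedFieldType) (M N : nat) (T U : Type)
    (c : T -> 'rV[K]_M) (d : U -> 'rV[K]_N) (f : T -> U) :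
  (forall y, d y != 0) -> is_morphism c d f -> irreducible_closed c (fun=> True) ->
  irreducible_closed d (zclosure d (fun y => exists x, y = f x)).
Proof.
move=> d0 mf [_ [x0 _] irr]; split.
- exact: zclosure_closed.
- by exists (f x0); apply: zclosure_sub; exists x0.
move=> Z1 Z2 h1 h2 cov.
have [|h|h] := irr _ _ (preimage_zclosed d0 mf h1) (preimage_zclosed d0 mf h2).
- by move=> x _; apply: cov; apply: zclosure_sub; exists x.
- by left=> y /(_ _ h1); apply=> _ [x ->]; exact: h.
- by right=> y /(_ _ h2); apply=> _ [x ->]; exact: h.
Qed.

Section FunctionField.

Variables (K : closedFieldType) (A : abelianVariety K).
Notation c := (@av_coord K A).
Notation N := (@av_size K A).

Lemma av_irreducible : irreducible_closed c (fun=> True).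
Proof. by case: (av_axiom A). Qed.

Variable p : 'I_N.
Hypothesis hp : exists a, c a 0 p != 0.

Definition aff_ideal (q : {mpoly K[N]}) : Prop := forall y, aff_zero c p q y.

Lemma aff_ideal_is_ideal : is_ideal aff_ideal.
Proof.
split=> [y _|q r hq hr y yp|a q hq y yp]; first by rewrite meval0.
  by rewrite mevalD hq // hr // addr0.
by rewrite mevalM hq // mulr0.
Qed.

Lemma aff_ideal_proper : ~ aff_ideal 1.
Proof.
by move=> h; have [a ap] := hp; have := h a ap; rewrite meval1 => /eqP; rewrite oner_eq0.
Qed.

(** The closed sets [aff_zero q] and [aff_zero r] cover [A], which is irreducible. *)
Lemma aff_ideal_prime q r : aff_ideal (q * r) -> aff_ideal q \/ aff_ideal r.
Proof.
move=> h; have [x _|h1|h1] := irreducible_open av_irreducible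
    (@aff_zero_open _ _ _ c p q) (@aff_zero_open _ _ _ c p r).
- have [xp|/negPn/eqP xp] := boolP (c x 0 p != 0); last by left; rewrite /aff_zero xp eqxx.
  have := h x xp; rewrite mevalM => /eqP; rewrite mulf_eq0 => /orP[]/eqP e; by [left|right].
- by left=> y; exact: h1.
- by right=> y; exact: h1.
Qed.

Theorem function_field : exists (L : fieldType) (h : {rmorphism {mpoly K[N]} -> L}),
  forall q, h q = 0 <-> forall y, c y 0 p != 0 -> q.@[(aff c p)^~ y] = 0.
Proof.
exact: (prime_residue_field (PrimeIdeal aff_ideal_is_ideal aff_ideal_proper aff_ideal_prime)).
Qed.

Section Points.

Variables (L : fieldType) (h : {rmorphism {mpoly K[N]} -> L}).
Hypothesis hP : forall q, h q = 0 <-> forall y, c y 0 p != 0 -> q.@[(aff c p)^~ y] = 0.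

Definition cst : {rmorphism K -> L} := (h \o @mpolyC N K)%FUN.
Definition coor (i : 'I_N) : L := h 'X_i.

Lemma subalg_fun O : is_subalg cst O -> (forall i, O (coor i)) -> forall q, O (h q).
Proof.
move=> hO hu; elim/mpolyind=> [|a m q _ _ IH]; first by rewrite rmorph0; exact: sub0 hO.
rewrite rmorphD; apply: (subD hO) => //.
rewrite -mul_mpolyC rmorphM; apply: (subM hO); first exact: sub_emb hO a.
rewrite mpolyXE_id rmorph_prod; elim: (index_enum _) => [|i r IHr].
  by rewrite big_nil; exact: sub1 hO.
by rewrite big_cons; apply: (subM hO) => //; rewrite rmorphXn; apply: (subX hO); exact: hu.
Qed.

Lemma hom_fun O phi : is_subalg cst O -> is_hom cst O phi -> (forall i, O (coor i)) ->
  forall q, phi (h q) = q.@[fun i => phi (coor i)].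
Proof.
move=> hO hphi hu; elim/mpolyind=> [|a m q _ _ IH].
  by rewrite rmorph0 meval0 (hom0 hphi).
rewrite rmorphD mevalD (homD hphi) ?IH; [congr (_ + _)|exact: subalg_fun|exact: subalg_fun].
rewrite -mul_mpolyC rmorphM mevalM mevalC (homM hphi); try exact: subalg_fun.
  rewrite -[h _]/(cst a) (hom_emb hphi); congr (_ * _).
  rewrite mevalX mpolyXE_id rmorph_prod /=.
  elim: (index_enum _) => [|i r IHr]; first by rewrite !big_nil (hom1 hphi).
  have Op (s : seq 'I_N) : O (\prod_(j <- s) h ('X_j ^+ m j)).
    elim: s => [|j s IHs]; first by rewrite big_nil; exact: sub1 hO.
    by rewrite big_cons; apply: (subM hO) => //; exact: subalg_fun.
  rewrite !big_cons (homM hphi) ?IHr //; [congr (_ * _)|exact: subalg_fun].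
  elim: (m i) => [|n IHn]; first by rewrite rmorph1 (hom1 hphi).
  rewrite !exprS rmorphM (homM hphi) ?IHn //; exact: subalg_fun.
Qed.

(** A homomorphism from the coordinate ring to [K] is evaluation at a point: the vector of its
    values satisfies all equations of [A], hence represents a point of [A]. *)
Lemma point_of_hom O phi : is_subalg cst O -> is_hom cst O phi -> (forall i, O (coor i)) ->
  exists a, c a 0 p != 0 /\ forall i, aff c p i a = phi (coor i).
Proof.
move=> hO hphi hu.
pose v : 'rV[K]_N := \row_i phi (coor i).
have vp : v 0 p = 1.
  rewrite mxE; have e : h ('X_p - 1) = 0.
    by apply/hP => y yp; rewrite mevalB mevalXU meval1 /aff divff // subrr.
  have := congr1 phi e; rewrite (hom_fun hO hphi hu) mevalB mevalXU meval1 (hom0 hphi).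
  by move/eqP; rewrite subr_eq0 => /eqP.
have v0 : v != 0 by apply/rV0Pn; exists p; rewrite vp oner_neq0.
have [_ _ [S [hS hA]] _] := av_axiom A.
have [a [l el]] : exists a, exists l, v = l *: c a.
  apply/(hA v v0) => F SF; have [d hd] := hS F SF.
  have e : h F = 0.
    apply/hP => y yp; have : form_eval F (c y) = 0.
      by apply: (iffRL (hA _ (av_coord_neq0 y))) => //; exists y, 1; rewrite scale1r.
    rewrite (form_eval_aff hd yp) => /eqP; rewrite mulf_eq0 expf_eq0 (negbTE yp) andbF.
    by move/eqP.
  have := hom_fun hO hphi hu F; rewrite e (hom0 hphi) => e0; rewrite [RHS]e0.
  by rewrite /form_eval; apply: meval_eq => i; rewrite mxE.
exists a; have vi i : v 0 i = l * c a 0 i by rewrite el mxE.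
have lp : l * c a 0 p = 1 by rewrite -vi.
have ap : c a 0 p != 0 by apply: contra_eq_neq lp => ->; rewrite mulr0 eq_sym oner_neq0.
split=> // i; have -> : phi (coor i) = v 0 i by rewrite mxE.
rewrite /aff vi; apply: (mulIf ap); rewrite divfK // mulrAC lp mul1r //.
Qed.

End Points.

End FunctionField.

(** * Surjectivity of multiplication *)

Lemma near_pt_all (K : closedFieldType) (N : nat) (T : Type) (c : T -> 'rV[K]_N) n x
    (P : 'I_n -> T -> Prop) :
  (forall i, near_pt c x (P i)) -> near_pt c x (fun y => forall i, P i y).
Proof.
move=> h.
have s (r : seq 'I_n) : near_pt c x (fun y => forall i, i \in r -> P i y).
  elim: r => [|i r IH]; first exact: near_ptT.
  apply: near_pt_sub (near_ptI (h i) IH) => y [h1 h2] l.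
  by rewrite inE => /orP[/eqP->|/h2].
by apply: near_pt_sub (s (enum 'I_n)) => y hy j; apply: hy; rewrite mem_enum.
Qed.

Section Chevalley.

Variables (R : realType) (K : closedFieldType) (nrm : K -> R).
Hypothesis hn : is_norm nrm.
Variable A : abelianVariety K.
Notation c := (@av_coord K A).
Notation N := (@av_size K A).

Lemma aff_eq_point q x y : c x 0 q != 0 -> c y 0 q != 0 ->
  (forall i, aff c q i x = aff c q i y) -> x = y.
Proof.
move=> xq yq e; apply: (@av_coord_inj K A x y (c y 0 q / c x 0 q)).
apply/rowP => i; rewrite mxE.
have := e i; rewrite /aff => ei; apply: (mulIf (invr_neq0 yq)).
by rewrite -ei; field; rewrite xq yq.
Qed.

(** The coordinates of [f] generate a subalgebra [O] of the function field. A point of the closure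
    of the image, in the chart [q], gives a homomorphism from [O] to [K], and where [Q0] does not
    vanish it extends to the coordinates of [A], that is, to a preimage. *)
Theorem image_contains_open (f : A -> A) : is_morphism c c f ->
  exists d (H : {mpoly K[N]}) a0, [/\ H \is d.-homog, form_eval H (c (f a0)) != 0 &
    forall z, zclosure c (fun y => exists x, y = f x) z -> form_eval H (c z) != 0 ->
      exists a, z = f a].
Proof.
move=> mf; have c0 := @av_coord_neq0 K A.
have [p p0] := exists_coord (c0 0); have [q q0] := exists_coord (c0 (f 0)).
have [dd [F [G hFG]]] : exists (dd : 'I_N -> nat) (F G : 'I_N -> {mpoly K[N]}), forall i,
    [/\ F i \is (dd i).-homog, G i \is (dd i).-homog &
      near_pt c 0 (fun y => form_eval (G i) (c y) != 0 /\
        aff c q i (f y) = form_eval (F i) (c y) / form_eval (G i) (c y))].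
  have E i : exists t : nat * {mpoly K[N]} * {mpoly K[N]},
    [/\ t.1.2 \is t.1.1.-homog, t.2 \is t.1.1.-homog &
      near_pt c 0 (fun y => form_eval t.2 (c y) != 0 /\
        aff c q i (f y) = form_eval t.1.2 (c y) / form_eval t.2 (c y))].
    have [d [F [G h]]] := mf 0 _ (regular_aff i q0).
    by exists (d, F, G).
  exists (fun i => (projT1 (cid (E i))).1.1), (fun i => (projT1 (cid (E i))).1.2),
    (fun i => (projT1 (cid (E i))).2) => i; by case: (cid (E i)).
have hF i : F i \is (dd i).-homog by case: (hFG i).
have hG i : G i \is (dd i).-homog by case: (hFG i).
have [d0 [H0 [hH0 H00 good]]] : near_pt c 0 (fun y => [/\ c y 0 p != 0, c (f y) 0 q != 0 &
   forall i, form_eval (G i) (c y) != 0 /\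
        aff c q i (f y) = form_eval (F i) (c y) / form_eval (G i) (c y)]).
  have n1 := near_pt_coord p0.
  have n2 := morphism_near c0 mf (near_pt_coord q0).
  have n3 : near_pt c 0 (fun y => forall i, form_eval (G i) (c y) != 0 /\
        aff c q i (f y) = form_eval (F i) (c y) / form_eval (G i) (c y)).
    by apply: near_pt_all => i; case: (hFG i).
  by apply: near_pt_sub (near_ptI (near_ptI n1 n2) n3) => y [[]].
have [L [h hP]] := function_field (ex_intro _ 0 p0).
pose G' i := fun y => (G i).@[(aff c p)^~ y].
have evE d (Q : {mpoly K[N]}) y : Q \is d.-homog -> c y 0 p != 0 ->
    (Q.@[(aff c p)^~ y] == 0) = (form_eval Q (c y) == 0).
  move=> hQ yp; rewrite (form_eval_aff hQ yp) mulf_eq0 expf_eq0 (negbTE yp) andbF //.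
have hne (s : {mpoly K[N]}) : s.@[(aff c p)^~ 0] != 0 -> h s != 0.
  by move=> nz; apply: contra_neq nz => /hP/(_ 0 p0).
have hH0ne : h H0 != 0 by apply: hne; rewrite (evE _ _ _ hH0 p0).
pose w i := h (F i) / h (G i).
pose ok y := form_eval H0 (c y) != 0.
(* [rep x u]: the element x of the function field is a fraction whose value at
   every y with H0(y) <> 0 is u y *)
pose rep (x : L) (u : A -> K) := exists s t : {mpoly K[N]}, x = h s / h t /\
  forall y, ok y -> t.@[(aff c p)^~ y] != 0 /\ u y = s.@[(aff c p)^~ y] / t.@[(aff c p)^~ y].
have rep_ne s t x u : x = h s / h t ->
    (forall y, ok y -> t.@[(aff c p)^~ y] != 0 /\ u y = s.@[(aff c p)^~ y] / t.@[(aff c p)^~ y]) ->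
    h t != 0.
  by move=> _ ht; apply: hne; case: (ht 0 H00).
have repC a : rep (cst h a) (fun=> a).
  exists a%:MP, 1; rewrite rmorph1 divr1; split=> // y _.
  by rewrite mevalC meval1 divr1 oner_neq0.
have repD x u x' u' : rep x u -> rep x' u' -> rep (x + x') (fun y => u y + u' y).
  move=> [s [t [e ht]]] [s' [t' [e' ht']]]; exists (s * t' + s' * t), (t * t').
  have n1 := rep_ne _ _ _ _ e ht; have n2 := rep_ne _ _ _ _ e' ht'; split.
    by rewrite e e' rmorphD !rmorphM; field; rewrite n1 n2.
  move=> y oy; have [m1 ->] := ht y oy; have [m2 ->] := ht' y oy.
  by rewrite mevalD !mevalM mulf_neq0 //; split=> //; field; rewrite m1 m2.
have repM x u x' u' : rep x u -> rep x' u' -> rep (x * x') (fun y => u y * u' y).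
  move=> [s [t [e ht]]] [s' [t' [e' ht']]]; exists (s * s'), (t * t').
  have n1 := rep_ne _ _ _ _ e ht; have n2 := rep_ne _ _ _ _ e' ht'; split.
    by rewrite e e' !rmorphM; field; rewrite n1 n2.
  move=> y oy; have [m1 ->] := ht y oy; have [m2 ->] := ht' y oy.
  by rewrite !mevalM mulf_neq0 //; split=> //; field; rewrite m1 m2.
have repw i : rep (w i) (fun y => aff c q i (f y)).
  exists (F i), (G i); split=> // y oy; have [yp _ /(_ i)[Gy ->]] := good y oy.
  rewrite (evE _ _ _ (hG i) yp) Gy; split=> //.
  rewrite (form_eval_aff (hF i) yp) (form_eval_aff (hG i) yp) -mulf_div divff ?mul1r //.
  by rewrite expf_neq0.
have rep_ext x u u' : rep x u -> (forall y, u' y = u y) -> rep x u'.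
  move=> [s [t [e ht]]] eu; exists s, t; split=> // y oy; rewrite eu; exact: ht.
have repmap (Q : {mpoly K[N]}) : rep (mmap (cst h) w Q) (fun y => Q.@[fun i => aff c q i (f y)]).
  elim/mpolyind: Q => [|a m Q _ _ IH].
    apply: (rep_ext _ (fun=> 0)) => [|y]; last by rewrite meval0.
    by rewrite mmap0 -(rmorph0 (cst h)); exact: repC.
  apply: (rep_ext _ (fun y => a * \prod_i aff c q i (f y) ^+ m i + Q.@[fun i => aff c q i (f y)])) => [|y].
    rewrite mmapD mmapZ mmapX; apply: (@repD) => //; apply: (@repM) => //.
    rewrite /mmap1; elim: (index_enum _) => [|i r IHr].
      apply: (rep_ext _ (fun=> 1)) => [|y]; last by rewrite big_nil.
      by rewrite big_nil -(rmorph1 (cst h)); exact: repC.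
    apply: (rep_ext _ (fun y => aff c q i (f y) ^+ m i * \prod_(j <- r) aff c q j (f y) ^+ m j)) => [|y];
      last by rewrite big_cons.
    rewrite big_cons; apply: (@repM) => //; elim: (m i) => [|n IHn].
      apply: (rep_ext _ (fun=> 1)) => [|y]; last by rewrite expr0.
      by rewrite expr0 -(rmorph1 (cst h)); exact: repC.
    apply: (rep_ext _ (fun y => aff c q i (f y) * aff c q i (f y) ^+ n)) => [|y];
      last by rewrite exprS.
    by rewrite exprS; exact: repM.
  by rewrite mevalD mevalZ mevalX.
have map0 Q : mmap (cst h) w Q = 0 <-> forall y, ok y -> Q.@[fun i => aff c q i (f y)] = 0.
  have [s [t [e ht]]] := repmap Q; have tn := rep_ne _ _ _ _ e ht; split.
    move=> e0 y oy; have [m1 ->] := ht y oy.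
    have /eqP : h s / h t = 0 by rewrite -e.
    rewrite mulf_eq0 invr_eq0 (negbTE tn) orbF => /eqP/hP -> //; first by rewrite mul0r.
    by case: (good y oy).
  move=> hQ; rewrite e; suff -> : h s = 0 by rewrite mul0r.
  apply: (mulIf hH0ne); rewrite mul0r -rmorphM; apply/hP => y yp; rewrite mevalM.
  have [z|oy] := eqVneq (form_eval H0 (c y)) 0.
    have /eqP -> : H0.@[(aff c p)^~ y] == 0 by rewrite (evE _ _ _ hH0 yp) z.
    by rewrite mulr0.
  have [m1 e1] := ht y oy; move: e1; rewrite hQ // => /esym/eqP.
  by rewrite mulf_eq0 invr_eq0 (negbTE m1) orbF => /eqP ->; rewrite mul0r.
pose image y := exists x, y = f x.
(* A relation between the coordinates of [f] holds where [H0] is nonzero, hence on all of [A] by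
   irreducibility, hence on the closure of the image. *)
have closure0 Q z : mmap (cst h) w Q = 0 -> zclosure c image z -> aff_zero c q Q z.
  move=> /map0 hQ; apply; first by apply: open_zclosed => x; exact: aff_zero_open.
  have [||//|h1|h1] := @irreducible_open _ _ _ c (fun=> True) (fun y => form_eval H0 (c y) = 0)
      (fun y => aff_zero c q Q (f y)) (av_irreducible A).
  - move=> x /eqP nz; apply: near_pt_sub (near_pt_form hH0 nz) => y ny /eqP.
    by rewrite (negbTE ny).
  - by move=> x nx; have := morphism_near c0 mf (aff_zero_open nx).
  - by move=> x _; have [z0|oy] := eqVneq (form_eval H0 (c x)) 0; [left|right=> _; exact: hQ].
  - by have := h1 0 I; move/eqP; rewrite (negbTE H00).
  - by move=> _ [x ->]; exact: h1.
pose O x := exists Q, x = mmap (cst h) w Q.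
have hO : is_subalg (cst h) O.
  split.
  - by move=> a; exists a%:MP; rewrite mmapC.
  - by move=> _ _ [Q ->] [Q' ->]; exists (Q + Q'); rewrite mmapD.
  - by move=> _ _ [Q ->] [Q' ->]; exists (Q * Q'); rewrite rmorphM.
pose us := [seq coor h i | i <- enum 'I_N].
have hO' := adjoin_seq_subalg us hO.
have uO i : adjoin_seq O us (coor h i).
  by apply: (adjoin_seq_gen hO); apply: map_f; rewrite mem_enum.
have bO : adjoin_seq O us (h H0) by exact: subalg_fun.
(* Keeping [h H0] away from 0 places the lifted point where the fractions [F i / G i] compute
   [f]. *)
have [h0 [cs [[Q0 eQ0] h00 csO ext]]] := adjoin_seq_extend hn hO bO hH0ne.
have [a' [oa' Qa']] : exists a', ok a' /\ Q0.@[fun i => aff c q i (f a')] != 0.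
  apply: contrapT => /forallNP n; move/eqP: h00; apply; rewrite eQ0; apply/map0 => y oy.
  by apply/eqP/negPn/negP => nz; apply: (n y).
have fa'q : c (f a') 0 q != 0 by case: (good a' oa').
have [d [H [hH Ha' HP]]] : near_pt c (f a') (fun z => c z 0 q != 0 /\ Q0.@[(aff c q)^~ z] != 0).
  apply: near_ptI; first exact: near_pt_coord.
  by apply: regular_neq0 => //; apply: regular_meval => i; exact: regular_aff.
exists d, H, a'; split=> // z cz /HP[zq Qz].
have [phi hphi] : exists phi : L -> K, forall Q, phi (mmap (cst h) w Q) = Q.@[(aff c q)^~ z].
  exists (fun x => if pselect (O x) is left e then (projT1 (cid e)).@[(aff c q)^~ z] else 0) => Q.
  case: pselect => [e|[]]; last by exists Q.
  case: (cid e) => Q' /= e'; apply/eqP; rewrite -subr_eq0 -mevalB; apply/eqP.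
  by apply: (closure0 (Q' - Q) z _ cz) => //; rewrite mmapB -e' subrr.
have hom : is_hom (cst h) O phi.
  split.
  - by move=> a; rewrite -(mmapC w (cst h) a) hphi mevalC.
  - by move=> _ _ [Q ->] [Q' ->]; rewrite -mmapD !hphi mevalD.
  - by move=> _ _ [Q ->] [Q' ->]; rewrite -rmorphM !hphi mevalM.
have g0 : 0 < nrm (phi h0) by rewrite eQ0 hphi; exact: nrm_gt0.
have [C' [g' [g'0 ex]]] := ext (\sum_(x <- cs) nrm (phi x)) _ g0.
have [|phi' [hphi' e1 _ hb]] := ex phi hom _ (lexx _).
  move=> x xcs; rewrite (big_rem x) //= lerDl; apply: sumr_ge0 => y _; exact: (nrm_ge0 hn).
have [a [ap ea]] := point_of_hom hP hO' hphi' uO.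
have ev Q : phi' (h Q) = Q.@[(aff c p)^~ a].
  by rewrite (hom_fun hO' hphi' uO); apply: meval_eq => i; rewrite ea.
have oa : ok a.
  rewrite /ok -(evE _ _ _ hH0 ap) -ev; apply: contraTneq hb => ->.
  by rewrite (nrm0 hn) -ltNge.
have [_ faq gd] := good a oa.
exists a; apply: (aff_eq_point zq faq) => i.
have [Ga ->] := gd i.
have wO : O (w i) by exists 'X_i; rewrite mmapX mmap1U.
have Gh : h (G i) != 0.
  by apply: hne; rewrite (evE _ _ _ (hG i) p0); have [_ _ /(_ i)[]] := good 0 H00.
have : phi' (w i) * phi' (h (G i)) = phi' (h (F i)).
  rewrite -(homM hphi'); [by rewrite divfK | exact: (adjoin_seq_sub us hO wO) | exact: (subalg_fun hO' uO)].
rewrite e1 // !ev; have -> : phi (w i) = aff c q i z.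
  by have := hphi 'X_i; rewrite mmapX mmap1U mevalXU.
rewrite (form_eval_aff (hF i) ap) (form_eval_aff (hG i) ap).
have Gn : (G i).@[(aff c p)^~ a] != 0 by rewrite (evE _ _ _ (hG i) ap).
move=> <-; rewrite -mulf_div divff ?mul1r ?mulfK // expf_neq0 //.
Qed.

Lemma irreducible_union (I : Type) (s : seq I) (Z : I -> A -> Prop) :
  (forall i, zclosed c (Z i)) -> (forall x, exists i, List.In i s /\ Z i x) ->
  exists i, forall x, Z i x.
Proof.
move=> hZ; have [_ _ irr] := av_irreducible A.
have U (r : seq I) : zclosed c (fun x => exists i, List.In i r /\ Z i x).
  elim: r => [|i r IH].
    exists (fun F => F = 1); split=> [F ->|x]; first by exists 0%N; exact: dhomog1.
    split=> [[i []] //|/(_ 1 erefl)]; rewrite /form_eval meval1 => /eqP.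
    by rewrite oner_eq0.
  have := zclosed_or (hZ i) IH; congr zclosed; apply/funext => x; apply/propext.
  split=> [[h|[j [h1 h2]]]|[j [[<-|h1] h2]]].
  - by exists i; split=> //; left.
  - by exists j; split=> //; right.
  - by left.
  - by right; exists j.
elim: s => [|i s IH] cov; first by have [j []] := cov 0.
have [|h|h] := irr _ _ (hZ i) (U s).
- by move=> x _; have [j [[<-|h1] h2]] := cov x; [left|right; exists j].
- by exists i => x; exact: h.
- by apply: IH => x; exact: h.
Qed.

(** Over each point killed by [n^j] lie at most [size ker] points. Some of these fibres may be
    empty, hence the default value in the choice of preimages. *)
Lemma kernel_power (n : nat) (ker : seq A) :
  (forall z, (z \in ker) = (z *+ n == 0)) -> forall j,
  exists s : seq A, (size s <= size ker ^ j)%N /\ forall z, z *+ (n ^ j)%N = 0 -> z \in s.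
Proof.
move=> hker; elim=> [|j [s [ss hs]]].
  by exists [:: 0]; split=> // z; rewrite expn0 mulr1n => ->; rewrite mem_head.
have ch t : exists x : A, (exists y : A, y *+ n = t) -> x *+ n = t.
  by have [[y hy]|no] := pselect (exists y : A, y *+ n = t); [exists y|exists 0].
pose pre t := projT1 (cid (ch t)).
have preP t y : y *+ n = t -> pre t *+ n = t.
  by rewrite /pre; case: (cid (ch t)) => x /= h e; apply: h; exists y.
exists [seq pre t + k | t <- s, k <- ker]; split.
  by rewrite size_allpairs expnS mulnC leq_mul2l ss orbT.
move=> z hz; apply/allpairsP; exists (z *+ n, z - pre (z *+ n)); split=> /=.
- by apply: hs; rewrite -mulrnA -expnS.
- by rewrite hker mulrnBl (preP _ z erefl) subrr.
- by rewrite addrCA subrr addr0.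
Qed.

(** The closures of the images of [n^j] decrease and become stationary since the dimension bounds
    chains. Each image contains an open part of its closure, so the stationary one, being a group,
    is closed. As the kernel is finite, [A] is then a finite union of translates of this image, and
    irreducibility leaves a single translate. *)
Theorem multiplication_surjective (g n : nat) (ker : seq A) : has_dim c g ->
  (forall z, (z \in ker) = (z *+ n == 0)) -> forall y : A, exists x, y = x *+ n.
Proof.
move=> [_ dim] hker y0.
have c0 := @av_coord_neq0 K A.
pose f j (x : A) := x *+ (n ^ j)%N.
have mf j : is_morphism c c (f j).
  by apply: morphism_ext (@morphism_mulz K A (n ^ j)%N) => x; rewrite /mulz_pt -pmulrn.
pose im j (y : A) := exists x, y = f j x.
pose Z j := zclosure c (im j).
have irrZ j : irreducible_closed c (Z j).
  exact: (image_closure_irreducible c0 (mf j) (av_irreducible A)).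
have imS j x : im j.+1 x -> im j x.
  by move=> [y ->]; exists (y *+ n); rewrite /f expnS mulrnA.
have ZS j x : Z j.+1 x -> Z j x.
  by move=> h C hC hi; apply: h => // y /imS; exact: hi.
have [j stab] : exists j, forall x, Z j x -> Z j.+1 x.
  apply: contrapT => /forallNP nst.
  have [|] := ltnP g g.+1; last by rewrite ltnn.
  suff : (g.+1 <= g)%N by rewrite ltnn.
  apply: (dim g.+1 (fun i => Z (g.+1 - i)%N)); split=> [i _ //|i ig].
  have e : (g.+1 - i = (g.+1 - i.+1).+1)%N by rewrite subnS prednK // subn_gt0.
  split=> [x|]; first by rewrite e; exact: ZS.
  have /existsNP[x /not_implyP[h1 h2]] := nst (g.+1 - i.+1)%N.
  by exists x; rewrite e.
have [d [H [a0 [hH Ha0 HP]]]] := image_contains_open (mf j.+1).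
(* the closure of the subgroup [im j.+1] is stable under translation by it *)
have Zsub b h : Z j.+1 b -> im j.+1 h -> Z j.+1 (b - h).
  move=> Zb imh C hC hi.
  apply: (Zb (fun x => C (x - h))).
    exact: (preimage_zclosed c0 (@morphism_translation K A (- h)) hC).
  move=> _ [x ->]; apply: hi; have [y ->] := imh.
  by exists (x - y); rewrite /f mulrnBl.
have Zneg b h : Z j.+1 b -> im j.+1 h -> Z j.+1 (h - b).
  move=> Zb imh C hC hi.
  have mo : is_morphism c c (fun x : A => h - x).
    apply: morphism_ext (morphism_comp (@av_opp K A) (@morphism_translation K A h)) => x /=.
    by rewrite addrC.
  apply: (Zb (fun x => C (h - x))); first exact: (preimage_zclosed c0 mo hC).
  move=> _ [x ->]; apply: hi; have [y ->] := imh.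
  by exists (y - x); rewrite /f mulrnBl.
(* Some translate [b - x] by a point of the image lies in the open part. Otherwise the closed
   condition [H (b - x) = 0] would hold on the whole closure, in particular at [b - o]. *)
have full b : Z j.+1 b -> im j.+1 b.
  move=> Zb; set o := f j.+1 a0.
  have imo : im j.+1 o by exists a0.
  have [x [imx Hx]] : exists x, im j.+1 x /\ form_eval H (c (b - x)) != 0.
    apply: contrapT => /forallNP nx.
    have mo : is_morphism c c (fun x : A => b - x).
      apply: morphism_ext (morphism_comp (@av_opp K A) (@morphism_translation K A b)) => x /=.
      by rewrite addrC.
    have cl : zclosed c (fun x : A => form_eval H (c (b - x)) = 0).
      apply: (@preimage_zclosed _ _ _ _ _ c c (fun x => b - x) (fun x => form_eval H (c x) = 0)) => //.
      exists (fun F => F = H); split=> [F ->|x]; first by exists d.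
      by split=> [h F ->|]; [|apply].
    have := Zsub _ _ Zb imo => /(_ _ cl); rewrite opprB addrCA subrr addr0 => e.
    move: Ha0; rewrite e ?eqxx // => y imy.
    by apply/eqP/negPn/negP => nz; apply: (nx y).
  have [a ea] := HP _ (Zsub _ _ Zb imx) Hx.
  have [y ey] := imx; exists (a + y).
  by rewrite /f mulrnDl; rewrite /f in ea ey; rewrite -ea -ey subrK.
have imst x : im j x -> im j.+1 x.
  by move=> h; apply: full; apply: stab; apply: zclosure_sub.
have imi i x : im j x -> im (j + i)%N x.
  elim: i x => [|i IH] x; first by rewrite addn0.
  move=> /imst[y ey]; have [z ez] : im (j + i)%N (f j y) by apply: IH; exists y.
  exists z; rewrite addnS /f expnSr mulrnA -[z *+ _]/(f (j + i)%N z) -ez /f -mulrnA -expnSr.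
  exact: ey.
have [s [_ hs]] := kernel_power hker j.
have [t ht] : exists t, forall x, Z j (x - t).
  apply: (@irreducible_union _ s (fun t x => Z j (x - t))).
    by move=> t; apply: (preimage_zclosed c0 (@morphism_translation K A (- t))); exact: zclosure_closed.
  move=> x; have [y ey] : im (j + j)%N (f j x) by apply: imi; exists x.
  exists (x - f j y); split.
    have : x - f j y \in s.
      by apply: hs; rewrite mulrnBl -[x *+ _]/(f j x) ey /f expnD mulrnA subrr.
    elim: s {hs} => //= u s IH; rewrite inE => /orP[/eqP->|/IH]; [by left|by right].
  by rewrite subKr; apply: zclosure_sub; exists y.
have [x ex] : im j.+1 y0.
  apply: full; apply: stab; have := ht (y0 + t); by rewrite addrK.
by exists (x *+ (n ^ j)%N); rewrite ex /f expnSr mulrnA.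
Qed.

End Chevalley.

(** * Lipschitz estimates *)

Section BiLipschitz.

Variables (R : realType) (K : fieldType) (nrm : K -> R).
Hypothesis hn : is_norm nrm.
Variables (T U : Type) (D1 : T -> Prop) (D2 : U -> Prop).
Variables (d1 : T -> T -> R) (d2 : U -> U -> R).
Hypothesis d1_ge0 : forall x y, 0 <= d1 x y.
Hypothesis d2_ge0 : forall x y, 0 <= d2 x y.

(** [bl_mixed] is the discrete form of a bound on the mixed second derivative. The bounds are kept
    together because each is needed to carry the mixed one through products and inverses. *)
Record bilip_by (f : T -> U -> K) (C : R) : Prop := BilipBy {
  bl_ge0 : 0 <= C;
  bl_bound : forall x w, D1 x -> D2 w -> nrm (f x w) <= C;
  bl_left : forall x x' w, D1 x -> D1 x' -> D2 w -> nrm (f x w - f x' w) <= C * d1 x x';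
  bl_right : forall x w w', D1 x -> D2 w -> D2 w' -> nrm (f x w - f x w') <= C * d2 w w';
  bl_mixed : forall x x' w w', D1 x -> D1 x' -> D2 w -> D2 w' ->
    nrm (f x w - f x' w - f x w' + f x' w') <= C * d1 x x' * d2 w w' }.

Definition bilip f := exists C, bilip_by f C.

Let n0 := nrm_ge0 hn.

Lemma bilip_ext f g : bilip f -> (forall x w, D1 x -> D2 w -> g x w = f x w) -> bilip g.
Proof.
move=> [C [C0 h1 h2 h3 h4]] e; exists C; split=> //.
- by move=> *; rewrite e //; apply: h1.
- by move=> *; rewrite !e //; apply: h2.
- by move=> *; rewrite !e //; apply: h3.
- by move=> *; rewrite !e //; apply: h4.
Qed.

Lemma bilip_const a : bilip (fun _ _ => a).
Proof.
exists (nrm a); split=> // *.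
- by rewrite subrr (nrm0 hn) mulr_ge0.
- by rewrite subrr (nrm0 hn) mulr_ge0.
- have -> : a - a - a + a = 0 by ring.
  by rewrite (nrm0 hn) !mulr_ge0.
Qed.

Lemma bilip_fst (f : T -> K) C : (forall x, D1 x -> nrm (f x) <= C) ->
  (forall x x', D1 x -> D1 x' -> nrm (f x - f x') <= d1 x x') -> bilip (fun x _ => f x).
Proof.
move=> h1 h2; exists (1 + `|C|); split=> //.
- by rewrite addr_ge0.
- move=> x w Dx _; apply: le_trans (h1 x Dx) _; apply: le_trans (ler_norm C) _; lra.
- move=> x x' w Dx Dx' _; apply: le_trans (h2 x x' Dx Dx') _.
  by rewrite ler_peMl // lerDl.
- by move=> *; rewrite subrr (nrm0 hn) mulr_ge0 // addr_ge0.
- move=> x x' w w' _ _ _ _; have -> : f x - f x' - f x + f x' = 0 by ring.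
  by rewrite (nrm0 hn) !mulr_ge0 // addr_ge0.
Qed.

Lemma bilip_snd (f : U -> K) C : (forall x, D2 x -> nrm (f x) <= C) ->
  (forall x x', D2 x -> D2 x' -> nrm (f x - f x') <= d2 x x') -> bilip (fun _ x => f x).
Proof.
move=> h1 h2; exists (1 + `|C|); split=> //.
- by rewrite addr_ge0.
- move=> x w _ Dx; apply: le_trans (h1 w Dx) _; apply: le_trans (ler_norm C) _; lra.
- by move=> *; rewrite subrr (nrm0 hn) mulr_ge0 // addr_ge0.
- move=> x w w' _ Dw Dw'; apply: le_trans (h2 w w' Dw Dw') _.
  by rewrite ler_peMl // lerDl.
- move=> x x' w w' _ _ _ _; have -> : f w - f w - f w' + f w' = 0 by ring.
  by rewrite (nrm0 hn) !mulr_ge0 // addr_ge0.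
Qed.

Lemma bilipD f g : bilip f -> bilip g -> bilip (fun x w => f x w + g x w).
Proof.
move=> [C [C0 h1 h2 h3 h4]] [C' [C0' h1' h2' h3' h4']]; exists (C + C'); split.
- exact: addr_ge0.
- move=> x w Dx Dw; apply: le_trans (nrmD hn _ _) _; apply: lerD; [exact: h1|exact: h1'].
- move=> x x' w Dx Dx' Dw; rewrite opprD addrACA mulrDl.
  apply: le_trans (nrmD hn _ _) _; apply: lerD; [exact: h2|exact: h2'].
- move=> x w w' Dx Dw Dw'; rewrite opprD addrACA mulrDl.
  apply: le_trans (nrmD hn _ _) _; apply: lerD; [exact: h3|exact: h3'].
- move=> x x' w w' Dx Dx' Dw Dw'; rewrite !mulrDl.
  set e := nrm _.
  have -> : e = nrm ((f x w - f x' w - f x w' + f x' w') + (g x w - g x' w - g x w' + g x' w')).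
    by congr nrm; ring.
  apply: le_trans (nrmD hn _ _) _; apply: lerD; [exact: h4|exact: h4'].
Qed.

Lemma nrmM_le a b x y : nrm a <= x -> nrm b <= y -> nrm (a * b) <= x * y.
Proof. by move=> h h'; rewrite (nrmM hn); apply: ler_pM. Qed.

Lemma nrmD_le a b x y : nrm a <= x -> nrm b <= y -> nrm (a + b) <= x + y.
Proof. by move=> h h'; apply: le_trans (nrmD hn _ _) _; exact: lerD. Qed.

Lemma nrmB_le a b x y : nrm a <= x -> nrm b <= y -> nrm (a - b) <= x + y.
Proof. by move=> h h'; apply: le_trans (nrmB hn _ _) _; exact: lerD. Qed.

Lemma bilipM f g : bilip f -> bilip g -> bilip (fun x w => f x w * g x w).
Proof.
move=> [C [C0 h1 h2 h3 h4]] [C' [C0' h1' h2' h3' h4']]; exists (4 * (C * C')).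
have CC : 0 <= C * C' by exact: mulr_ge0.
split.
- by rewrite mulr_ge0.
- move=> x w Dx Dw; apply: (@le_trans _ _ (C * C')); last by lra.
  by apply: nrmM_le; [exact: h1|exact: h1'].
- move=> x x' w Dx Dx' Dw.
  have -> : f x w * g x w - f x' w * g x' w = f x w * (g x w - g x' w) + (f x w - f x' w) * g x' w by ring.
  apply: (@le_trans _ _ (C * (C' * d1 x x') + (C * d1 x x') * C')).
    by apply: nrmD_le; apply: nrmM_le; [exact: h1|exact: h2'|exact: h2|exact: h1'].
  have := mulr_ge0 CC (d1_ge0 x x'); nra.
- move=> x w w' Dx Dw Dw'.
  have -> : f x w * g x w - f x w' * g x w' = f x w * (g x w - g x w') + (f x w - f x w') * g x w' by ring.
  apply: (@le_trans _ _ (C * (C' * d2 w w') + (C * d2 w w') * C')).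
    by apply: nrmD_le; apply: nrmM_le; [exact: h1|exact: h3'|exact: h3|exact: h1'].
  have := mulr_ge0 CC (d2_ge0 w w'); nra.
- move=> x x' w w' Dx Dx' Dw Dw'.
  set e := nrm _.
  have -> : e = nrm (f x w * (g x w - g x' w - g x w' + g x' w')
     + (f x w - f x' w) * (g x' w - g x' w') + (f x w - f x w') * (g x w' - g x' w')
     + (f x w - f x' w - f x w' + f x' w') * g x' w') by congr nrm; ring.
  apply: (@le_trans _ _ (C * (C' * d1 x x' * d2 w w') + (C * d1 x x') * (C' * d2 w w')
    + (C * d2 w w') * (C' * d1 x x') + (C * d1 x x' * d2 w w') * C')); last first.
    by rewrite le_eqVlt; apply/orP; left; apply/eqP; ring.
  apply: nrmD_le; first apply: nrmD_le; first apply: nrmD_le; apply: nrmM_le.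
  + exact: h1. + exact: h4'. + exact: h2. + exact: h3'. + exact: h3. + exact: h2'.
  + exact: h4. + exact: h1'.
Qed.

Lemma bilipV f g : 0 < g -> (forall x w, D1 x -> D2 w -> g <= nrm (f x w)) ->
  bilip f -> bilip (fun x w => (f x w)^-1).
Proof.
move=> g0 low [C [C0 h1 h2 h3 h4]].
pose G := g^-1.
have G0 : 0 < G by rewrite invr_gt0.
have nz x w : D1 x -> D2 w -> f x w != 0.
  by move=> Dx Dw; apply: contraTneq (low x w Dx Dw) => ->; rewrite (nrm0 hn) -ltNge.
have hi x w : D1 x -> D2 w -> nrm (f x w)^-1 <= G.
  move=> Dx Dw; rewrite (nrmV hn) lef_pV2 ?posrE //; first exact: low.
  exact: lt_le_trans (low x w Dx Dw).
pose B := G + G * G * C + G ^+ 4 * (5 * C ^+ 3).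
have G40 : 0 <= G ^+ 4 * (5 * C ^+ 3) by rewrite mulr_ge0 ?exprn_ge0 ?(ltW G0) // mulr_ge0 ?exprn_ge0.
have GGC : 0 <= G * G * C by rewrite !mulr_ge0 // ltW.
exists B; split.
- by rewrite !addr_ge0 // ltW.
- move=> x w Dx Dw; apply: le_trans (hi x w Dx Dw) _; rewrite /B; lra.
- move=> x x' w Dx Dx' Dw.
  have -> : (f x w)^-1 - (f x' w)^-1 = - ((f x w)^-1 * (f x' w)^-1 * (f x w - f x' w)).
    by field; rewrite !nz.
  rewrite (nrmN hn); apply: (@le_trans _ _ (G * G * (C * d1 x x'))).
    by apply: nrmM_le; [apply: nrmM_le; exact: hi|exact: h2].
  by rewrite mulrA ler_wpM2r // /B; lra.
- move=> x w w' Dx Dw Dw'.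
  have -> : (f x w)^-1 - (f x w')^-1 = - ((f x w)^-1 * (f x w')^-1 * (f x w - f x w')).
    by field; rewrite !nz.
  rewrite (nrmN hn); apply: (@le_trans _ _ (G * G * (C * d2 w w'))).
    by apply: nrmM_le; [apply: nrmM_le; exact: hi|exact: h3].
  by rewrite mulrA ler_wpM2r // /B; lra.
- move=> x x' w w' Dx Dx' Dw Dw'.
  set F := f x w; set X := f x' w; set Y := f x w'; set Z := f x' w'.
  (* Every term of the numerator contains either one difference in each variable or the mixed
     difference of [f]. *)
  have -> : F^-1 - X^-1 - Y^-1 + Z^-1 = F^-1 * X^-1 * (Y^-1 * Z^-1) *
    ((X + Y) * ((X - Z) * (Y - Z)) + (F - X - Y + Z) * (X * Y - (X + Y) * Z)).
    by field; rewrite !nz.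
  apply: (@le_trans _ _ (G * G * (G * G) * ((C + C) * ((C * d2 w w') * (C * d1 x x'))
     + (C * d1 x x' * d2 w w') * (C * C + (C + C) * C)))).
    apply: nrmM_le; first by apply: nrmM_le; apply: nrmM_le; exact: hi.
    apply: nrmD_le; apply: nrmM_le.
    + by apply: nrmD_le; exact: h1.
    + by apply: nrmM_le; [exact: h3|exact: h2].
    + exact: h4.
    + by apply: nrmB_le; apply: nrmM_le; try exact: h1; apply: nrmD_le; exact: h1.
  have -> : G * G * (G * G) * ((C + C) * ((C * d2 w w') * (C * d1 x x'))
     + (C * d1 x x' * d2 w w') * (C * C + (C + C) * C)) = (G ^+ 4 * (5 * C ^+ 3)) * d1 x x' * d2 w w' by ring.
  by rewrite ler_wpM2r // ler_wpM2r // /B; lra.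
Qed.

Lemma bilip_sum (I : Type) (r : seq I) (F : I -> T -> U -> K) :
  (forall i, bilip (F i)) -> bilip (fun x w => \sum_(i <- r) F i x w).
Proof.
move=> h; elim: r => [|i r IH].
  by apply: bilip_ext (bilip_const 0) _ => *; rewrite big_nil.
by apply: bilip_ext (bilipD (h i) IH) _ => *; rewrite big_cons.
Qed.

Lemma bilip_prod (I : Type) (r : seq I) (F : I -> T -> U -> K) :
  (forall i, bilip (F i)) -> bilip (fun x w => \prod_(i <- r) F i x w).
Proof.
move=> h; elim: r => [|i r IH].
  by apply: bilip_ext (bilip_const 1) _ => *; rewrite big_nil.
by apply: bilip_ext (bilipM (h i) IH) _ => *; rewrite big_cons.
Qed.

Lemma bilip_meval n (H : {mpoly K[n]}) (h : 'I_n -> T -> U -> K) :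
  (forall i, bilip (h i)) -> bilip (fun x w => H.@[fun i => h i x w]).
Proof.
move=> hh; apply: bilip_ext (_ : bilip
  (fun x w => \sum_(m <- msupp H) H@_m * \prod_i h i x w ^+ m i)) _ => [|x w _ _]; last exact: mevalE.
apply: bilip_sum => m; apply: bilipM; first exact: bilip_const.
apply: bilip_prod => i; elim: (m i) => [|k IH].
  by apply: bilip_ext (bilip_const 1) _ => *; rewrite expr0.
by apply: bilip_ext (bilipM (hh i) IH) _ => *; rewrite exprS.
Qed.

End BiLipschitz.

(** * Lifting a polydisc *)

Section Muni.

Variables (K : fieldType) (n : nat).

Let wd (i : 'I_n) : 'I_n.+1 := widen_ord (leqnSn n) i.

Lemma muni_eval (q : {mpoly K[n.+1]}) (v : 'I_n.+1 -> K) :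
  q.@[v] = (map_poly (meval (v \o wd)) (muni q)).[v ord_max].
Proof.
rewrite muniE rmorph_sum /= horner_sum mevalE; apply: eq_bigr => m _.
rewrite map_polyZ map_polyXn hornerZ hornerXn /= mevalZ mevalX big_ord_recr /= mulrA.
by congr (_ * _ * _); apply: eq_bigr => i _; rewrite mnmE.
Qed.

Lemma muni_eq0 (q : {mpoly K[n.+1]}) : muni q = 0 -> q = 0.
Proof.
move=> e; suff <- : (map_poly (@mwiden n K) (muni q)).['X_ord_max] = q.
  by rewrite e rmorph0 horner0.
rewrite muniE rmorph_sum /= horner_sum [RHS]mpolyE; apply: eq_bigr => m _.
rewrite map_polyZ map_polyXn hornerZ hornerXn /= mwidenZ mwidenX -scalerAl; congr (_ *: _).
rewrite mpolyXn -mpolyXD; congr 'X_[_]; apply/mnmP => i; rewrite mnmDE mulmnE mnm1E.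
have [im|im] := eqVneq ord_max i.
  by rewrite -im mnmwiden_ordmax add0n mul1n.
have lt : (i < n)%N.
  by rewrite ltn_neqAle -ltnS ltn_ord andbT; apply: contraNneq im => e'; apply/eqP/val_inj.
have -> : i = widen_ord (leqnSn n) (Ordinal lt) by apply: val_inj.
by rewrite mnmwiden_widen mnmE mul0n addn0.
Qed.

End Muni.

Section Independence.

Variables (K : closedFieldType) (N : nat) (T : Type) (c : T -> 'rV[K]_N) (p : 'I_N).

Definition fun_zero (u : T -> K) (y : T) : Prop := c y 0 p != 0 -> u y = 0.

Lemma fun_zero_open u : (forall x, c x 0 p != 0 -> regular_at c x u) ->
  forall x, ~ fun_zero u x -> near_pt c x (fun y => ~ fun_zero u y).
Proof.
move=> hu x /not_implyP[xp /eqP nz].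
apply: near_pt_sub (near_ptI (near_pt_coord xp) (regular_neq0 (hu x xp) nz)) => y [yp hy] h.
by rewrite (h yp) eqxx in hy.
Qed.

(* Coquand and Lombardi's characterisation of Krull dimension: functions that
   vanish on one member of a chain of irreducible sets but not on the next are
   algebraically independent. *)
Lemma chain_independent r (Z : nat -> T -> Prop) (phi : nat -> T -> K) :
  (forall i, (i <= r)%N -> irreducible_closed c (Z i)) ->
  (forall i, (i < r)%N -> forall x, Z i x -> Z i.+1 x) ->
  (exists z, Z 0%N z /\ c z 0 p != 0) ->
  (forall i x, c x 0 p != 0 -> regular_at c x (phi i)) ->
  (forall i, (i < r)%N -> forall x, Z i x -> c x 0 p != 0 -> phi i x = 0) ->
  (forall i, (i < r)%N -> exists x, [/\ Z i.+1 x, c x 0 p != 0 & phi i x != 0]) ->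
  forall q : {mpoly K[r]}, q != 0 ->
    exists x, [/\ Z r x, c x 0 p != 0 & q.@[fun i : 'I_r => phi i x] != 0].
Proof.
move=> + + hz0 reg; elim: r => [|r IH] irr sub van nvan q q0.
  have [z [Zz zp]] := hz0; exists z; split=> //.
  rewrite [q]nvar0_mpolyC mevalC; apply: contra q0 => /eqP e.
  by rewrite [q]nvar0_mpolyC e.
have {}IH := IH (fun i h => irr i (leqW h)) (fun i h => sub i (leqW h))
  (fun i h => van i (leqW h)) (fun i h => nvan i (leqW h)).
pose P := muni q.
have P0 : P != 0 by apply: contra_neq q0; exact: muni_eq0.
(* With [j] the lowest exponent of the last variable, [q] becomes [W] times the [j]-th power of the
   last function. If this vanished on [Z r.+1], so would [W] by irreducibility; on [Z r], where the
   last function is 0, [W] reduces to the lowest coefficient, against the induction. *)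
have exj : exists j, P`_j != 0.
  by exists (size P).-1; rewrite -lead_coefE lead_coef_eq0.
case: (ex_minnP exj) => j Pj minj.
pose P' := drop_poly j P.
have eP : P = P' * 'X^j.
  rewrite -[LHS](poly_take_drop j) (_ : take_poly j P = 0) ?add0r //.
  apply/polyP => i; rewrite coef_take_poly coef0; case: ifP => // ij.
  by apply/eqP/negPn/negP => /minj; rewrite leqNgt ij.
have P'0 : P'`_0 = P`_j by rewrite coef_drop_poly add0n.
apply: contrapT => /forallNP none.
pose v x := fun i : 'I_r.+1 => phi i x.
pose v' x := fun i : 'I_r => phi i x.
pose W x := (map_poly (meval (v' x)) P').[phi r x].
have ev x : q.@[v x] = W x * phi r x ^+ j.
  rewrite muni_eval -/P eP rmorphM /= map_polyXn hornerM hornerXn.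
  congr (_ * _); rewrite /W; congr (_ .[_]); apply: eq_map_poly => a; exact: meval_eq.
have Wreg x : c x 0 p != 0 -> regular_at c x W.
  move=> xp; apply: (@regular_ext _ _ _ _ _
    (fun y => \sum_(i < size P') (P'`_i).@[fun l : 'I_r => phi l y] * phi r y ^+ i)) => [|y].
    apply: regular_sum => i _; apply: regularM; last by apply: regularX; exact: reg.
    by apply: regular_meval => l; exact: reg.
  rewrite /W (horner_coef_wide _ (size_poly _ _)); apply: eq_bigr => i _.
  by rewrite coef_map.
have irrZ := irr r.+1 (leqnn _).
have [x1 [Zx1 x1p x1n]] := nvan r (leqnn _).
have [x|h|h] := irreducible_open irrZ (fun_zero_open (reg r)) (fun_zero_open Wreg).
- move=> Zx; have [xp|/negPn/eqP xp] := boolP (c x 0 p != 0); last first.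
    by left; rewrite /fun_zero xp eqxx.
  have /eqP : q.@[v x] = 0.
    by apply/eqP/negPn/negP => nz; apply: (none x).
  by rewrite ev mulf_eq0 expf_eq0 => /orP[/eqP|/andP[_ /eqP]] e; [right|left].
- by move: x1n; rewrite h ?eqxx.
have [y [Zy yp yn]] := IH (P`_j) Pj.
move/negP: yn; apply; apply/eqP.
have := h y (sub r (leqnn _) y Zy) yp.
rewrite /W (van r (leqnn _) y Zy yp) horner_coef0 coef_map P'0 //.
Qed.

End Independence.

Section Polydisc.

Variables (R : realType) (K : closedFieldType) (nrm : K -> R).
Hypothesis hn : is_norm nrm.
Variable A : abelianVariety K.
Notation c := (@av_coord K A).
Notation N := (@av_size K A).

Definition dist1 n (v w : 'I_n -> K) : R := \sum_i nrm (v i - w i).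

Lemma dist1_ge0 n (v w : 'I_n -> K) : 0 <= dist1 v w.
Proof. by apply: sumr_ge0 => i _; exact: (nrm_ge0 hn). Qed.

Lemma dist1_coord n (v w : 'I_n -> K) i : nrm (v i - w i) <= dist1 v w.
Proof. by rewrite /dist1 (bigD1 i) //= lerDl sumr_ge0 // => j _; exact: (nrm_ge0 hn). Qed.

Lemma meval_lipschitz n (Q : {mpoly K[n]}) (D : ('I_n -> K) -> Prop) (B : R) :
  (forall v, D v -> forall i, nrm (v i) <= B) ->
  exists C, [/\ 0 <= C, forall v, D v -> nrm Q.@[v] <= C
    & forall v w, D v -> D w -> nrm (Q.@[v] - Q.@[w]) <= C * dist1 v w].
Proof.
move=> hB.
have [C [C0 h1 h2 _ _]] : bilip nrm D (fun _ : unit => True) (@dist1 n) (fun _ _ => 0) (fun v _ => Q.@[v]).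
  apply: (@bilip_meval _ _ _ hn _ _ D (fun=> True) (@dist1 n) (fun _ _ => 0) _ _ n Q
    (fun i v _ => v i)) => //; first exact: dist1_ge0.
  move=> i; apply: (bilip_fst hn) => //; first exact: dist1_ge0.
    by move=> v Dv; exact: hB.
  by move=> v w _ _; exact: dist1_coord.
by exists C; split=> //; [move=> v Dv; exact: (h1 v tt)|move=> v w Dv Dw; exact: (h2 v w tt)].
Qed.

(** A chain of length [g] yields [g] functions whose algebra [O] is a polynomial ring. Points of
    [K^g] are then homomorphisms from [O] to [K], and they lift to [A], with bounded coordinates,
    wherever [Q0] is bounded below. *)
Theorem polydisc_lift g : has_dim c g -> exists (F : 'I_g -> {mpoly K[N]}) (p : 'I_N)
    (y0 : 'I_g -> K) (rho C : R), 0 < rho /\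
  forall y, dist1 y y0 <= rho -> exists a, [/\ c a 0 p != 0,
    forall i, (F i).@[(aff c p)^~ a] = y i & forall j, nrm (aff c p j a) <= C].
Proof.
move=> [[Z [irrZ chZ]] _].
have [_ [z0 Zz0] _] := irrZ 0%N (leq0n _).
have [p z0p] := exists_coord (@av_coord_neq0 K A z0).
have Zup i z : (i <= g)%N -> Z 0%N z -> Z i z.
  by elim: i => // i IH ig Zz; apply: (chZ i ig).1; apply: IH => //; exact: ltnW.
have E i : exists F : {mpoly K[N]}, (i < g)%N ->
    (forall x, Z i x -> c x 0 p != 0 -> F.@[(aff c p)^~ x] = 0) /\
    exists x, [/\ Z i.+1 x, c x 0 p != 0 & F.@[(aff c p)^~ x] != 0].
  have [ig|_] := ltnP i g; last by exists 0.
  have [_ [w [Zw nw]]] := chZ i ig.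
  have [clZ _ _] := irrZ i (ltnW ig).
  have [S [hS hZ]] := clZ.
  have [F [SF Fw]] : exists F, S F /\ form_eval F (c w) != 0.
    apply: contrapT => /forallNP h; apply: nw; apply/hZ => F SF.
    by apply/eqP/negPn/negP => nz; apply: (h F).
  have [d hd] := hS F SF.
  have F0 x : Z i x -> c x 0 p != 0 -> F.@[(aff c p)^~ x] = 0.
    move=> Zx xp; have := (hZ x).1 Zx F SF; rewrite (form_eval_aff hd xp) => /eqP.
    by rewrite mulf_eq0 expf_eq0 (negbTE xp) andbF => /eqP.
  exists F => _; split=> //.
  have irrS := irrZ i.+1 ig.
  apply: contrapT => /forallNP none.
  have [|||h|h] := irreducible_open (P1 := fun y => c y 0 p = 0)
      (P2 := fun y => form_eval F (c y) = 0) irrS.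
  - by move=> x /eqP xp; apply: near_pt_sub (near_pt_coord xp) => y /eqP.
  - by move=> x /eqP nz; apply: near_pt_sub (near_pt_form hd nz) => y /eqP.
  - move=> x Zx; have [xp|xp] := eqVneq (c x 0 p) 0; first by left.
    right; apply/eqP/negPn/negP => nz; apply: (none x); split=> //.
    by apply: contra_neq nz => e; rewrite (form_eval_aff hd xp) e mulr0.
  - by move: z0p; rewrite h ?eqxx //; exact: Zup.
  - by move: Fw; rewrite h ?eqxx.
have [F hF] : exists F : nat -> {mpoly K[N]}, forall i, (i < g)%N ->
    (forall x, Z i x -> c x 0 p != 0 -> (F i).@[(aff c p)^~ x] = 0) /\
    exists x, [/\ Z i.+1 x, c x 0 p != 0 & (F i).@[(aff c p)^~ x] != 0].
  by exists (fun i => projT1 (cid (E i))) => i; case: (cid (E i)).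
have indep (q : {mpoly K[g]}) : q != 0 -> exists x, [/\ Z g x, c x 0 p != 0 &
    q.@[fun i : 'I_g => (F i).@[(aff c p)^~ x]] != 0].
  apply: (@chain_independent _ _ _ c p g Z (fun i x => (F i).@[(aff c p)^~ x])) => //.
  - by move=> i ig; exact: (chZ i ig).1.
  - by exists z0.
  - by move=> i x xp; apply: regular_meval => j; exact: regular_aff.
  - by move=> i ig; exact: (hF i ig).1.
  - by move=> i ig; exact: (hF i ig).2.
have [L [h hP]] := function_field (ex_intro _ z0 z0p).
pose f (i : 'I_g) := h (F i).
have mapE (Q : {mpoly K[g]}) : exists s, mmap (cst h) f Q = h s /\
    forall y, s.@[(aff c p)^~ y] = Q.@[fun i : 'I_g => (F i).@[(aff c p)^~ y]].
  exists (Q \mPo [tuple F i | i < g]); split.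
    rewrite /comp_mpoly /mmap rmorph_sum; apply: eq_bigr => m _; rewrite rmorphM; congr (_ * _).
    rewrite /mmap1 rmorph_prod; apply: eq_bigr => i _; by rewrite rmorphXn tnth_mktuple.
  by move=> y; rewrite comp_mpoly_meval; apply: meval_eq => i; rewrite tnth_mktuple.
have inj Q : mmap (cst h) f Q = 0 -> Q = 0.
  have [s [-> hs]] := mapE Q => /hP s0; apply/eqP/negPn/negP => /indep[x [_ xp]].
  by rewrite -hs s0 // eqxx.
pose O x := exists Q, x = mmap (cst h) f Q.
have hO : is_subalg (cst h) O.
  split.
  - by move=> a; exists a%:MP; rewrite mmapC.
  - by move=> _ _ [Q ->] [Q' ->]; exists (Q + Q'); rewrite mmapD.
  - by move=> _ _ [Q ->] [Q' ->]; exists (Q * Q'); rewrite rmorphM.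
pose us := [seq coor h i | i <- enum 'I_N].
have hO' := adjoin_seq_subalg us hO.
have uO i : adjoin_seq O us (coor h i).
  by apply: (adjoin_seq_gen hO); apply: map_f; rewrite mem_enum.
have [h0 [cs [[Q0 eQ0] h00 csO ext]]] :=
  adjoin_seq_extend hn hO (sub1 hO') (oner_neq0 L).
have [x0 [_ x0p Q0x]] : exists x, [/\ Z g x, c x 0 p != 0 &
    Q0.@[fun i : 'I_g => (F i).@[(aff c p)^~ x]] != 0].
  by apply: indep; apply: contra_neq h00 => e; rewrite eQ0 e mmap0.
pose y0 (i : 'I_g) := (F i).@[(aff c p)^~ x0].
pose D (y : 'I_g -> K) := dist1 y y0 <= 1.
pose B := 1 + \sum_i nrm (y0 i).
have DB v : D v -> forall i, nrm (v i) <= B.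
  move=> Dv i; have -> : v i = (v i - y0 i) + y0 i by rewrite subrK.
  apply: le_trans (nrmD hn _ _) _; apply: lerD.
    exact: le_trans (dist1_coord _ _ _) Dv.
  by rewrite (bigD1 i) //= lerDl sumr_ge0 // => j _; exact: (nrm_ge0 hn).
have [C0 [C00 _ lip0]] := meval_lipschitz Q0 DB.
have [Cs hCs] : exists Cs, forall x, x \in cs -> forall Q, x = mmap (cst h) f Q ->
    forall y, D y -> nrm Q.@[y] <= Cs.
  elim: cs csO {ext} => [|x s IH] csO; first by exists 0.
  have [|C1 h1] := IH; first by move=> y ys; apply: csO; rewrite inE ys orbT.
  have [Q eQ] := csO x (mem_head _ _).
  have [C2 [_ h2 _]] := meval_lipschitz Q DB.
  exists (Num.max C1 C2) => y; rewrite inE => /orP[/eqP->|ys] Q' eQ' v Dv; rewrite le_max.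
    have -> : Q' = Q.
      by apply/eqP; rewrite -subr_eq0; apply/eqP/inj; rewrite mmapB -eQ -eQ' subrr.
    by rewrite h2 // orbT.
  by rewrite (h1 y ys).
pose g0 := nrm Q0.@[y0].
have g00 : 0 < g0 by exact: nrm_gt0.
have [C' [g' [g'0 ex]]] := ext Cs (g0 / 2) (divr_gt0 g00 (ltr0Sn _ 1)).
(* Within this radius the Lipschitz constant [C0] lets [Q0] change by at most [g0 / 2], half of its
   size at the centre. *)
pose rho := Num.min 1 (g0 / (2 * (C0 + 1))).
have rho0 : 0 < rho by rewrite lt_min ltr01 divr_gt0 // mulr_gt0 // ltr_wpDl.
exists (fun i : 'I_g => F i), p, y0, rho, C'; split=> // y hy.
have Dy : D y by apply: le_trans hy _; rewrite ge_min lexx.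
have Dy0 : D y0 by rewrite /D /dist1 big1 // => i _; rewrite subrr (nrm0 hn).
have low : g0 / 2 <= nrm Q0.@[y].
  have h1 := lip0 y0 y Dy0 Dy.
  have h2 : dist1 y0 y <= g0 / (2 * (C0 + 1)).
    have -> : dist1 y0 y = dist1 y y0 by apply: eq_bigr => i _; exact: (nrmBC hn).
    by apply: le_trans hy _; rewrite ge_min lexx orbT.
  have h3 : C0 * dist1 y0 y <= g0 / 2.
    apply: (@le_trans _ _ (C0 * (g0 / (2 * (C0 + 1))))); first exact: ler_wpM2l.
    have C1 : 0 < C0 + 1 by rewrite ltr_wpDl.
    rewrite mulrA ler_pdivrMr ?mulr_gt0 //.
    have -> : g0 / 2 * (2 * (C0 + 1)) = C0 * g0 + g0 by field.
    by rewrite lerDl ltW.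
  have h4 : g0 <= nrm (Q0.@[y0] - Q0.@[y]) + nrm Q0.@[y].
    by rewrite /g0 -{1}(subrK Q0.@[y] Q0.@[y0]); exact: (nrmD hn).
  lra.
have [phi hphi] : exists phi : L -> K, forall Q, phi (mmap (cst h) f Q) = Q.@[y].
  exists (fun x => if pselect (O x) is left e then (projT1 (cid e)).@[y] else 0) => Q.
  case: pselect => [e|[]]; last by exists Q.
  case: (cid e) => Q' /= e'; suff -> : Q' = Q by [].
  by apply/eqP; rewrite -subr_eq0; apply/eqP/inj; rewrite mmapB e' subrr.
have hom : is_hom (cst h) O phi.
  split.
  - by move=> a; rewrite -(mmapC f (cst h) a) hphi mevalC.
  - by move=> _ _ [Q ->] [Q' ->]; rewrite -mmapD !hphi mevalD.
  - by move=> _ _ [Q ->] [Q' ->]; rewrite -rmorphM !hphi mevalM.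
have [||phi' [hphi' e1 nb _]] := ex phi hom.
- move=> x xcs; have [Q eQ] := csO x xcs; rewrite eQ hphi; exact: hCs eQ _ Dy.
- by rewrite eQ0 hphi.
have [a [ap ea]] := point_of_hom hP hO' hphi' uO.
exists a; split=> // [i|j]; last by rewrite ea nb //; apply: map_f; rewrite mem_enum.
have ev Q : phi' (h Q) = Q.@[(aff c p)^~ a].
  by rewrite (hom_fun hO' hphi' uO); apply: meval_eq => j; rewrite ea.
have fO : O (f i) by exists 'X_i; rewrite mmapX mmap1U.
rewrite -ev -[h _]/(f i) e1 //.
by have := hphi 'X_i; rewrite mmapX mmap1U mevalXU.
Qed.

End Polydisc.

(** * Sequential compactness *)

Definition increasing_seq (phi : nat -> nat) := forall n, (phi n < phi n.+1)%N.

Lemma increasing_seq_ge phi : increasing_seq phi -> forall n, (n <= phi n)%N.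
Proof. by move=> h; elim=> // n IH; exact: leq_ltn_trans IH (h n). Qed.

Lemma increasing_seq_lt phi : increasing_seq phi -> forall m n, (m < n)%N -> (phi m < phi n)%N.
Proof.
move=> h m; elim=> // n IH; rewrite ltnS leq_eqVlt => /orP[/eqP->|/IH]; first exact: h.
by move=> lt; exact: ltn_trans lt (h n).
Qed.

Lemma increasing_seq_comp phi psi : increasing_seq phi -> increasing_seq psi ->
  increasing_seq (phi \o psi).
Proof. by move=> h h' n /=; apply: increasing_seq_lt. Qed.

Lemma infinitely_often_seq (P : nat -> Prop) : (forall n0, exists2 n, (n0 <= n)%N & P n) ->
  exists2 phi, increasing_seq phi & forall n, P (phi n).
Proof.
move=> h.
have ch n0 : exists n, (n0 <= n)%N /\ P n by have [n] := h n0; exists n.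
pose nx n0 := projT1 (cid (ch n0)).
have nxP n0 : (n0 <= nx n0)%N /\ P (nx n0) by rewrite /nx; case: (cid _).
exists (fun n => iter n (fun m => nx m.+1) (nx 0%N)) => n; first by rewrite iterS; exact: (nxP _).1.
by case: n => [|n]; [exact: (nxP _).2 | rewrite iterS; exact: (nxP _).2].
Qed.

Lemma infinite_pigeonhole n (f : nat -> 'I_n) :
  exists p, exists2 phi, increasing_seq phi & forall k, f (phi k) = p.
Proof.
have [p hp] : exists p, forall n0, exists2 k, (n0 <= k)%N & f k = p.
  apply: contrapT => /forallNP h.
  have ch p : exists n0, forall k, (n0 <= k)%N -> f k <> p.
    have /existsNP[n0 hn0] := h p; exists n0 => k hk e; apply: hn0; by exists k.
  pose b p := projT1 (cid (ch p)).
  have bP p k : (b p <= k)%N -> f k <> p by rewrite /b; case: (cid _) => n0 /= H; exact: H.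
  pose k := \max_p b p.
  have bk : (b (f k) <= k)%N by exact: leq_bigmax.
  exact: (bP (f k) k bk).
exists p; exact: (infinitely_often_seq hp).
Qed.

Section Limits.

Variables (R : realType) (K : fieldType) (nrm : K -> R).
Hypothesis hn : is_norm nrm.

Definition tends (u : nat -> K) (l : K) := forall e, 0 < e -> exists n0, forall n, (n0 <= n)%N ->
  nrm (u n - l) < e.

Definition bolzano_weierstrass := forall (u : nat -> K) (B : R), (forall n, nrm (u n) <= B) ->
  exists2 phi, increasing_seq phi & exists l, tends (u \o phi) l.

Lemma tends_sub u l phi : increasing_seq phi -> tends u l -> tends (u \o phi) l.
Proof.
move=> hp h e /h[n0 hn0]; exists n0 => n hn1; apply: hn0.
exact: leq_trans hn1 (increasing_seq_ge hp n).
Qed.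

Lemma nrm_small x : (forall e, 0 < e -> nrm x < e) -> x = 0.
Proof.
move=> h; apply: (nrm_eq0 hn); apply/eqP; rewrite eq_le (nrm_ge0 hn) andbT.
by rewrite leNgt; apply/negP => /h; rewrite ltxx.
Qed.

Lemma tends_unique u l l' : tends u l -> tends u l' -> l = l'.
Proof.
move=> h h'; apply/eqP; rewrite -subr_eq0; apply/eqP/nrm_small => e e0.
have e2 : 0 < e / 2 by rewrite divr_gt0.
have [n1 h1] := h _ e2; have [n2 h2] := h' _ e2.
have m1 := h1 (maxn n1 n2) (leq_maxl _ _); have m2 := h2 (maxn n1 n2) (leq_maxr _ _).
have -> : l - l' = (u (maxn n1 n2) - l') - (u (maxn n1 n2) - l) by ring.
apply: le_lt_trans (nrmB hn _ _) _; lra.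
Qed.

Lemma tends_bounded u l : tends u l -> exists B n0, forall n, (n0 <= n)%N -> nrm (u n) <= B.
Proof.
move=> /(_ 1 ltr01)[n0 h]; exists (1 + nrm l), n0 => n /h hh.
rewrite -(subrK l (u n)); apply: le_trans (nrmD hn _ _) _; rewrite lerD2r; exact: ltW.
Qed.

Lemma tendsM u l u' l' : tends u l -> tends u' l' -> tends (fun n => u n * u' n) (l * l').
Proof.
move=> h h' e e0; have [B [n1 hB]] := tends_bounded h'.
pose M := 1 + `|B| + nrm l.
have M0 : 0 < M by have := nrm_ge0 hn l; have := normr_ge0 B; rewrite /M; lra.
have e2 : 0 < e / (2 * M) by rewrite divr_gt0 // mulr_gt0.
have [n2 h2] := h _ e2; have [n3 h3] := h' _ e2.
exists (maxn n1 (maxn n2 n3)) => n; rewrite !geq_max => /and3P[m1 m2 m3].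
have -> : u n * u' n - l * l' = (u n - l) * u' n + l * (u' n - l') by ring.
apply: le_lt_trans (nrmD hn _ _) _; rewrite !(nrmM hn).
have b1 : nrm (u n - l) * nrm (u' n) <= e / (2 * M) * `|B|.
  apply: ler_pM; rewrite ?(nrm_ge0 hn) //; first by apply: ltW; exact: h2.
  exact: le_trans (hB n m1) (ler_norm _).
have b2 : nrm l * nrm (u' n - l') <= nrm l * (e / (2 * M)).
  by apply: ler_wpM2l; [exact: nrm_ge0 hn _ | apply: ltW; exact: h3].
have -> : e = e / (2 * M) * M + e / (2 * M) * M by field; rewrite lt0r_neq0.
set t := e / (2 * M) in e2 b1 b2 *.
have : 0 <= t * nrm l by apply: mulr_ge0; [exact: ltW | exact: nrm_ge0 hn _].
have : 0 <= t * `|B| by rewrite mulr_ge0 // ltW.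
rewrite /M !mulrDr mulr1; move: b2; rewrite [nrm l * t]mulrC; lra.
Qed.

Lemma bw_coordinates (BW : bolzano_weierstrass) n (u : nat -> 'I_n -> K) (B : R) :
  (forall k i, nrm (u k i) <= B) ->
  exists2 phi, increasing_seq phi & exists l, forall i, tends (fun k => u (phi k) i) (l i).
Proof.
move=> hB.
suff H (s : seq 'I_n) : exists2 phi, increasing_seq phi &
    exists l : 'I_n -> K, forall i, i \in s -> tends (fun k => u (phi k) i) (l i).
  have [phi hp [l hl]] := H (enum 'I_n); exists phi => //; exists l => i.
  by apply: hl; rewrite mem_enum.
elim: s => [|i s [phi hp [l hl]]].
  by exists id; [move=> k; exact: ltnSn | exists (fun=> 0)].
have [psi hs [li hli]] := BW (fun k => u (phi k) i) B (fun k => hB _ _).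
exists (phi \o psi); first exact: increasing_seq_comp.
exists (fun j => if j == i then li else l j) => j; rewrite inE.
have [->|ji] /= := eqVneq j i; first by move=> _; exact: hli.
by move=> js; exact: (tends_sub hs (hl j js)).
Qed.

End Limits.

(** * Metric estimates and sequential limits on the variety *)

Section LocalAnalysis.

Variables (R : realType) (K : closedFieldType) (nrm : K -> R).
Hypothesis hn : is_norm nrm.
Variable A : abelianVariety K.
Notation c := (@av_coord K A).
Notation N := (@av_size K A).

Definition adist p (x y : A) : R := dist1 nrm ((aff c p)^~ x) ((aff c p)^~ y).

(** Membership in the chart is demanded explicitly: off the chart division by zero makes all affine
    coordinates 0, and the distance is meaningless. *)
Definition nbd p (a : A) (e : R) (x : A) : Prop := c x 0 p != 0 /\ adist p x a < e.

Lemma adist_ge0 p x y : 0 <= adist p x y. Proof. exact: dist1_ge0. Qed.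

Lemma adist_coord p i x y : nrm (aff c p i x - aff c p i y) <= adist p x y.
Proof. exact: (dist1_coord hn (fun i => aff c p i x) (fun i => aff c p i y) i). Qed.

Lemma adistxx p x : adist p x x = 0.
Proof. by rewrite /adist /dist1 big1 // => i _; rewrite subrr (nrm0 hn). Qed.

Lemma adistC p x y : adist p x y = adist p y x.
Proof. by apply: eq_bigr => i _; exact: nrmBC. Qed.

Lemma adist_triangle p x y z : adist p x z <= adist p x y + adist p y z.
Proof.
rewrite /adist /dist1 -big_split /=; apply: ler_sum => i _.
have -> : aff c p i x - aff c p i z = (aff c p i x - aff c p i y) + (aff c p i y - aff c p i z) by ring.
exact: nrmD.
Qed.

Lemma nbd_sub p a e e' x : e <= e' -> nbd p a e x -> nbd p a e' x.
Proof. by move=> le [h1 h2]; split=> //; exact: lt_le_trans h2 le. Qed.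

Lemma nbd_self p a e : c a 0 p != 0 -> 0 < e -> nbd p a e a.
Proof. by move=> h1 h2; split=> //; rewrite adistxx. Qed.

Section TwoPoints.

Variables (a b : A) (p q : 'I_N).
Hypotheses (ap : c a 0 p != 0) (bq : c b 0 q != 0).

Definition bilip_at (e : R) (f : A * A -> K) :=
  bilip nrm (nbd p a e) (nbd q b e) (adist p) (adist q) (fun x w => f (x, w)).

Lemma bilip_at_sub e e' f : e <= e' -> bilip_at e' f -> bilip_at e f.
Proof.
move=> le [C [C0 h1 h2 h3 h4]]; exists C; split=> //.
- by move=> x w /(nbd_sub le) hx /(nbd_sub le) hw; exact: h1.
- by move=> x x' w /(nbd_sub le) ? /(nbd_sub le) ? /(nbd_sub le) ?; exact: h2.
- by move=> x w w' /(nbd_sub le) ? /(nbd_sub le) ? /(nbd_sub le) ?; exact: h3.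
- by move=> x x' w w' /(nbd_sub le) ? /(nbd_sub le) ? /(nbd_sub le) ? /(nbd_sub le) ?; exact: h4.
Qed.

Lemma aff_bounded r z e i x : nbd r z e x -> nrm (aff c r i x) <= e + nrm (aff c r i z).
Proof.
move=> [_ h]; rewrite -{1}(subrK (aff c r i z) (aff c r i x)).
apply: le_trans (nrmD hn _ _) _; rewrite lerD2r.
exact: le_trans (adist_coord _ _ _ _) (ltW h).
Qed.

Lemma bilip_aff1 e i : bilip_at e (fun y => aff c p i y.1).
Proof.
apply: (@bilip_fst _ _ _ hn _ _ _ _ _ _ (@adist_ge0 p) (@adist_ge0 q) (aff c p i) (e + nrm (aff c p i a))).
  by move=> x; exact: aff_bounded.
by move=> x x' _ _; exact: adist_coord.
Qed.

Lemma bilip_aff2 e i : bilip_at e (fun y => aff c q i y.2).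
Proof.
apply: (@bilip_snd _ _ _ hn _ _ _ _ _ _ (@adist_ge0 p) (@adist_ge0 q) (aff c q i) (e + nrm (aff c q i b))).
  by move=> x; exact: aff_bounded.
by move=> x x' _ _; exact: adist_coord.
Qed.

Lemma bilip_lower e f : 0 < e -> bilip_at e f -> f (a, b) != 0 ->
  exists e' g, [/\ 0 < e', e' <= e, 0 < g & forall x w, nbd p a e' x -> nbd q b e' w -> g <= nrm (f (x, w))].
Proof.
move=> e0 [C [C0 h1 h2 h3 h4]] f0.
have g0 : 0 < nrm (f (a, b)) by exact: nrm_gt0.
(* Replacing [x] by [a] and then [w] by [b] changes [f] by at most [g / 4] each time, which leaves
   [g / 2]. *)
pose g := nrm (f (a, b)); pose e' := Num.min e (g / (4 * (C + 1))).
have C1 : 0 < C + 1 by rewrite ltr_wpDl.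
have e'0 : 0 < e' by rewrite lt_min e0 divr_gt0 // mulr_gt0.
have le' : e' <= e by rewrite ge_min lexx.
exists e', (g / 2); split=> //; first by rewrite divr_gt0.
move=> x w hx hw.
have xe := nbd_sub le' hx; have we := nbd_sub le' hw.
have ae := nbd_self ap e0; have be := nbd_self bq e0.
have k1 := h2 x a w xe ae we; have k2 := h3 a w b ae we be.
have small t : 0 <= t -> t < e' -> C * t <= g / 4.
  move=> t0 lt; apply: (@le_trans _ _ (C * (g / (4 * (C + 1))))).
    by apply: ler_wpM2l => //; apply: le_trans (ltW lt) _; rewrite ge_min lexx orbT.
  rewrite mulrA ler_pdivrMr ?mulr_gt0 //.
  have -> : g / 4 * (4 * (C + 1)) = C * g + g by field.
  by rewrite lerDl ltW.
have s1 := small _ (adist_ge0 _ _ _) hx.2; have s2 := small _ (adist_ge0 _ _ _) hw.2.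
have : g <= nrm (f (x, w)) + (nrm (f (x, w) - f (a, w)) + nrm (f (a, w) - f (a, b))).
  have -> : g = nrm (f (x, w) - ((f (x, w) - f (a, w)) + (f (a, w) - f (a, b)))).
    by rewrite /g; congr nrm; ring.
  by apply: le_trans (nrmB hn _ _) _; rewrite lerD2l; exact: nrmD.
lra.
Qed.

Lemma near_nbd P : near_pt (segre c c) (a, b) P ->
  exists2 e, 0 < e & forall x w, nbd p a e x -> nbd q b e w -> P (x, w).
Proof.
move=> [n [H [hH Hab HP]]].
pose k0 := mxvec_index p q.
have kab : segre c c (a, b) 0 k0 != 0 by rewrite segreE mulf_neq0.
pose f y := H.@[fun k => aff (segre c c) k0 k y].
have bf : bilip_at 1 f.
  apply: (@bilip_meval _ _ _ hn _ _ _ _ _ _ (@adist_ge0 p) (@adist_ge0 q) _ H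
    (fun k x w => aff (segre c c) k0 k (x, w))) => k.
  case/mxvec_indexP: k => i j.
  apply: bilip_ext (bilipM hn (@adist_ge0 p) (@adist_ge0 q) (bilip_aff1 1 i) (bilip_aff2 1 j)) _.
  by move=> x w _ _; rewrite /aff /k0 !segreE mulf_div.
have f0 : f (a, b) != 0.
  by apply: contra_neq Hab => e; rewrite (form_eval_aff hH kab) -/(f (a, b)) e mulr0.
have [e [g [e0 _ g0 low]]] := bilip_lower ltr01 bf f0.
exists e => // x w hx hw; apply: HP.
have kxw : segre c c (x, w) 0 k0 != 0 by rewrite segreE mulf_neq0 //; [exact: hx.1 | exact: hw.1].
rewrite (form_eval_aff hH kxw) mulf_neq0 // ?expf_neq0 //.
by apply: contraTneq (low x w hx hw) => e'; rewrite /f e' (nrm0 hn) -ltNge.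
Qed.

(* The mixed difference bound in [bilip_by] is what makes the addition law
   tangent to ordinary addition at the origin. *)
Lemma regular_bilip phi : regular_at (segre c c) (a, b) phi -> exists2 e, 0 < e & bilip_at e phi.
Proof.
move: phi; apply: (@segre_regular_ind _ _ _ _ _ c c (a, b) p q) => //.
- move=> k; exists 1 => //.
  exact: (bilip_const hn _ _ (@adist_ge0 p) (@adist_ge0 q)).
- by move=> i; exists 1 => //; exact: bilip_aff1.
- by move=> i; exists 1 => //; exact: bilip_aff2.
- move=> f g [e e0 hf] [e' e'0 hg]; exists (Num.min e e'); first by rewrite lt_min e0 e'0.
  apply: (bilipD hn); first by apply: bilip_at_sub hf; rewrite ge_min lexx.
  by apply: bilip_at_sub hg; rewrite ge_min lexx orbT.
- move=> f g [e e0 hf] [e' e'0 hg]; exists (Num.min e e'); first by rewrite lt_min e0 e'0.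
  apply: (bilipM hn (@adist_ge0 p) (@adist_ge0 q)); first by apply: bilip_at_sub hf; rewrite ge_min lexx.
  by apply: bilip_at_sub hg; rewrite ge_min lexx orbT.
- move=> f [e e0 hf] f0; have [e' [g [e'0 le g0 low]]] := bilip_lower e0 hf f0.
  exists e' => //; apply: (bilipV hn (@adist_ge0 p) (@adist_ge0 q) g0 low).
  exact: bilip_at_sub hf.
- move=> f g [e e0 hf] hnear; have [e' e'0 he'] := near_nbd hnear.
  exists (Num.min e e'); first by rewrite lt_min e0 e'0.
  have l1 : Num.min e e' <= e by rewrite ge_min lexx.
  have l2 : Num.min e e' <= e' by rewrite ge_min lexx orbT.
  apply: bilip_ext (bilip_at_sub l1 hf) _ => x w /(nbd_sub l2) hx /(nbd_sub l2) hw.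
  exact: he'.
Qed.

Lemma add_bilip r : c (a + b) 0 r != 0 -> exists2 e, 0 < e & exists2 C, 0 <= C &
  (forall x w, nbd p a e x -> nbd q b e w -> c (x + w) 0 r != 0) /\
  forall i, bilip_by nrm (nbd p a e) (nbd q b e) (adist p) (adist q) (fun x w => aff c r i (x + w)) C.
Proof.
move=> abr.
have reg i : regular_at (segre c c) (a, b) (fun y => aff c r i (y.1 + y.2)).
  by apply: (@av_add K A (a, b) (aff c r i)); exact: regular_aff.
have nr : near_pt (segre c c) (a, b) (fun y => c (y.1 + y.2) 0 r != 0).
  exact: (morphism_near (@av_coord_neq0 K A) (@av_add K A) (x := (a, b)) (near_pt_coord abr)).
have [e1 e10 h1] := near_nbd nr.
have [e2 e20 h2] : exists2 e, 0 < e & exists C : R, forall i,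
    0 <= C /\ bilip_by nrm (nbd p a e) (nbd q b e) (adist p) (adist q) (fun x w => aff c r i (x + w)) C.
  suff H (s : seq 'I_N) : exists2 e, 0 < e & exists C : R, forall i, i \in s ->
    0 <= C /\ bilip_by nrm (nbd p a e) (nbd q b e) (adist p) (adist q) (fun x w => aff c r i (x + w)) C.
    have [e e0 [C hC]] := H (enum 'I_N); exists e => //; exists C => i; apply: hC.
    by rewrite mem_enum.
  elim: s => [|i s [e e0 [C hC]]]; first by exists 1 => //; exists 0.
  have [e' e'0 be] := regular_bilip (reg i).
  exists (Num.min e e'); first by rewrite lt_min e0 e'0.
  have l1 : Num.min e e' <= e by rewrite ge_min lexx.
  have l2 : Num.min e e' <= e' by rewrite ge_min lexx orbT.
  have [C' hC'] := bilip_at_sub l2 be.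
  have mono (f : A -> A -> K) (D D' : R) e3 : D <= D' ->
     bilip_by nrm (nbd p a e3) (nbd q b e3) (adist p) (adist q) f D ->
     bilip_by nrm (nbd p a e3) (nbd q b e3) (adist p) (adist q) f D'.
    move=> le [D0 b1 b2 b3 b4]; split.
    - exact: le_trans le.
    - by move=> *; apply: le_trans le; exact: b1.
    - move=> *; apply: (le_trans (b2 _ _ _ _ _ _)) => //; apply: ler_wpM2r => //; exact: adist_ge0.
    - move=> *; apply: (le_trans (b3 _ _ _ _ _ _)) => //; apply: ler_wpM2r => //; exact: adist_ge0.
    - move=> *; apply: (le_trans (b4 _ _ _ _ _ _ _ _)) => //.
      by apply: ler_wpM2r; [exact: adist_ge0 | apply: ler_wpM2r => //; exact: adist_ge0].
  exists (Num.max C C') => j; rewrite inE => /orP[/eqP->|js].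
    split; first by rewrite le_max (bl_ge0 hC') orbT.
    by apply: mono hC'; rewrite le_max lexx orbT.
  have [Cp hj] := hC j js; split; first by rewrite le_max Cp.
  apply: (@mono _ C); first by rewrite le_max lexx.
  case: hj => D0 b1 b2 b3 b4; split=> //.
  - by move=> x w /(nbd_sub l1) hx /(nbd_sub l1) hw; exact: b1.
  - by move=> x x' w /(nbd_sub l1) ? /(nbd_sub l1) ? /(nbd_sub l1) ?; exact: b2.
  - by move=> x w w' /(nbd_sub l1) ? /(nbd_sub l1) ? /(nbd_sub l1) ?; exact: b3.
  - by move=> x x' w w' /(nbd_sub l1) ? /(nbd_sub l1) ? /(nbd_sub l1) ? /(nbd_sub l1) ?; exact: b4.
have [C hC] := h2.
pose e := Num.min e1 e2.
have l1 : e <= e1 by rewrite ge_min lexx.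
have l2 : e <= e2 by rewrite ge_min lexx orbT.
exists e; first by rewrite lt_min e10 e20.
exists C; first exact: (hC r).1.
split=> [x w /(nbd_sub l1) hx /(nbd_sub l1) hw|i]; first exact: (h1 x w).
case: (hC i) => _ [D0 b1 b2 b3 b4]; split=> //.
- by move=> x w /(nbd_sub l2) hx /(nbd_sub l2) hw; exact: b1.
- by move=> x x' w /(nbd_sub l2) ? /(nbd_sub l2) ? /(nbd_sub l2) ?; exact: b2.
- by move=> x w w' /(nbd_sub l2) ? /(nbd_sub l2) ? /(nbd_sub l2) ?; exact: b3.
- by move=> x x' w w' /(nbd_sub l2) ? /(nbd_sub l2) ? /(nbd_sub l2) ? /(nbd_sub l2) ?; exact: b4.
Qed.

End TwoPoints.

Definition conv p (x : nat -> A) (a : A) := c a 0 p != 0 /\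
  forall e, 0 < e -> exists n0, forall n, (n0 <= n)%N -> nbd p a e (x n).

Lemma conv_sub p x a phi : increasing_seq phi -> conv p x a -> conv p (x \o phi) a.
Proof.
move=> hp [ap h]; split=> // e /h[n0 hn0]; exists n0 => n le; apply: hn0.
exact: leq_trans le (increasing_seq_ge hp n).
Qed.

Lemma conv_const p a : c a 0 p != 0 -> conv p (fun=> a) a.
Proof. by move=> ap; split=> // e e0; exists 0%N => n _; exact: nbd_self. Qed.

Lemma conv_aff p x a i : conv p x a -> tends nrm (fun n => aff c p i (x n)) (aff c p i a).
Proof.
move=> [_ h] e /h[n0 hn0]; exists n0 => n /hn0[_ lt].
exact: le_lt_trans (adist_coord _ _ _ _) lt.
Qed.

Lemma tends_conv p x a : c a 0 p != 0 -> (forall n, c (x n) 0 p != 0) ->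
  (forall i, tends nrm (fun n => aff c p i (x n)) (aff c p i a)) -> conv p x a.
Proof.
move=> ap xp h; split=> // e e0.
pose e' := e / (N%:R + 1).
have N1 : 0 < (N%:R + 1 : R) by rewrite ltr_wpDl.
have e'0 : 0 < e' by rewrite divr_gt0.
have [f hf] : exists f : 'I_N -> nat, forall i n, (f i <= n)%N -> nrm (aff c p i (x n) - aff c p i a) < e'.
  have ch i := h i e' e'0.
  by exists (fun i => projT1 (cid (ch i))) => i; case: (cid (ch i)).
exists (\max_i f i) => n hmax; split=> //.
apply: (@le_lt_trans _ _ (\sum_(i < N) e')).
  apply: ler_sum => i _; apply: ltW; apply: hf; apply: leq_trans hmax; exact: leq_bigmax.
rewrite sumr_const card_ord -mulr_natl /e' mulrA ltr_pdivrMr // mulrDr mulr1 mulrC.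
by rewrite ltrDl.
Qed.

Lemma aff_cross p q i j (x : A) : aff c p i x * aff c q j x = aff c p j x * aff c q i x.
Proof. by rewrite /aff mulf_div [X in _ = X]mulf_div [c x 0 i * _]mulrC. Qed.

(** Coordinates of one point in two charts are proportional. This is expressed by the identities
    [aff_cross], which pass to the limit and make the two limits proportional. *)
Lemma conv_unique p q x a b : conv p x a -> conv q x b -> a = b.
Proof.
move=> ha hb; have ap := ha.1; have bq := hb.1.
have cross i j : aff c p i a * aff c q j b = aff c p j a * aff c q i b.
  apply: (tends_unique hn (tendsM hn (conv_aff i ha) (conv_aff j hb))).
  have := tendsM hn (conv_aff j ha) (conv_aff i hb).
  by move=> h e /h[n0 hn0]; exists n0 => n /hn0; rewrite aff_cross.
apply: (@av_coord_inj K A a b (aff c q p b * c b 0 q / c a 0 p)); apply/rowP => i.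
rewrite mxE; have := cross i p; rewrite /aff divff // mul1r => e.
have -> : c b 0 i = c b 0 i / c b 0 q * c b 0 q by rewrite divfK.
by rewrite -e; field; rewrite ap bq.
Qed.

Lemma conv_add p q r x w a b : conv p x a -> conv q w b -> c (a + b) 0 r != 0 ->
  conv r (fun n => x n + w n) (a + b).
Proof.
move=> [ap hx] [bq hw] abr; split=> // e e0.
have [e1 e10 [C C0 [nz bl]]] := add_bilip ap bq abr.
pose M := 2 * N%:R * (C + 1).
have M0 : 0 <= M by rewrite !mulr_ge0 // addr_ge0.
pose e2 := Num.min e1 (e / (M + 1)).
have M1 : 0 < M + 1 by rewrite ltr_wpDl.
have e20 : 0 < e2 by rewrite lt_min e10 divr_gt0.
have [n1 h1] := hx e2 e20; have [n2 h2] := hw e2 e20.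
have l1 : e2 <= e1 by rewrite ge_min lexx.
have l2 : e2 <= e / (M + 1) by rewrite ge_min lexx orbT.
exists (maxn n1 n2) => n; rewrite geq_max => /andP[m1 m2].
have k1 := h1 n m1; have k2 := h2 n m2.
have x1 := nbd_sub l1 k1; have w1 := nbd_sub l1 k2.
have a1 := nbd_self ap e10; have b1 := nbd_self bq e10.
split; first exact: nz.
apply: (@le_lt_trans _ _ (\sum_(i < N) (C * e2 + C * e2))).
  apply: ler_sum => i _; case: (bl i) => _ _ b2 b3 _.
  have -> : aff c r i (x n + w n) - aff c r i (a + b) =
    (aff c r i (x n + w n) - aff c r i (a + w n)) + (aff c r i (a + w n) - aff c r i (a + b)) by ring.
  apply: le_trans (nrmD hn _ _) _; apply: lerD.
    apply: le_trans (b2 _ _ _ x1 a1 w1) _; apply: ler_wpM2l => //; exact: ltW k1.2.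
  apply: le_trans (b3 _ _ _ a1 w1 b1) _; apply: ler_wpM2l => //; exact: ltW k2.2.
rewrite sumr_const card_ord -mulr_natl.
apply: (@le_lt_trans _ _ (M * e2)).
  have -> : M * e2 = N%:R * (C * e2 + C * e2) + 2 * N%:R * e2 by rewrite /M; ring.
  by rewrite lerDl !mulr_ge0 // ltW.
apply: (@le_lt_trans _ _ (M * (e / (M + 1)))); first exact: ler_wpM2l.
rewrite mulrA ltr_pdivrMr // mulrC mulrDr mulr1 ltrDl //.
Qed.

Lemma conv_ext p x y a : (forall n, y n = x n) -> conv p x a -> conv p y a.
Proof. by move=> e [ap h]; split=> // d /h[n0 hn0]; exists n0 => n; rewrite e; exact: hn0. Qed.

Lemma conv_add_lim p q r x w a b s : conv p x a -> conv q w b ->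
  conv r (fun n => x n + w n) s -> s = a + b.
Proof.
move=> hx hw hs; have [t ht] := exists_coord (@av_coord_neq0 K A (a + b)).
exact: conv_unique hs (conv_add hx hw ht).
Qed.

(* Normalising by a coordinate of maximal norm makes the others bounded by 1;
   the limit lies on A because A is closed. *)
Theorem sequentially_compact (BW : bolzano_weierstrass nrm) (x : nat -> A) :
  exists2 phi, increasing_seq phi & exists p a, conv p (x \o phi) a.
Proof.
have ch n : exists p, c (x n) 0 p != 0 /\ forall i, nrm (c (x n) 0 i) <= nrm (c (x n) 0 p).
  have [p0 hp0] := exists_coord (@av_coord_neq0 K A (x n)).
  case: (@arg_maxP _ _ _ p0 xpredT (fun i => nrm (c (x n) 0 i)) isT) => p _ hp.
  exists p; split; last by move=> i; exact: hp.
  have := hp p0 isT; apply: contraTneq => ->; rewrite (nrm0 hn) /= leNgt negbK; exact: nrm_gt0.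
pose f n := projT1 (cid (ch n)).
have fP n : c (x n) 0 (f n) != 0 /\ forall i, nrm (c (x n) 0 i) <= nrm (c (x n) 0 (f n)).
  by rewrite /f; case: (cid (ch n)).
have [p [phi hphi hf]] := infinite_pigeonhole f.
have xp n : c (x (phi n)) 0 p != 0 by have := (fP (phi n)).1; rewrite hf.
have bd n i : nrm (aff c p i (x (phi n))) <= 1.
  rewrite /aff (nrmM hn) (nrmV hn) ler_pdivrMr ?mul1r; last exact: nrm_gt0.
  by have := (fP (phi n)).2 i; rewrite hf.
have [psi hpsi [l hl]] := bw_coordinates BW bd.
pose v : 'rV[K]_N := \row_i l i.
have lp : l p = 1.
  apply: (tends_unique hn (hl p)) => e e0; exists 0%N => n _.
  by rewrite /aff divff // subrr (nrm0 hn).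
have lb i : nrm (l i) <= 2.
  have [n0 h0] := hl i 1 ltr01.
  rewrite -(subrK (aff c p i (x (phi (psi n0)))) (l i)).
  apply: le_trans (nrmD hn _ _) _; rewrite (nrmBC hn).
  have := ltW (h0 n0 (leqnn _)); have := bd (psi n0) i; lra.
have v0 : v != 0 by apply/rV0Pn; exists p; rewrite mxE lp oner_neq0.
have [_ _ [S [hS hA]] _] := av_axiom A.
have [a [t et]] : exists a, exists t, v = t *: c a.
  apply/(hA v v0) => F SF; have [d hd] := hS F SF.
  have Fz y : c y 0 p != 0 -> F.@[(aff c p)^~ y] = 0.
    move=> yp; have : form_eval F (c y) = 0.
      by apply: (iffRL (hA _ (av_coord_neq0 y))) => //; exists y, 1; rewrite scale1r.
    rewrite (form_eval_aff hd yp) => /eqP; rewrite mulf_eq0 expf_eq0 (negbTE yp) andbF.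
    by move/eqP.
  have -> : form_eval F v = F.@[l] by apply: meval_eq => i; rewrite mxE.
  have [|C [C0 _ lip]] := @meval_lipschitz _ _ _ hn _ F (fun v => forall i, nrm (v i) <= 2) 2.
    by [].
  apply: (nrm_small hn) => e e0.
  pose e' := e / ((C + 1) * (N%:R + 1)).
  have N1 : 0 < (N%:R + 1 : R) by rewrite ltr_wpDl.
  have C1 : 0 < C + 1 by rewrite ltr_wpDl.
  have e'0 : 0 < e' by rewrite divr_gt0 // mulr_gt0.
  have [g hg] : exists g : 'I_N -> nat, forall i n, (g i <= n)%N ->
      nrm (aff c p i (x (phi (psi n))) - l i) < e'.
    have ch' i := hl i e' e'0.
    by exists (fun i => projT1 (cid (ch' i))) => i; case: (cid (ch' i)).
  pose n := \max_i g i; pose w i := aff c p i (x (phi (psi n))).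
  have Fw : F.@[w] = 0 by exact: (Fz (x (phi (psi n)))).
  have bw i : nrm (w i) <= 2 by apply: le_trans (bd _ _) _; lra.
  have := lip l w lb bw; rewrite Fw subr0 => h; apply: le_lt_trans h _.
  apply: (@le_lt_trans _ _ (C * (N%:R * e'))).
    apply: ler_wpM2l => //; rewrite /dist1.
    apply: (@le_trans _ _ (\sum_(i < N) e')).
      apply: ler_sum => i _; rewrite (nrmBC hn); apply: ltW; apply: hg; exact: leq_bigmax.
    by rewrite sumr_const card_ord mulr_natl.
  have -> : C * (N%:R * e') = e * ((C * N%:R) / ((C + 1) * (N%:R + 1))).
    by rewrite /e'; field; rewrite !lt0r_neq0.
  rewrite gtr_pMr // ltr_pdivrMr ?mulr_gt0 // mul1r.
  have NN : 0 <= N%:R :> R by [].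
  nra.
have vi i : l i = t * c a 0 i by have := congr1 (fun u : 'rV_N => u 0 i) et; rewrite !mxE.
have ap : c a 0 p != 0.
  by apply: contra_eq_neq lp => e; rewrite vi e mulr0 eq_sym oner_neq0.
exists (phi \o psi); first exact: increasing_seq_comp.
exists p, a; apply: tends_conv => // [n|i]; first exact: xp.
have -> : aff c p i a = l i.
  have tp : t * c a 0 p = 1 by rewrite -vi.
  by rewrite /aff vi; apply: (mulIf ap); rewrite divfK // mulrAC tp mul1r.
exact: hl.
Qed.

End LocalAnalysis.

(** * Halving, covering and counting torsion *)

Section Growth.

Variables (R : realType) (K : closedFieldType) (nrm : K -> R).
Hypothesis hn : is_norm nrm.
Hypothesis BW : bolzano_weierstrass nrm.
Variable A : abelianVariety K.
Notation c := (@av_coord K A).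
Notation N := (@av_size K A).
Notation adist := (adist nrm (A := A)).
Notation nbd := (nbd nrm (A := A)).
Notation conv := (conv nrm (A := A)).

Variable o : 'I_N.
Hypothesis o0 : c 0 0 o != 0.

Lemma invr_small (e : R) : 0 < e -> exists n0, forall n, (n0 <= n)%N -> n.+1%:R^-1 < e.
Proof.
move=> e0; exists (Num.bound e^-1) => n le.
have h : e^-1 < n.+1%:R.
  apply: (@lt_trans _ _ (Num.bound e^-1)%:R); last by rewrite ltr_nat ltnS.
  by apply: archi_boundP; rewrite invr_ge0 ltW.
by rewrite invf_plt ?posrE.
Qed.

Lemma shrinking_conv x : (forall n, nbd o 0 n.+1%:R^-1 (x n)) -> conv o x 0.
Proof.
move=> h; split=> // e /invr_small[n0 h0]; exists n0 => n /h0 lt.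
by apply: nbd_sub (h n); exact: ltW.
Qed.

(** The mixed difference of addition between 0 and [x] in both variables compares [x + x] with twice
    [x]. It is quadratic in the distance, hence at most [2 - theta] times it near 0. *)
Lemma double_expand (theta : R) : theta < 2 -> exists2 d, 0 < d &
  forall x, nbd o 0 d x -> theta * adist o x 0 <= adist o (x + x) 0.
Proof.
move=> t2; have oo : c (0 + 0 : A) 0 o != 0 by rewrite addr0.
have [e e0 [C C0 [_ bl]]] := add_bilip hn o0 o0 oo.
pose D := N%:R * C + 1.
have D0 : 0 < D by rewrite ltr_wpDl // mulr_ge0.
pose d := Num.min e ((2 - theta) / D).
have l1 : d <= e by rewrite ge_min lexx.
have l2 : d <= (2 - theta) / D by rewrite ge_min lexx orbT.
exists d; first by rewrite lt_min e0 divr_gt0 // subr_gt0.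
move=> x hx; have xe := nbd_sub l1 hx; have z0 := nbd_self hn o0 e0.
set v := adist o x 0.
have v0 : 0 <= v by exact: adist_ge0.
have main : 2 * v - N%:R * (C * v * v) <= adist o (x + x) 0.
  have -> : 2 * v - N%:R * (C * v * v) = \sum_(i < N) (2 * nrm (aff c o i x - aff c o i 0) - C * v * v).
    by rewrite sumrB -mulr_sumr sumr_const card_ord [N%:R * _]mulr_natl.
  apply: ler_sum => i _; case: (bl i) => _ _ _ _ b4.
  have := b4 _ _ _ _ xe z0 xe z0; rewrite !addr0 !add0r -/v => h.
  have -> : 2 * nrm (aff c o i x - aff c o i 0) = nrm (2%:R * (aff c o i x - aff c o i 0)).
    by rewrite (nrmM hn) (nrm_nat hn).
  have -> : 2%:R * (aff c o i x - aff c o i 0) = (aff c o i (x + x) - aff c o i 0)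
    - (aff c o i (x + x) - aff c o i x - aff c o i x + aff c o i 0) by ring.
  have := nrmB hn (aff c o i (x + x) - aff c o i 0)
    (aff c o i (x + x) - aff c o i x - aff c o i x + aff c o i 0).
  move: h; lra.
apply: le_trans main; rewrite -subr_ge0.
have -> : 2 * v - N%:R * (C * v * v) - theta * v = v * ((2 - theta) - N%:R * C * v) by ring.
apply: mulr_ge0 => //; rewrite subr_ge0.
have vd : v <= (2 - theta) / D by apply: le_trans l2; apply: ltW; exact: hx.2.
apply: (@le_trans _ _ (D * v)); first by rewrite /D mulrDl mul1r lerDl.
by rewrite mulrC -ler_pdivlMr.
Qed.

Section Halving.

Hypothesis surj2 : forall y : A, exists x, y = x *+ 2.

(* If z_n -> 0 and x_n + x_n = z_n, a limit a of the x_n satisfies a + a = 0,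
   so x_n - a is a half of z_n tending to 0. *)
Lemma small_half (d : R) : 0 < d -> exists2 r, 0 < r &
  forall z, nbd o 0 r z -> exists2 w, nbd o 0 d w & w + w = z.
Proof.
move=> d0; apply: contrapT => /forall2NP h.
have ch n : exists z, nbd o 0 n.+1%:R^-1 z /\ forall w, nbd o 0 d w -> w + w <> z.
  case: (h n.+1%:R^-1) => [|/existsNP[z /not_implyP[hz /forall2NP hw]]].
    by move=> H; case: H; rewrite invr_gt0.
  by exists z; split=> // w hw' e; case: (hw w).
pose z n := projT1 (cid (ch n)).
have zP n : nbd o 0 n.+1%:R^-1 (z n) /\ forall w, nbd o 0 d w -> w + w <> z n.
  by rewrite /z; case: (cid _).
pose x n := projT1 (cid (surj2 (z n))).
have xP n : x n + x n = z n by rewrite /x; case: (cid _) => y /= ->; rewrite mulr2n.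
have [phi hphi [p [a ha]]] := sequentially_compact hn BW x.
have hz : conv o (z \o phi) 0.
  by apply: conv_sub => //; apply: shrinking_conv => n; exact: (zP n).1.
have aa : 0 = a + a.
  apply: (conv_add_lim hn ha ha); apply: conv_ext hz => n; exact: xP.
have [q q0] := exists_coord (@av_coord_neq0 K A (- a)).
have := conv_add hn ha (conv_const hn q0) (r := o); rewrite subrr => /(_ o0)[_ /(_ d d0)[n0 h0]].
have := h0 n0 (leqnn _) => hw; apply: ((zP (phi n0)).2 _ hw).
by rewrite addrACA -opprD -aa oppr0 addr0; exact: xP.
Qed.

(** Since [theta > 1], halves of points near 0 are nearer to 0, so halving repeats inside one
    neighbourhood and gains a factor [theta] each time. *)
Lemma iterated_half (theta : R) : 1 < theta -> theta < 2 -> forall r0, 0 < r0 -> exists r, [/\ 0 < r, r <= r0 &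
  forall j z, nbd o 0 r z -> exists w, [/\ nbd o 0 r w, w *+ (2 ^ j) = z &
    adist o w 0 * theta ^+ j <= r]].
Proof.
move=> t1 t2 r0 r00.
have [d d0 hd] := double_expand t2.
have [r1 r10 hr1] := small_half d0.
pose r := Num.min r0 r1; exists r.
have l0 : r <= r0 by rewrite ge_min lexx.
have l1 : r <= r1 by rewrite ge_min lexx orbT.
have r0' : 0 < r by rewrite lt_min r00 r10.
split=> // j z hz.
suff [w [hw e le]] : exists w, [/\ nbd o 0 r w, w *+ (2 ^ j) = z & adist o w 0 * theta ^+ j <= adist o z 0].
  by exists w; split=> //; apply: le_trans le _; apply: ltW; exact: hz.2.
elim: j => [|j [w [hw e le]]]; first by exists z; rewrite expn0 mulr1n expr0 mulr1.
have [w' hw' e'] := hr1 w (nbd_sub l1 hw).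
have := hd w' hw'; rewrite e' => ex.
have w'0 := adist_ge0 hn o w' 0.
exists w'; split.
- split; first exact: hw'.1.
  apply: le_lt_trans hw.2; apply: le_trans ex; rewrite ler_peMl //; exact: ltW.
- by rewrite expnS mulrnA mulr2n e'.
apply: le_trans le; rewrite exprS mulrA; apply: ler_wpM2r; last by rewrite mulrC.
by apply: exprn_ge0; lra.
Qed.

End Halving.

(** A greedy choice would give a separated sequence. By compactness its terms and their opposites
    converge along a common subsequence, and the differences of consecutive terms tend to 0. *)
Lemma finite_cover (r : R) : 0 < r -> exists ss : seq A, forall x, exists2 s, s \in ss & nbd o 0 r (x - s).
Proof.
move=> r0; apply: contrapT => /forallNP h.
have ch (ss : seq A) : exists x, forall s, s \in ss -> ~ nbd o 0 r (x - s).
  have /existsNP[x /forall2NP hx] := h ss; exists x => s hs hr.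
  by case: (hx s).
pose nx ss := projT1 (cid (ch ss)).
have nxP ss s : s \in ss -> ~ nbd o 0 r (nx ss - s) by rewrite /nx; case: (cid _) => x /= H; exact: H.
pose L n := iter n (fun l => nx l :: l) [::].
pose x n := nx (L n).
have sep m n : (m < n)%N -> ~ nbd o 0 r (x n - x m).
  move=> lt; apply: nxP; elim: n lt => // n IH; rewrite ltnS leq_eqVlt inE => /orP[/eqP->|/IH->].
    by rewrite eqxx.
  by rewrite orbT.
have [phi hphi [p [a ha]]] := sequentially_compact hn BW x.
have [psi hpsi [q [b hb]]] := sequentially_compact hn BW (fun n => - x (phi n)).
have ab : 0 = a + b.
  apply: (conv_add_lim hn (conv_sub hpsi ha) hb (r := o)).
  by apply: conv_ext (conv_const hn o0) => n /=; rewrite subrr.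
have hS : increasing_seq (fun n => (psi n).+1) by move=> n; rewrite ltnS; exact: hpsi.
have := conv_add hn (conv_sub hS ha) hb (r := o); rewrite -ab => /(_ o0)[_ /(_ r r0)[n0 h0]].
by apply: sep (h0 n0 (leqnn _)); exact: hphi.
Qed.

(** By compactness: in a sequence of counterexamples the base points converge to some [b], and the
    local estimate for addition at [(b, 0)] contradicts the growing constants. *)
Lemma uniform_lipschitz p (C : R) : exists L rho, [/\ 0 <= L, 0 < rho &
  forall b w w', nbd o 0 rho w -> nbd o 0 rho w' ->
    c (b + w) 0 p != 0 -> (forall j, nrm (aff c p j (b + w)) <= C) ->
    adist p (b + w) (b + w') <= L * adist o w w'].
Proof.
apply: contrapT => h.
have ch n : exists t : A * A * A, [/\ nbd o 0 n.+1%:R^-1 t.1.2, nbd o 0 n.+1%:R^-1 t.2,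
    c (t.1.1 + t.1.2) 0 p != 0, (forall j, nrm (aff c p j (t.1.1 + t.1.2)) <= C) &
    n%:R * adist o t.1.2 t.2 < adist p (t.1.1 + t.1.2) (t.1.1 + t.2)].
  apply: contrapT => /forallNP H; apply: h; exists n%:R, n.+1%:R^-1; split; rewrite ?invr_gt0 //.
  move=> b w w' hw hw' bw hC; rewrite leNgt; apply/negP => lt.
  by apply: (H (b, w, w')).
pose t n := projT1 (cid (ch n)).
have tP n : [/\ nbd o 0 n.+1%:R^-1 (t n).1.2, nbd o 0 n.+1%:R^-1 (t n).2,
    c ((t n).1.1 + (t n).1.2) 0 p != 0, (forall j, nrm (aff c p j ((t n).1.1 + (t n).1.2)) <= C) &
    n%:R * adist o (t n).1.2 (t n).2 < adist p ((t n).1.1 + (t n).1.2) ((t n).1.1 + (t n).2)].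
  by rewrite /t; case: (cid _).
have [phi hphi [q [b hb]]] := sequentially_compact hn BW (fun n => (t n).1.1).
have hw : conv o (fun n => (t (phi n)).1.2) 0.
  apply: (@conv_sub _ _ _ _ o (fun n => (t n).1.2)) => //; apply: shrinking_conv => n.
  by case: (tP n).
have hw' : conv o (fun n => (t (phi n)).2) 0.
  apply: (@conv_sub _ _ _ _ o (fun n => (t n).2)) => //; apply: shrinking_conv => n.
  by case: (tP n).
have bq := hb.1.
have hbw : conv q (fun n => (t (phi n)).1.1 + (t (phi n)).1.2) b.
  have := conv_add hn hb hw (r := q); rewrite addr0; exact.
have bp : c b 0 p != 0.
  (* The limit stays in the chart [p]: the ratio of coordinate [q] to coordinate [p] is bounded by
     [C], while its inverse would tend to 0. *)
  apply/negP => /eqP bp.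
  pose C1 := 1 + `|C|.
  have C10 : 0 < C1 by rewrite ltr_pwDl.
  have [|n0 h0] := conv_aff hn p hbw (e := C1^-1); first by rewrite invr_gt0.
  have [n1 h1] := hbw.2 1 ltr01.
  pose n := maxn n0 n1.
  have := h0 n (leq_maxl _ _); rewrite [aff c q p b]/aff bp mul0r subr0.
  have [xq _] := h1 n (leq_maxr _ _); move: xq.
  have [_ _ xp hC _] := tP (phi n).
  set x := _ + _ in xp hC * => xq.
  have one : aff c p q x * aff c q p x = 1 by rewrite /aff; field; rewrite xp xq.
  have := congr1 nrm one; rewrite (nrmM hn) (nrm1 hn) => e1 lt.
  have := nrm_ge0 hn (aff c q p x); have := hC q.
  have := ler_norm C; have := normr_ge0 C.
  move: lt; rewrite -[_ < _^-1](ltr_pM2l C10) divff ?lt0r_neq0 // /C1.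
  nra.
have bop : c (b + 0) 0 p != 0 by rewrite addr0.
have [e e0 [D D0 [nz bl]]] := add_bilip hn bq o0 bop.
have [n1 h1] := hb.2 e e0; have [n2 h2] := hw.2 e e0; have [n3 h3] := hw'.2 e e0.
pose n := maxn (Num.bound (N%:R * D)) (maxn n1 (maxn n2 n3)).
have : [/\ (Num.bound (N%:R * D) <= n)%N, (n1 <= n)%N, (n2 <= n)%N & (n3 <= n)%N].
  by split; rewrite /n !leq_max leqnn ?orbT.
move=> [m0 m1 m2 m3].
have [_ _ _ _ lt] := tP (phi n).
move: lt; apply/negP; rewrite -leNgt.
set w := (t _).1.2; set w' := (t _).2; set b' := (t _).1.1.
apply: (@le_trans _ _ (N%:R * D * adist o w w')).
  have -> : N%:R * D * adist o w w' = \sum_(i < N) (D * adist o w w').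
    by rewrite sumr_const card_ord -mulrA mulr_natl.
  apply: ler_sum => i _; case: (bl i) => _ _ _ b3 _.
  by apply: b3; [exact: h1 | exact: h2 | exact: h3].
apply: ler_wpM2r; first exact: adist_ge0.
apply: (@le_trans _ _ (Num.bound (N%:R * D))%:R); first by apply: ltW; apply: archi_boundP; rewrite mulr_ge0.
by rewrite ler_nat; apply: leq_trans m0 _; exact: increasing_seq_ge.
Qed.

End Growth.

Section Count.

Variables (R : realType) (K : closedFieldType) (nrm : K -> R).
Hypothesis hn : is_norm nrm.
Hypothesis BW : bolzano_weierstrass nrm.
(** [I] stands for the imaginary unit. The Gaussian integers are separated by 1 and supply
    [(n + 1)^2] grid points per coordinate, which is why the count reaches the exponent [2 g]. *)
Variable I : K.
Hypothesis I1 : nrm I <= 1.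
Hypothesis lattice : forall k l : int, (k, l) != (0, 0) -> 1 <= nrm (k%:~R + l%:~R * I).
Variable A : abelianVariety K.
Notation c := (@av_coord K A).
Notation N := (@av_size K A).
Notation adist := (adist nrm (A := A)).
Notation nbd := (nbd nrm (A := A)).
Variables (g : nat) (ker : seq A).
Hypothesis dimA : has_dim c g.
Hypothesis kerP : forall z, (z \in ker) = (z *+ 2 == 0).

Lemma surj_pow2 j (y : A) : exists x, x *+ (2 ^ j) = y.
Proof.
elim: j => [|j [x <-]]; first by exists y; rewrite expn0 mulr1n.
have [z ->] := multiplication_surjective hn dimA kerP x.
by exists z; rewrite expnS mulrnA.
Qed.

(* Halving j times shows that A is covered by |ss| * #A[2^j] translates of
   neighbourhoods of size r / theta^j, while the lift of a polydisc contains
   (n + 1)^(2g) points at mutual distance of order 1 / n. *)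
Lemma torsion_count (theta : R) : 1 < theta -> theta < 2 -> exists (G : R) (P : nat), 0 < G /\
  forall j n, n.+1%:R * G < theta ^+ j -> ((n.+1 ^ 2) ^ g <= P * size ker ^ j)%N.
Proof.
move=> t1 t2.
have [F [p [y0 [rho [C [rho0 hF]]]]]] := polydisc_lift hn dimA.
have [Lam Lam0 hLam] : exists2 Lam : R, 0 <= Lam & forall i (v w : 'I_N -> K),
    (forall j, nrm (v j) <= C) -> (forall j, nrm (w j) <= C) ->
    nrm ((F i).@[v] - (F i).@[w]) <= Lam * dist1 nrm v w.
  have ch i := @meval_lipschitz _ _ _ hn _ (F i) (fun v => forall j, nrm (v j) <= C) C (fun v h => h).
  pose f i := projT1 (cid (ch i)).
  have fP i : 0 <= f i /\ forall v w : 'I_N -> K,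
    (forall j, nrm (v j) <= C) -> (forall j, nrm (w j) <= C) ->
    nrm ((F i).@[v] - (F i).@[w]) <= f i * dist1 nrm v w.
    by rewrite /f; case: (cid _) => x [].
  exists (\sum_i f i); first by apply: sumr_ge0 => i _; case: (fP i).
  move=> i v w hv hw; apply: le_trans ((fP i).2 v w hv hw) _; apply: ler_wpM2r; first exact: dist1_ge0.
  rewrite (bigD1 i) //= lerDl; apply: sumr_ge0 => k _; exact: (fP k).1.
have [o o0] := exists_coord (@av_coord_neq0 K A 0).
have [L [rhod [L0 rhod0 hL]]] := uniform_lipschitz hn BW o0 p C.
have surj2 (y : A) : exists x, y = x *+ 2 := multiplication_surjective hn dimA kerP y.
have [r [r0 rd hr]] := iterated_half hn BW o0 surj2 t1 t2 rhod0.
have [ss hss] := finite_cover hn BW o0 r0.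
(* The grid of mesh [1 / ((n + 1) M)] moves each coordinate by at most [2 / M], so it fits into the
   polydisc of radius [rho]. *)
pose M := (Num.bound (2 * g%:R / rho)).+1.
have hM : 2 * g%:R / rho <= M%:R.
  apply: (@le_trans _ _ (Num.bound (2 * g%:R / rho))%:R); last by rewrite ler_nat.
  by apply: ltW; apply: archi_boundP; rewrite divr_ge0 ?mulr_ge0 // ltW.
have M0 : 0 < M%:R :> R by rewrite ltr0n.
(* If two grid points shared a translate, separation, [Lam], [L] and the two radii [r / theta^j]
   would give [theta^j <= (n + 1) M Lam L 2 r]. The added 1 keeps the constant positive. *)
exists (M%:R * Lam * L * 2 * r + 1), (size ss); split.
  by rewrite ltr_wpDl // !mulr_ge0 // ltW.
move=> j n hj.
have [T [sT hT]] := kernel_power kerP j.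
apply: (@leq_trans (size ss * size T)); last by rewrite leq_mul2l sT orbT.
pose h s := projT1 (cid (surj_pow2 j s)).
have hP s : h s *+ (2 ^ j) = s by rewrite /h; case: (cid _).
pose E := {ffun 'I_g -> 'I_n.+1 * 'I_n.+1}.
pose Q : K := (n.+1 * M)%:R.
have nQ : nrm Q = n.+1%:R * M%:R by rewrite /Q (nrm_nat hn) natrM.
pose pt (u : 'I_n.+1 * 'I_n.+1) : K := u.1%:R + u.2%:R * I.
pose y (e : E) i := y0 i + pt (e i) / Q.
have hy e : dist1 nrm (y e) y0 <= rho.
  apply: (@le_trans _ _ (\sum_(i < g) (2 / M%:R))).
    apply: ler_sum => i _; rewrite /y addrAC subrr add0r (nrmM hn) (nrmV hn) nQ.
    rewrite invfM mulrA; apply: ler_wpM2r; first by rewrite invr_ge0 ltW.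
    rewrite ler_pdivrMr ?ltr0n //; apply: le_trans (nrmD hn _ _) _.
    rewrite (nrmM hn) !(nrm_nat hn).
    have b1 : ((e i).1%:R : R) <= n.+1%:R by rewrite ler_nat ltnW.
    have b2 : ((e i).2%:R : R) * nrm I <= n.+1%:R.
      apply: (@le_trans _ _ ((e i).2%:R)); first by rewrite ler_piMr.
      by rewrite ler_nat ltnW.
    by move: b1 b2; lra.
  rewrite sumr_const card_ord -[_ *+ g]mulr_natr mulrAC ler_pdivrMr //.
  by rewrite [rho * _]mulrC -ler_pdivrMr.
pose a e := projT1 (cid (hF (y e) (hy e))).
have aP e : [/\ c (a e) 0 p != 0, forall i, (F i).@[(aff c p)^~ (a e)] = y e i &
    forall j, nrm (aff c p j (a e)) <= C] by rewrite /a; case: (cid _).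
have dec e : exists st : A * A, exists w, [/\ st.1 \in ss, st.2 \in T, nbd o 0 r w,
    adist o w 0 * theta ^+ j <= r & a e = h st.1 + st.2 + w].
  have [s sss hs] := hss (a e *+ (2 ^ j)).
  have [w [hw ew hV]] := hr j _ hs.
  exists (s, a e - h s - w), w; split=> //=; last by rewrite -addrA subrK addrC subrK.
  by apply: hT; rewrite !mulrnBl hP ew subrr.
pose f e := projT1 (cid (dec e)).
have fP e : exists w, [/\ (f e).1 \in ss, (f e).2 \in T, nbd o 0 r w,
    adist o w 0 * theta ^+ j <= r & a e = h (f e).1 + (f e).2 + w].
  by rewrite /f; case: (cid _).
have finj : injective f.
  move=> e e' ee; apply/ffunP => i; apply/eqP; apply: contraT => ne.
  have [w [_ _ hw Vw ew]] := fP e; have [w' [_ _ hw' Vw' ew']] := fP e'.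
  have [ap Fe be] := aP e; have [ap' Fe' be'] := aP e'.
  have d1 := hLam i _ _ be be'; rewrite Fe Fe' in d1.
  have d2 : adist p (a e) (a e') <= L * adist o w w'.
    rewrite ew in ap be *; rewrite ew' -ee; apply: hL => //; exact: nbd_sub rd _.
  have d3 := adist_triangle hn o w 0 w'; rewrite (adistC hn o 0) in d3.
  have d4 : 1 <= n.+1%:R * M%:R * nrm (y e i - y e' i).
    rewrite -nQ -(nrmM hn) /y.
    have Q0 : Q != 0.
      by apply/eqP => q; move: nQ; rewrite q (nrm0 hn) => /esym/eqP; rewrite mulf_eq0 pnatr_eq0 (gt_eqF M0).
    have -> : Q * (y0 i + pt (e i) / Q - (y0 i + pt (e' i) / Q)) = pt (e i) - pt (e' i).
      by rewrite opprD addrACA subrr add0r -mulrBl mulrC divfK.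
    have -> : pt (e i) - pt (e' i) = ((e i).1%:Z - (e' i).1%:Z)%:~R + ((e i).2%:Z - (e' i).2%:Z)%:~R * I.
      by rewrite /pt !intrB; ring.
    apply: lattice; apply: contra_neqN ne => /eqP[/eqP]; rewrite subr_eq0 => /eqP[h1] /eqP.
    rewrite subr_eq0 => /eqP[h2]; apply/eqP; move: (e i) (e' i) h1 h2 => [k l] [k' l'] /= h1 h2.
    by rewrite (val_inj h1) (val_inj h2).
  have Tj : 0 < theta ^+ j by apply: exprn_gt0; lra.
  have nM0 : 0 <= n.+1%:R * M%:R :> R by rewrite mulr_ge0.
  have d5 : nrm (y e i - y e' i) <= Lam * (L * (adist o w 0 + adist o w' 0)).
    apply: le_trans d1 _; apply: ler_wpM2l => //; apply: le_trans d2 _; exact: ler_wpM2l.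
  have d6 : theta ^+ j <= n.+1%:R * M%:R * (Lam * (L * (r + r))).
    apply: (@le_trans _ _ (theta ^+ j * (n.+1%:R * M%:R * nrm (y e i - y e' i)))).
      by rewrite ler_peMr // ltW.
    rewrite mulrCA; apply: ler_wpM2l => //.
    apply: (@le_trans _ _ (theta ^+ j * (Lam * (L * (adist o w 0 + adist o w' 0))))).
      by apply: ler_wpM2l => //; exact: ltW.
    rewrite mulrCA [theta ^+ j * (L * _)]mulrCA; do 2!apply: ler_wpM2l => //.
    by rewrite mulrC mulrDl; exact: lerD.
  exfalso.
  have n0 : 0 <= n.+1%:R :> R by [].
  have e7 : n.+1%:R * (M%:R * Lam * L * 2 * r + 1) = n.+1%:R * M%:R * (Lam * (L * (r + r))) + n.+1%:R by ring.
  move: d6 hj; rewrite e7; lra.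
have -> : ((n.+1 ^ 2) ^ g = size (map f (enum {: E})))%N.
  by rewrite size_map -cardE card_ffun card_prod !card_ord.
rewrite -(size_allpairs pair); apply: uniq_leq_size.
  by rewrite map_inj_uniq // enum_uniq.
move=> z /mapP[e _ ->]; have [w [h1 h2 _ _ _]] := fP e.
by apply/allpairsP; exists (f e); rewrite h1 h2; case: (f e).
Qed.

Lemma bernoulli_ineq (x : R) n : -1 <= x -> 1 + n%:R * x <= (1 + x) ^+ n.
Proof.
move=> hx; elim: n => [|n IH]; first by rewrite mul0r addr0.
rewrite exprS; have x1 : 0 <= 1 + x by lra.
apply: le_trans (ler_wpM2l x1 IH); rewrite -subr_ge0.
have -> : (1 + x) * (1 + n%:R * x) - (1 + n.+1%:R * x) = n%:R * x ^+ 2 by rewrite -natr1; ring.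
by rewrite mulr_ge0 // sqr_ge0.
Qed.

Lemma exp_unbounded (q B : R) : 1 < q -> exists j, B < q ^+ j.
Proof.
move=> q1; exists (Num.bound (`|B| / (q - 1))).
set j := Num.bound _.
have q0 : 0 < q - 1 by rewrite subr_gt0.
have h : `|B| / (q - 1) < j%:R by apply: archi_boundP; rewrite divr_ge0 // ltW.
have := @bernoulli_ineq (q - 1) j; rewrite [1 + (q - 1)]addrC subrK => h2.
apply: lt_le_trans (h2 _); last by lra.
move: h; rewrite ltr_pdivrMr //; have := ler_norm B; lra.
Qed.

(** If the kernel had fewer than [4^g] elements, some [theta < 2] would have [theta^(2 g)] above its
    order. The count with [n] of order [theta^j / G] then bounds the powers of a number [q > 1]. *)
Theorem torsion_lower_bound : (4 ^ g <= size ker)%N.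
Proof.
rewrite leqNgt; apply/negP => small.
have n0 : (0 < size ker)%N.
  have : 0 \in ker by rewrite kerP mul0rn.
  by case: (ker).
pose S : R := (size ker)%:R; have S0 : 0 < S by rewrite ltr0n.
pose W : R := 4 ^+ g; have W1 : 1 <= W by rewrite exprn_ege1 // ler1n.
have SW : S + 1 <= W by rewrite /S /W natr1 -natrX ler_nat.
(* Bernoulli's inequality gives [theta^(2 g) >= W (1 - 2 g eps) > W - 1 / 2], which exceeds
   [S <= W - 1]. *)
pose eps : R := (4 * g.+1%:R * W)^-1.
have g1 : 1 <= g.+1%:R :> R by rewrite ler1n.
have gW : 1 <= g.+1%:R * W by rewrite mulr_ege1.
have eps0 : 0 < eps by rewrite invr_gt0 -mulrA mulr_gt0 //; lra.
have epsE : 4 * eps * (g.+1%:R * W) = 1 by rewrite /eps; field; rewrite !lt0r_neq0 //; lra.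
have eps1 : eps <= 1 / 4 by nra.
pose theta := 2 * (1 - eps).
have t1 : 1 < theta by rewrite /theta; lra.
have t2 : theta < 2 by rewrite /theta; lra.
have tS : S < (theta ^+ 2) ^+ g.
  have -> : (theta ^+ 2) ^+ g = W * (1 + - eps) ^+ (2 * g).
    by rewrite /theta /W exprM -exprMn; congr (_ ^+ _); ring.
  have := @bernoulli_ineq (- eps) (2 * g); rewrite natrM => h.
  have {}h : 1 + 2 * g%:R * - eps <= (1 + - eps) ^+ (2 * g) by apply: h; lra.
  have h' := ler_wpM2l (ltW (lt_le_trans ltr01 W1)) h.
  apply: lt_le_trans h'; move: epsE; rewrite -natr1 => epsE.
  have W0 : 0 < eps * W by rewrite mulr_gt0 //; lra.
  nra.
have [G [P [G0 hP]]] := torsion_count t1 t2.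
pose q := (theta ^+ 2) ^+ g / S.
have q1 : 1 < q by rewrite ltr_pdivlMr // mul1r.
have [j] := exp_unbounded (((3 * G) ^+ 2) ^+ g * (P.+1)%:R) q1.
apply/negP; rewrite -leNgt /q expr_div_n ler_pdivrMr ?exprn_gt0 //.
pose t := theta ^+ j / G.
have t0 : 0 <= t by apply: divr_ge0; [apply: exprn_ge0; lra | exact: ltW].
have tG : theta ^+ j = t * G by rewrite divfK // lt0r_neq0.
have -> : ((theta ^+ 2) ^+ g) ^+ j = (t ^+ 2) ^+ g * (G ^+ 2) ^+ g.
  by rewrite -!exprMn -tG -!exprM mulnA mulnC.
have -> : ((3 * G) ^+ 2) ^+ g * P.+1%:R * S ^+ j = ((3 ^+ 2) ^+ g * (P.+1%:R * S ^+ j)) * (G ^+ 2) ^+ g.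
  by rewrite !exprMn; ring.
apply: ler_wpM2r; first by do 2!apply: exprn_ge0; exact: ltW.
have Sj : 1 <= S ^+ j by rewrite exprn_ege1 // ler1n.
have [lo hi] := andP (truncn_itv t0).
have t3 : t <= 3 -> (t ^+ 2) ^+ g <= (3 ^+ 2) ^+ g * (P.+1%:R * S ^+ j).
  move=> h; apply: (@le_trans _ _ ((3 ^+ 2) ^+ g)).
    by apply: lerXn2r; rewrite ?nnegrE ?exprn_ge0 //; apply: lerXn2r; rewrite ?nnegrE.
  by rewrite ler_peMr ?exprn_ge0 // mulr_ege1 // ler1n.
(* With [n + 2] the integer part of [t], the count applies to [n], and [t < n + 3 <= 3 (n + 1)]
   explains the constant 3. If the integer part is 0 or 1, then [t <= 3]. *)
case: (Num.truncn t) lo hi => [|[|n]] lo hi; [apply: t3; lra | apply: t3; lra |].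
have /hP : n.+1%:R * G < theta ^+ j.
  by rewrite tG ltr_pM2r //; apply: lt_le_trans lo; rewrite ltr_nat.
rewrite -(ler_nat R) natrM !natrX -/S => le.
have tn : t <= 3 * n.+1%:R.
  by move: hi; rewrite -!natr1; have : 0 <= n%:R :> R by []; lra.
apply: (@le_trans _ _ (((3 * n.+1%:R) ^+ 2) ^+ g)).
  have n3 : 0 <= 3 * n.+1%:R :> R by rewrite mulr_ge0.
  by apply: lerXn2r; rewrite ?nnegrE ?exprn_ge0 //; apply: lerXn2r.
rewrite (@exprMn _ 2 3) (@exprMn _ g (3 ^+ 2)); apply: ler_wpM2l; first by do 2!apply: exprn_ge0.
apply: le_trans le _; apply: ler_wpM2r; first by lra.
by rewrite ler_nat.
Qed.

End Count.

(** * The absolute value of complex numbers *)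

Section ComplexNorm.

Variable R : realType.

Lemma normc_is_norm : is_norm (@Normc.normc R).
Proof.
split.
- by case=> a b; exact: sqrtr_ge0.
- exact: Normc.eq0_normc.
- exact: le_normcD.
- exact: Normc.normcM.
- by move=> n; rewrite (@normcMn R (1 : R[i])) Normc.normc1.
Qed.

Lemma normc_le_sum (z : R[i]) : Normc.normc z <= `|complex.Re z| + `|complex.Im z|.
Proof.
case: z => a b; rewrite [Normc.normc _]/= [complex.Re _]/= [complex.Im _]/= -[`|a| + `|b|]ger0_norm ?addr_ge0 // -sqrtr_sqr ler_sqrt ?sqr_ge0 //.
by rewrite sqrrD !real_normK ?num_real // addrAC lerDl mulrn_wge0 // mulr_ge0.
Qed.

Lemma coord_le_normc (z : R[i]) : `|complex.Re z| <= Normc.normc z /\ `|complex.Im z| <= Normc.normc z.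
Proof.
by case: z => a b /=; rewrite -!sqrtr_sqr !ler_sqrt ?addr_ge0 ?sqr_ge0 // lerDl lerDr !sqr_ge0.
Qed.

(** The limit is the limit superior: [S] collects the numbers that the sequence reaches or exceeds
    infinitely often. *)
Lemma real_bolzano_weierstrass (u : nat -> R) (B : R) : (forall n, `|u n| <= B) ->
  exists2 phi, increasing_seq phi & exists l, tends (fun x => `|x|) (u \o phi) l.
Proof.
move=> hB.
pose S : set R := fun x => forall n0, exists2 n, (n0 <= n)%N & x <= u n.
have ub : ubound S B.
  by move=> x /(_ 0%N)[n _ /le_trans]; apply; apply: le_trans (ler_norm _) (hB n).
have hS : has_sup S.
  split; last by exists B.
  exists (- B) => n0; exists n0 => //; have := hB n0; rewrite ler_norml; by case/andP.
pose l := sup S.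
have near k n0 : exists n, (n0 <= n)%N /\ `|u n - l| < k.+1%:R^-1.
  set e := k.+1%:R^-1; have e0 : 0 < e by rewrite invr_gt0.
  have [x Sx lx] := sup_adherent e0 hS.
  have : ~ S (l + e / 2).
    move=> Sl; have := sup_upper_bound hS Sl; rewrite -/l; lra.
  move=> /existsNP[n1 /forall2NP h1].
  have [n le xn] := Sx (maxn n0 n1); rewrite geq_max in le; case/andP: le => l0 l1.
  exists n; split=> //; rewrite ltr_norml; apply/andP; split; first by rewrite -/l in lx; lra.
  have [//|/negP] := h1 n; rewrite -ltNge; lra.
pose pick k n0 := projT1 (cid (near k n0)).
have pickP k n0 : (n0 <= pick k n0)%N /\ `|u (pick k n0) - l| < k.+1%:R^-1.
  by rewrite /pick; case: (cid _).
pose phi := fix phi k := if k is k'.+1 then pick k (phi k').+1 else pick 0%N 0%N.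
exists phi; first by move=> n; exact: (pickP n.+1 (phi n).+1).1.
exists l => e /invr_small[n0 h0]; exists n0 => n /h0; apply: lt_trans.
by case: n => [|n]; exact: (pickP _ _).2.
Qed.

Theorem complex_bolzano_weierstrass : bolzano_weierstrass (@Normc.normc R).
Proof.
move=> u B hB.
have [|phi hphi [a ha]] := @real_bolzano_weierstrass (fun n => complex.Re (u n)) B.
  by move=> n; apply: le_trans (hB n); exact: (coord_le_normc _).1.
have [|psi hpsi [b hb]] := @real_bolzano_weierstrass (fun n => complex.Im (u (phi n))) B.
  by move=> n; apply: le_trans (hB _); exact: (coord_le_normc _).2.
exists (phi \o psi); first exact: increasing_seq_comp.
exists (a +i* b)%C => e e0.
have e2 : 0 < e / 2 by rewrite divr_gt0.
have [n1 h1] := ha _ e2; have [n2 h2] := hb _ e2.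
exists (maxn n1 n2) => n; rewrite geq_max => /andP[m1 m2].
apply: le_lt_trans (normc_le_sum _) _.
have := h1 (psi n) (leq_trans m1 (increasing_seq_ge hpsi n)); have := h2 n m2 => /=.
case: (u (phi (psi n))) => x y /=; lra.
Qed.

Lemma imaginary_lattice (k l : int) : (k, l) != (0, 0) ->
  1 <= Normc.normc (k%:~R + l%:~R * (0 +i* 1)%C : R[i]).
Proof.
move=> h.
have -> : k%:~R + l%:~R * (0 +i* 1)%C = (k%:~R +i* l%:~R)%C :> R[i].
  rewrite -!(rmorph_int (real_complex R)); simpc; congr (_ +i* _)%C; ring.
rewrite /= -[X in X <= _]sqrtr1 ler_sqrt ?addr_ge0 ?sqr_ge0 // -!rmorphXn -intrD ler1z.
have : k ^+ 2 + l ^+ 2 != 0.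
  by rewrite paddr_eq0 ?sqr_ge0 // !expf_eq0 /=; apply: contra h => /andP[/eqP-> /eqP->].
by have := sqr_ge0 k; have := sqr_ge0 l; lia.
Qed.

Lemma normc_i : Normc.normc ((0 +i* 1)%C : R[i]) <= 1.
Proof. by rewrite /= expr0n expr1n add0r sqrtr1. Qed.

End ComplexNorm.

(** * Beauville pieces *)

Section ClassMap.

Variables (K : closedFieldType) (X : projVariety K).

Lemma CH0_class_scale q (a : cycle0 X) : CH0_class (q *: a) = q *: CH0_class a.
Proof. exact: CH0_classZ. Qed.

Lemma CH0_class0 : CH0_class (0 : cycle0 X) = 0.
Proof. by rewrite -(scale0r (0 : cycle0 X)) CH0_class_scale scale0r. Qed.

Lemma CH0_classB (a b : cycle0 X) : CH0_class (a - b) = CH0_class a - CH0_class b.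
Proof. by rewrite -[- b]scaleN1r CH0_classD CH0_class_scale scaleN1r. Qed.

Lemma CH0_class_sum (I : Type) (r : seq I) (P : pred I) (F : I -> cycle0 X) :
  CH0_class (\sum_(i <- r | P i) F i) = \sum_(i <- r | P i) CH0_class (F i).
Proof. by apply: big_morph; [exact: CH0_classD | exact: CH0_class0]. Qed.

Lemma CH0_class_eq0 (a : cycle0 X) : CH0_class a = 0 <-> rat_trivial a.
Proof. by rewrite -CH0_class0 CH0_classP subr0. Qed.

End ClassMap.

Section Multiplication.

Variables (R : realType) (K : closedFieldType) (nrm : K -> R).
Hypothesis hn : is_norm nrm.
Variables (A : abelianVariety K) (g : nat).
Notation c := (@av_coord K A).
Hypothesis dimA : has_dim c g.

Lemma norm_nat_neq0 n : n.+1%:R != 0 :> K.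
Proof.
by apply/eqP => h; have /eqP := nrm_nat hn n.+1; rewrite h (nrm0 hn) eq_sym pnatr_eq0.
Qed.

(** For [k = 0] and [g > 0] the pull-back is 0 by definition. For other [k] even the zero cycle
    needs fibre multiplicities to exist, which they do because [[k]] is etale. *)
Lemma zero_in_beauville_piece s : (0 < g)%N -> @beauville_piece K A g s 0.
Proof.
move=> g0 k; exists 0, 0; rewrite scaler0 CH0_class0; split=> //.
rewrite /pullback_cycle g0 andbT; case: eqP => // /eqP k0 x; exists 1%N; last by rewrite !coeff0 mulr0.
have [p p0] := exists_coord (@av_coord_neq0 K A 0).
apply: (fibre_mult_mulz p0).
case: k k0 => [[|n]|n] // _; first exact: norm_nat_neq0.
by rewrite NegzE rmorphN oppr_eq0; exact: norm_nat_neq0.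
Qed.

Definition torsion_list n (ker : seq A) := uniq ker /\ forall z, (z \in ker) = (z *+ n == 0).

Lemma torsion_list_exists s (a : CH0 A) n : @beauville_piece K A g s a -> a != 0 ->
  exists ker, torsion_list n.+1 ker.
Proof.
move=> ha a0; have [al [be [_ e2 hp]]] := ha n.+1.
apply: (pullback_finite_kernel (norm_nat_neq0 n) hp); apply: contra_neq a0 => b0.
move/esym/eqP: e2; rewrite b0 CH0_class0 scaler_eq0 expf_eq0 => /orP[/andP[_]|/eqP //].
by rewrite -pmulrn pnatr_eq0.
Qed.

(** Push-forward after pull-back is multiplication by the order of the kernel. The bound on [s]
    makes the truncated subtraction in the exponent exact. *)
Lemma push_beauville s (a : CH0 A) n ker : @beauville_piece K A g s a -> (s <= 2 * g)%N ->
  torsion_list n.+1 ker ->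
  @push_class K A A (@mulz_pt K A n.+1) a = ((size ker)%:R / n.+1%:R ^+ (2 * g) * n.+1%:R ^+ s) *: a.
Proof.
move=> ha sg [uker hker]; have [al [be [e1 e2 hp]]] := ha n.+1.
have surj := multiplication_surjective hn dimA hker.
have mk := @morphism_mulz K A n.+1.
have := congr1 (@CH0_class K A) (push_pullback (norm_nat_neq0 n) uker hker surj hp).
rewrite CH0_class_scale e1 -(@push_classE K A A _ mk) e2 (@push_classZ K A A _ mk) -pmulrn => h.
have n0 : n.+1%:R != 0 :> rat by rewrite pnatr_eq0.
apply: (@scalerI _ _ (n.+1%:R ^+ (2 * g - s))); first by rewrite expf_neq0.
rewrite h scalerA; congr (_ *: _).
by rewrite -{2}(subnK sg) exprD; field; rewrite !expf_neq0.
Qed.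

Lemma push_class_mulzM k l (a : CH0 A) :
  @push_class K A A (@mulz_pt K A (k * l)%N) a =
  @push_class K A A (@mulz_pt K A k) (@push_class K A A (@mulz_pt K A l) a).
Proof.
rewrite -(CH0_class_repr a) !(@push_classE K A A) ?push_cycle_comp; try exact: morphism_mulz.
congr CH0_class; rewrite !push_cycleE; apply: eq_bigr => x _.
by rewrite /= /mulz_pt -!pmulrn mulnC mulrnA.
Qed.

End Multiplication.

Section Converse.

Variables (R : realType) (K : closedFieldType) (nrm : K -> R).
Hypothesis hn : is_norm nrm.
Hypothesis BW : bolzano_weierstrass nrm.
Variable I : K.
Hypothesis I1 : nrm I <= 1.
Hypothesis lattice : forall k l : int, (k, l) != (0, 0) -> 1 <= nrm (k%:~R + l%:~R * I).
Variables (A : abelianVariety K) (g m : nat) (x y : 'I_m -> A).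
Hypothesis dimA : has_dim (@av_coord K A) g.

Lemma filtration_difference_eq0 :
  @eq_mod_filtration K A g m.+1 (\sum_i @pt_class K A (x i)) (\sum_i @pt_class K A (y i)) ->
  \sum_i @pt_class K A (x i) = \sum_i @pt_class K A (y i).
Proof.
move=> [a [ha ea]].
(* If all components vanish, the two sums agree. Otherwise one nonzero component makes all the
   kernels finite and determines the multipliers. *)
have [/existsP[s0 /andP[hs0 as0]]|] := boolP [exists s : 'I_g.+1, (m < s)%N && (a s != 0)]; last first.
  move=> /existsPn h; apply/eqP; rewrite -subr_eq0 ea big_nat big1 // => s /andP[ms sg].
  by have := h (Ordinal sg); rewrite ms /= negbK => /eqP.
have pc0 : @beauville_piece K A g s0 (a s0) by apply: ha; rewrite hs0 -ltnS ltn_ord.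
have chk n : exists ker : seq A, torsion_list n.+1 ker by exact: (torsion_list_exists hn n pc0 as0).
pose ker n := projT1 (cid (chk n)).
have kerP n : torsion_list n.+1 (ker n) by rewrite /ker; case: (cid _).
have ker0 n : (0 < size (ker n))%N.
  have [_ h] := kerP n; have : 0 \in ker n by rewrite h mul0rn.
  by case: (ker n).
pose mu k : rat := (size (ker k.-1))%:R / k%:R ^+ (2 * g).
have push s k : (m < s < g.+1)%N -> (0 < k)%N ->
    @push_class K A A (@mulz_pt K A k) (a s) = (mu k * k%:R ^+ s) *: a s.
  move=> /andP[ms sg]; case: k => // n _; apply: (push_beauville hn dimA (ha s _) _ (kerP n)).
    by rewrite ms -ltnS.
  by move: sg; rewrite ltnS => h; apply: leq_trans h _; rewrite mul2n -addnn leq_addr.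
have hs1 : (m < s0 < g.+1)%N by rewrite hs0 ltn_ord.
(* Multiplicativity is read off from [[k l] = [k] [l]] acting on the nonzero class [a s0], without
   comparing kernels. *)
have muM k l : mu (k.+1 * l.+1)%N = mu k.+1 * mu l.+1.
  have := push s0 (k.+1 * l.+1)%N hs1 isT.
  rewrite push_class_mulzM push // (@push_classZ K A A _ (@morphism_mulz K A _)) push // scalerA.
  move=> /eqP; rewrite -subr_eq0 -scalerBl scaler_eq0 (negbTE as0) orbF subr_eq0 => /eqP e.
  have nz : (k.+1 * l.+1)%:R ^+ s0 != 0 :> rat by rewrite expf_neq0 // pnatr_eq0.
  apply: (mulIf nz); rewrite -e natrM exprMn; ring.
have mu1 : mu 1%N = 1.
  have [u h] := kerP 0%N; have -> : mu 1%N = (size [:: 0 : A])%:R.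
    rewrite /mu expr1n divr1 /=; congr (_%:R); apply: (perm_size (_ : perm_eq _ [:: 0])).
    by apply: uniq_perm => // z; rewrite h mulr1n inE.
  by [].
have mu2 : 1 <= mu 2%N.
  have := torsion_lower_bound hn BW I1 lattice dimA (kerP 1%N).2.
  rewrite /mu ler_pdivlMr ?exprn_gt0 // mul1r => h.
  by rewrite exprM -natrX -natrX ler_nat.
have mu0 k : mu k.+1 != 0.
  by rewrite /mu mulf_neq0 ?invr_eq0 ?expf_neq0 // pnatr_eq0 // -lt0n.
(* One finite list of variables has to express the given points and representatives of all the
   components. *)
pose zs : seq A := [seq x i | i <- enum 'I_m] ++ [seq y i | i <- enum 'I_m]
  ++ flatten [seq dom (repr (a s)) | s <- index_iota m.+1 g.+1].
pose z (i : 'I_(size zs)) : A := tnth (in_tuple zs) i.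
have zP t : t \in zs -> exists i, z i = t.
  by move=> h; have /tnthP[i ->] : t \in in_tuple zs by []; exists i.
have [X hX] : exists X : 'I_m -> 'I_(size zs), forall i, z (X i) = x i.
  have ch i : exists j, z j = x i by apply: zP; rewrite mem_cat map_f ?mem_enum.
  by exists (fun i => projT1 (cid (ch i))) => i; case: (cid _).
have [Y hY] : exists Y : 'I_m -> 'I_(size zs), forall i, z (Y i) = y i.
  have ch i : exists j, z j = y i by apply: zP; rewrite !mem_cat map_f ?mem_enum ?orbT.
  by exists (fun i => projT1 (cid (ch i))) => i; case: (cid _).
have chp s : exists p, (m < s < g.+1)%N -> mon_cycle z p = repr (a s).
  case hs : (m < s < g.+1)%N; last by exists 0.
  have [|p hp] := @mon_cycle_supported K A _ z (repr (a s)); last by exists p.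
  move=> t ht; apply: zP; rewrite !mem_cat; apply/orP; right; apply/orP; right.
  by apply/flattenP; exists (dom (repr (a s))) => //; apply: map_f; rewrite mem_index_iota.
pose p s := projT1 (cid (chp s)).
have pP s : (m < s < g.+1)%N -> mon_cycle z (p s) = repr (a s) by rewrite /p; case: (cid _).
have key : mon_ideal z (\sum_i 'X_(X i) - \sum_i 'X_(Y i)).
  apply: (@power_sum_multiplier _ (@mpolyC (size zs) rat) (mon_ideal z) m (fun i => 'X_(X i))
    (fun i => 'X_(Y i)) g.+1 p mu) => //; first exact: mon_ideal_is_ideal.
  move=> k; have mk := @morphism_mulz K A k.+1.
  have e (u : 'I_m -> A) (U : 'I_m -> 'I_(size zs)) : (forall i, z (U i) = u i) ->
      CH0_class (mon_cycle z (\sum_i 'X_(U i) ^+ k.+1)) =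
      @push_class K A A (@mulz_pt K A k.+1) (\sum_i @pt_class K A (u i)).
    move=> hU; rewrite mon_cycle_sum CH0_class_sum (@push_class_sum K A A _ mk).
    by apply: eq_bigr => i _; rewrite mon_cycleXn hU (@push_class_pt K A A _ mk).
  have e3 : CH0_class (mon_cycle z (\sum_(m.+1 <= s < g.+1) (mu k.+1 * k.+1%:R ^+ s)%:MP * p s)) =
      @push_class K A A (@mulz_pt K A k.+1) (\sum_(m.+1 <= s < g.+1) a s).
    rewrite mon_cycle_sum CH0_class_sum (@push_class_sum K A A _ mk) !big_nat.
    apply: eq_bigr => s hs; rewrite push // mul_mpolyC mon_cycleZ CH0_class_scale.
    by rewrite pP // CH0_class_repr.
  apply/CH0_class_eq0; rewrite mon_cycleB CH0_classB mon_cycleB CH0_classB [X in _ - X]e3.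
  rewrite [X in X - _ - _](e x X hX) [X in _ - X - _](e y Y hY).
  rewrite -[\sum_i pt_class (x i)](subrK (\sum_i @pt_class K A (y i))) ea.
  by rewrite (@push_classD K A A _ mk) addrK subrr.
have e (u : 'I_m -> A) (U : 'I_m -> 'I_(size zs)) : (forall i, z (U i) = u i) ->
    CH0_class (mon_cycle z (\sum_i 'X_(U i))) = \sum_i @pt_class K A (u i).
  move=> hU; rewrite mon_cycle_sum CH0_class_sum; apply: eq_bigr => i _.
  by rewrite -['X_(U i)]expr1 mon_cycleXn hU mulr1n.
apply/eqP; rewrite -subr_eq0 -(e x X) // -(e y Y) // -CH0_classB -mon_cycleB.
by apply/eqP/CH0_class_eq0.
Qed.

End Converse.

Theorem theorem1p6 (R : realType) (A : abelianVariety R[i]) (g : nat)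
    (hg : has_dim (@av_coord R[i] A) g)
    (m : nat) (hm : (1 <= m)%N) (x y : 'I_m -> A) :
  \sum_(i < m) @pt_class R[i] A (x i) = \sum_(i < m) @pt_class R[i] A (y i)
  <->
  @eq_mod_filtration R[i] A g m.+1
    (\sum_(i < m) @pt_class R[i] A (x i)) (\sum_(i < m) @pt_class R[i] A (y i)).
Proof.
split=> [e|]; last first.
  exact: (filtration_difference_eq0 (normc_is_norm R) (@complex_bolzano_weierstrass R)
    (@normc_i R) (@imaginary_lattice R)).
(* All components are 0. An index [s] with [m < s <= g] forces [g > 0], the case in which 0 is known
   to lie in every piece. *)
exists (fun=> 0); split; last by rewrite e subrr big1.
move=> s /andP[ms sg]; apply: (zero_in_beauville_piece (normc_is_norm R)).
by apply: leq_trans sg; apply: leq_trans ms.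
Qed.
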